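(* Let $(M,g)$ be a pseudo-Riemannian manifold. There is a one-to-one correspondence between para-Sasakian structures $(M,g,T)$ on $(M,g)$ and para-Kähler structures $(\widehat M,\widehat g,\widehat J)$ on the cone $(\widehat M,\widehat g)$. The correspondence is given by $T\mapsto\widehat J:=\widehat\nabla T$.
   Context: Manifolds are connected. The cone over $(M,g)$ is $\widehat M=\mathbb R^+\times M$ with metric $\widehat g=dr^2+r^2g$, $r$ the coordinate on $\mathbb R^+=(0,\infty)$, and $\widehat\nabla$ is its Levi-Civita connection; $\nabla$ is the Levi-Civita connection of $g$. A vector field $T$ on $M$ is also regarded as an ($r$-independent) vector field on $\widehat M$ tangent to $M$, and $\widehat\nabla T$ denotes the endomorphism field $U\mapsto\widehat\nabla_UT$. Signature $(p,q)$ means $p$ negative (time-like) and $q$ positive (space-like) directions. A para-complex structure on a finite-dimensional real vector space $V$ is $J\in \mathrm{End}(V)$ with $J^2=\mathrm{Id}$ whose two eigenspaces $V^\pm=\ker(\mathrm{Id}\mp J)$ have the same dimension. An almost para-complex structure on a distribution $\mathcal V\subset TM$ is a field $J\in\Gamma(\mathrm{End}\,\mathcal V)$ of para-complex structures; it is called integrable (or a para-complex structure on $\mathcal V$) if the eigen-distributions $\mathcal V^\pm=\ker(\mathrm{Id}\mp J)$ are involutive. A para-Kähler structure $(N,h,J)$ on a pseudo-Riemannian manifold $(N,h)$ is a para-complex structure $J$ on $TN$ with $h(J\cdot,J\cdot)=-h$ which is parallel with respect to the Levi-Civita connection of $h$. A para-Sasakian structure $(M,g,T)$ consists of a pseudo-Riemannian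 manifold $(M,g)$ of signature $(n+1,n)$, where $n+1$ is the number of time-like dimensions, and a time-like geodesic unit Killing vector field $T$ (so $g(T,T)=-1$, $\nabla_TT=0$) such that $\nabla T$ defines an integrable para-complex structure $J=\nabla T|_E:E\to E$ on $E=T^\perp$. *)

(* Defs.v *)
From mathcomp Require Import all_boot all_order all_algebra.
From mathcomp Require Import all_classical all_reals all_analysis.

Set Implicit Arguments.
Unset Strict Implicit.
Unset Printing Implicit Defensive.

Import Order.TTheory GRing.Theory Num.Theory.
Import numFieldNormedType.Exports.

Local Open Scope classical_set_scope.
Local Open Scope ring_scope.

Fixpoint Ck {R : realType} {m : nat} {W : normedModType R} (k : nat)
    (U : set 'rV[R]_m) (f : 'rV[R]_m -> W) : Prop :=
  match k with
  | 0 => forall u, U u -> {for u, continuous f}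
  | k'.+1 => (forall u, U u -> differentiable f u) /\
             (forall i : 'I_m, Ck k' U (fun u => 'D_(delta_mx 0 i) f u))
  end.

Definition smooth_on {R : realType} {m : nat} {W : normedModType R}
    (U : set 'rV[R]_m) (f : 'rV[R]_m -> W) : Prop :=
  forall k, Ck k U f.

(* An atlas with one preferred chart around every point p (different points   *)
(* may share a chart); every atlas contains such a family, and it determines  *)
(* the smooth structure. The chart around p has domain [cdom p], coordinate   *)
(* map [cmap p] and inverse [cinv p]; the values of [cmap p] outside [cdom p] *)
(* and of [cinv p] outside the image of [cdom p] are irrelevant.              *)
Record charts (R : realType) (m : nat) (M : Type) := Charts {
  cdom : M -> set M ;
  cmap : M -> M -> 'rV[R]_m ;
  cinv : M -> 'rV[R]_m -> M }.

Record connected_manifold {R : realType} {m : nat} {M : topologicalType}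
    (A : charts R m M) : Prop := ConnectedManifold {
  manifold_hausdorff : hausdorff_space M ;
  manifold_second_countable : @second_countable M ;
  manifold_connected : connected [set: M] ;
  cdom_center : forall p, cdom A p p ;
  cdom_open : forall p, open (cdom A p) ;
  cimg_open : forall p, open (cmap A p @` cdom A p) ;
  cmapK : forall p q, cdom A p q -> cinv A p (cmap A p q) = q ;
  cmap_continuous : forall p q, cdom A p q -> {for q, continuous (cmap A p)} ;
  cinv_continuous : forall p u, (cmap A p @` cdom A p) u ->
    {for u, continuous (cinv A p)} ;
  transition_smooth : forall p q,
    smooth_on (cmap A p @` (cdom A p `&` cdom A q)) (cmap A q \o cinv A p) }.

(* The tangent space at p is 'rV[R]_m, a tangent vector being given by its    *)
(* components in the preferred chart around p. So vector fields are functions *)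
(* M -> 'rV[R]_m, while (0,2)-tensor fields (Gram matrices), endomorphism     *)
(* fields (acting by v *m J p) and distributions (as row spaces) are          *)
(* functions M -> 'M[R]_m.                                                    *)
Section Calculus.
Context {R : realType} {m : nat} {M : topologicalType} (A : charts R m M).
Implicit Types (p q : M) (v w : 'rV[R]_m) (X Y Z T : M -> 'rV[R]_m).
Implicit Types (f : M -> R) (U : set M) (g J V : M -> 'M[R]_m).
Implicit Types D : M -> 'rV[R]_m -> (M -> 'rV[R]_m) -> 'rV[R]_m.

(* components, in the chart around q, of a tangent vector v at p *)
Definition tcomp q p v : 'rV[R]_m :=
  'D_v (cmap A q \o cinv A p) (cmap A p p).

Definition local_rep q X (u : 'rV[R]_m) : 'rV[R]_m :=
  tcomp q (cinv A q u) (X (cinv A q u)).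

(* [smooth_fun U] and [smooth_vf U] are meant for open U, and only depend on  *)
(* the values on U.                                                           *)
Definition smooth_fun U f : Prop :=
  forall q, smooth_on (cmap A q @` (cdom A q `&` U)) (f \o cinv A q : _ -> R^o).

Definition smooth_vf U X : Prop :=
  forall q, smooth_on (cmap A q @` (cdom A q `&` U)) (local_rep q X).

Definition dfun f p v : R :=
  'D_v (f \o cinv A p : _ -> R^o) (cmap A p p).

(* [X, Y]^k = X^i d_i Y^k - Y^i d_i X^k, in the chart around p *)
Definition lie_bracket X Y p : 'rV[R]_m :=
  'D_(X p) (local_rep p Y) (cmap A p p) - 'D_(Y p) (local_rep p X) (cmap A p p).

Definition ip g p v w : R := (v *m g p *m w^T) 0 0.

Record pseudo_riemannian g : Prop := PseudoRiemannian {
  metric_sym : forall p, (g p)^T = g p ;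
  metric_nondegenerate : forall p, g p \in unitmx ;
  metric_smooth : forall U X Y, open U -> smooth_vf U X -> smooth_vf U Y ->
    smooth_fun U (fun p => ip g p (X p) (Y p)) }.

(* [D p v Y] is the derivative of Y at p in direction v. It is constrained    *)
(* only for fields Y smooth near p; its locality in Y follows from the        *)
(* Leibniz rule, f being arbitrary away from U.                               *)
Record affine_connection D : Prop := AffineConnection {
  conn_linear : forall U p (a : R) v w Y, open U -> U p -> smooth_vf U Y ->
    D p (a *: v + w) Y = a *: D p v Y + D p w Y ;
  conn_add : forall U p v Y Z, open U -> U p -> smooth_vf U Y ->
    smooth_vf U Z -> D p v (fun q => Y q + Z q) = D p v Y + D p v Z ;
  conn_leibniz : forall U p v f Y, open U -> U p -> smooth_fun U f ->
    smooth_vf U Y ->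
    D p v (fun q => f q *: Y q) = dfun f p v *: Y p + f p *: D p v Y ;
  conn_smooth : forall U X Y, open U -> smooth_vf U X -> smooth_vf U Y ->
    smooth_vf U (fun p => D p (X p) Y) }.

Record levi_civita g D : Prop := LeviCivita {
  lc_connection : affine_connection D ;
  lc_torsion_free : forall U p X Y, open U -> U p -> smooth_vf U X ->
    smooth_vf U Y -> D p (X p) Y - D p (Y p) X = lie_bracket X Y p ;
  lc_metric : forall U p v Y Z, open U -> U p -> smooth_vf U Y ->
    smooth_vf U Z ->
    dfun (fun q => ip g q (Y q) (Z q)) p v =
      ip g p (D p v Y) (Z p) + ip g p (Y p) (D p v Z) }.

Definition nabla D T p : 'M[R]_m :=
  lin1_mx (fun v => D p v T).

(* s negative and t positive directions *)
Definition has_signature (s t : nat) (G : 'M[R]_m) : Prop :=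
  (s + t)%N = m /\
  exists2 P : 'M[R]_m, P \in unitmx &
    P *m G *m P^T = diag_mx (\row_i (if (i < s)%N then -1 else 1)).

Definition section_on U V X : Prop := forall p, U p -> (X p <= V p)%MS.

Definition involutive_distribution V : Prop :=
  forall U X Y, open U -> smooth_vf U X -> smooth_vf U Y ->
    section_on U V X -> section_on U V Y -> section_on U V (lie_bracket X Y).

Definition eigen_distribution V J (a : R) p : 'M[R]_m :=
  (V p :&: eigenspace (J p) a)%MS.

(* Only the restriction of J p to the row space of V p matters here. *)
Record almost_para_complex V J : Prop := AlmostParaComplex {
  apc_stable : forall p, stablemx (V p) (J p) ;
  apc_involution : forall p, V p *m J p *m J p = V p ;
  apc_rank : forall p, \rank (eigen_distribution V J 1 p) =
                       \rank (eigen_distribution V J (-1) p) ;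
  apc_smooth : forall U X, open U -> smooth_vf U X -> section_on U V X ->
    smooth_vf U (fun p => X p *m J p) }.

Record para_complex V J : Prop := ParaComplex {
  pc_almost : almost_para_complex V J ;
  pc_plus_involutive : involutive_distribution (eigen_distribution V J 1) ;
  pc_minus_involutive : involutive_distribution (eigen_distribution V J (-1)) }.

Definition killing g T : Prop :=
  forall U p X Y, open U -> U p -> smooth_vf U X -> smooth_vf U Y ->
    dfun (fun q => ip g q (X q) (Y q)) p (T p) =
      ip g p (lie_bracket T X p) (Y p) + ip g p (X p) (lie_bracket T Y p).

Definition orthogonal_distribution g T p : 'M[R]_m :=
  kermx (g p *m (T p)^T).

Record para_sasakian g D T : Prop := ParaSasakian {
  ps_signature : exists n, forall p, has_signature n.+1 n (g p) ;
  ps_smooth : smooth_vf [set: M] T ;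
  ps_unit : forall p, ip g p (T p) (T p) = -1 ;
  ps_geodesic : forall p, D p (T p) T = 0 ;
  ps_killing : killing g T ;
  ps_para_complex :
    para_complex (orthogonal_distribution g T) (nabla D T) }.

Record para_kahler g D J : Prop := ParaKahler {
  pk_para_complex : para_complex (fun=> 1%:M) J ;
  pk_anti_isometry : forall p v w, ip g p (v *m J p) (w *m J p) = - ip g p v w ;
  pk_parallel : forall U p v X, open U -> U p -> smooth_vf U X ->
    D p v (fun q => X q *m J q) = D p v X *m J p }.

End Calculus.

Section Cone.
Context {R : realType} {m : nat} {M : topologicalType}.

Definition pos_reals : set R := [set r | 0 < r].

Definition cone : topologicalType := (pos_reals * M)%type.

(* The chart around (r, x) is the identity on the first factor times the      *)
(* chart around x; the first component of a tangent vector is the one along   *)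
(* d/dr. [insubd r s] is s as a positive real, and r if s <= 0.               *)
Definition cone_charts (A : charts R m M) : charts R (1 + m) cone :=
  Charts (fun z => [set y | cdom A z.2 y.2])
         (fun z y => row_mx (set_val y.1)%:M (cmap A z.2 y.2))
         (fun z u => (insubd z.1 (lsubmx u 0 0), cinv A z.2 (rsubmx u))).

Definition cone_metric (g : M -> 'M[R]_m) (z : cone) : 'M[R]_(1 + m) :=
  block_mx 1%:M 0 0 (set_val z.1 ^+ 2 *: g z.2).

Definition cone_lift (T : M -> 'rV[R]_m) (z : cone) : 'rV[R]_(1 + m) :=
  row_mx 0 (T z.2).

End Cone.
Arguments cone R M : clear implicits.

(* Main.v *)
(* On the cone, for X tangent to M,
     nabla^_(a d/dr + v) X = (a / r) X + nabla_v X - r g(v, X) d/dr,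
   and nabla^_U (r d/dr) = U. Hence for J^ = nabla^ T, nabla^ J^ vanishes on d/dr,
   while (nabla^_v J^) Y has d/dr-component - r (g(Y, nabla_v T) + g(v, nabla_Y T))
   and M-component nabla^2_(v,Y) T - g(Y, T) v + g(v, Y) T: J^ is parallel if and
   only if T is Killing and satisfies the Sasakian equation
     nabla^2_(x,y) T = g(y, T) x - g(x, y) T.
   A para-Sasakian T satisfies it. Indeed the difference C(x, y, z) of both sides,
   paired with z, is skew in y, z, has vanishing cyclic sums because
   d (d g(T, .)) = 0, and vanishes as soon as one argument is T. On E = T^perp,
   differentiating J^2 = 1 gives C = 0 when y and z lie in different eigenspaces
   of J = nabla T, and involutivity makes C symmetric in x, y when both lie in the
   same one; the remaining cases follow from the cyclic identity.
   Conversely a para-Kaehler J^ on the cone is nabla^ T for T = J^ (r d/dr), a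
   field which is orthogonal to d/dr and does not depend on r. The identities
   J^^2 = 1 and g^(J^ ., .) = - g^(., J^ .) then contain all the pointwise
   conditions on T. Equality of the ranks of the eigenspaces is automatic for
   skew endomorphisms. *)
From HB Require Import structures.
Require Import Defs.
From mathcomp Require Import all_boot all_order all_algebra.
From mathcomp Require Import all_classical all_reals all_analysis.
From mathcomp Require Import ring lra.

Set Implicit Arguments.
Unset Strict Implicit.
Unset Printing Implicit Defensive.

Import Order.TTheory GRing.Theory Num.Theory.
Import numFieldNormedType.Exports.

Local Open Scope classical_set_scope.
Local Open Scope ring_scope.

(** Once tensoriality is available, the argument is pointwise linear algebra. The obstacle is to get
    there: [D] and [Dh] act on arbitrary functions, whose values are components in a different chart
    at every point, and they are constrained only where fields are smooth. Indicator functions that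
    are constant near the point in question take the place of bump functions and give both locality
    and dependence on the value at the point. [Dh] is just some Levi-Civita connection of the cone
    metric, so its Christoffel symbols have to be deduced from symmetry and metric compatibility.
    That T^ = J^ (r d/dr) does not depend on r comes from the connection: J^ is parallel and nabla^
    (r d/dr) is the identity, so nabla^_(d/dr) T^ = J^ (d/dr) = T^ / r. This is exactly the
    Christoffel contribution, hence the components of T^ have zero derivative along each ray. The
    signature (n+1, n) has to be produced in the converse direction: the two eigenspaces of J are
    isotropic and dually paired, so E is a sum of hyperbolic planes, and T adds one negative
    direction. *)

Section Differentiability.
Context {R : realType}.

(** The little-o expansion of [f] at [a] is also one of [h], because the functions agree at all
    nearby points and at [a] itself; [diff_unique] then identifies the differential of [h]. *)
Lemma near_eq_differentiable (V W : normedModType R) (f h : V -> W) (a : V) :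
  {near a, f =1 h} -> differentiable f a -> differentiable h a.
Proof.
move=> fh df.
have h_locally : h \o shift a = cst (h a) + 'd f a +o_ 0 id.
  have /eqaddoP fo := diff_locally df.
  apply/eqaddoP => e e0.
  have := fo e e0.
  have hs : \forall y \near (0 : V), f (y + a) = h (y + a).
    by have := fh; rewrite (near_shift 0 a)/= subr0; exact.
  apply: filter_app; apply: filter_app hs; apply: nearW => y fhy.
  by rewrite !fctE/= fhy (nbhs_singleton fh).
have dE := diff_unique (diff_continuous df) h_locally.
apply/diff_locallyP; rewrite dE; split => //; exact: diff_continuous df.
Qed.

Lemma linear_continuous m (W : normedModType R)
    (f : {linear 'rV[R]_m -> W}) : continuous f.
Proof.
pose F (i : 'I_m) (v : 'rV[R]_m) := v 0 i *: f (delta_mx 0 i) : W.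
have -> : f = \sum_(i < m) F i :> (_ -> _).
  apply/funext => v; rewrite {1}(row_sum_delta v) linear_sum fct_sumE.
  by apply: eq_bigr => i _; rewrite linearZ.
move=> v; apply: differentiable_continuous; apply: differentiable_sum => i.
by apply: differentiableZl; exact: differentiable_coord.
Qed.

Lemma derive_line (V W : normedModType R) (f : V -> W) (u v : V) (s : R) :
  differentiable f (u + s *: v) ->
  is_derive s 1 (fun t : R => f (u + t *: v)) ('D_v f (u + s *: v)).
Proof.
move=> df.
have -> : (fun t : R => f (u + t *: v)) = f \o (cst u + ( *:%R^~ v)) by [].
have hd : is_diff s (cst u + ( *:%R^~ v) : R -> V) (0 + ( *:%R^~ v)).
  by apply: is_diffD; exact: is_diff_scalel.
have hf : is_diff ((cst u + ( *:%R^~ v) : R -> V) s) f ('d f (u + s *: v)).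
  exact: DiffDef.
have [dfc dfE] := is_diff_comp hd hf.
apply: DeriveDef; first exact: diff_derivable.
by rewrite deriveE // dfE /= deriveE // !fctE add0r scale1r.
Qed.

End Differentiability.

(** * Calculus of C^k maps on R^m *)

Section SmoothCalculus.
Context {R : realType}.

Lemma CkS m (W : normedModType R) k (U : set 'rV[R]_m) (f : 'rV[R]_m -> W) :
  Ck k.+1 U f -> Ck k U f.
Proof.
elim: k f => [|k IH] f [df Df].
  by move=> u Uu; apply: differentiable_continuous; exact: df.
by split=> // i; exact: IH.
Qed.

(** All clauses of [Ck] are pointwise statements about a globally defined function, so they can be
    checked on any set that contains the point. *)
Lemma Ck_local m (W : normedModType R) k (U : set 'rV[R]_m) (f : 'rV[R]_m -> W) :
  (forall u, U u -> exists2 V : set 'rV[R]_m, V u & Ck k V f) -> Ck k U f.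
Proof.
elim: k f => [|k IH] f H.
  by move=> u /[dup] Uu /H[V Vu]; exact.
split; first by move=> u /[dup] Uu /H[V Vu [+ _]]; exact.
by move=> i; apply: IH => u /H[V Vu [_ Vf]]; exists V => //; exact: Vf.
Qed.

(** On an open set, equality of functions is equality of germs and so passes to all partial
    derivatives. *)
Lemma Ck_eq m (W : normedModType R) k (U : set 'rV[R]_m)
    (f h : 'rV[R]_m -> W) :
  open U -> (forall u, U u -> f u = h u) -> Ck k U f -> Ck k U h.
Proof.
move=> oU; elim: k f h => [|k IH] f h fh.
  move=> cf u Uu; have := cf u Uu.
  rewrite /prop_for /continuous_at (fh u Uu) => cfu; apply: cvg_trans cfu.
  have : {near u, f =1 h} by near=> v; apply: fh; near: v; exact: open_nbhs_nbhs.
  by move=> fhu; apply: (near_eq_cvg fhu).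
have fhn u : U u -> {near u, f =1 h}.
  by move=> Uu; near=> v; apply: fh; near: v; exact: open_nbhs_nbhs.
move=> [df Df]; split.
  by move=> u Uu; apply: near_eq_differentiable (df u Uu); exact: fhn.
move=> i; apply: IH (Df i) => u Uu.
by apply: near_eq_derive; exact: fhn.
Unshelve. all: by end_near. Qed.

Lemma Ck_cst m (W : normedModType R) k (U : set 'rV[R]_m) (w : W) :
  Ck k U (fun=> w).
Proof.
elim: k w => [|k IH] w; first by move=> u _; exact: cst_continuous.
split; first by move=> u _; exact: (differentiable_cst w).
move=> i; pose h (u : 'rV[R]_m) := 'D_(delta_mx 0 i) (fun=> w) u.
have hE : h = fun=> 0 by apply/funext => u; exact: derive_cst.
rewrite -/h hE; exact: IH.
Qed.

Lemma CkD m (W : normedModType R) k (U : set 'rV[R]_m) (f h : 'rV[R]_m -> W) :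
  open U -> Ck k U f -> Ck k U h -> Ck k U (fun u => f u + h u).
Proof.
move=> oU; elim: k f h => [|k IH] f h.
  by move=> cf ch u Uu; exact: (continuousD (cf u Uu) (ch u Uu)).
move=> [df Df] [dh Dh]; split.
  by move=> u Uu; apply: differentiableD; [exact: df|exact: dh].
move=> i; apply: (Ck_eq oU _ (IH _ _ (Df i) (Dh i))) => u Uu.
by rewrite [RHS]deriveD //; apply: diff_derivable; [exact: df|exact: dh].
Qed.

(** Scaling as a named map, so that it can carry a bilinear structure; the differential of a
    continuous bilinear map then yields the product rule. *)
Let scale_fun (W : normedModType R) (a : R^o) (w : W) : W := a *: w.

Let scale_fun_is_bilinear (W : normedModType R) :
  bilinear_for
    (GRing.Scale.Law.clone _ _ *:%R _) (GRing.Scale.Law.clone _ _ *:%R _)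
    (@scale_fun W).
Proof.
split=> [u'|u] a x y /=; rewrite /scale_fun; first by rewrite scalerDl scalerA.
by rewrite scalerDr !scalerA mulrC.
Qed.

HB.instance Definition _ (W : normedModType R) :=
  bilinear_isBilinear.Build R R^o W W _ _ (@scale_fun W)
    (@scale_fun_is_bilinear W).

Lemma is_diff_scale (V W : normedModType R) (a : V -> R^o) (f : V -> W) u :
  differentiable a u -> differentiable f u ->
  is_diff u (fun u => a u *: f u)
            (fun v => a u *: 'd f u v + 'd a u v *: f u).
Proof.
move=> da df.
have -> : (fun u => a u *: f u) =
    (fun p => @scale_fun W p.1 p.2) \o (fun y => (a y, f y)) by [].
have cB : continuous (fun p : R^o * W => @scale_fun W p.1 p.2).
  exact: scale_continuous.
have dB : is_diff (a u, f u) (fun p : R^o * W => @scale_fun W p.1 p.2)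
    (fun q => a u *: q.2 + q.1 *: f u).
  by apply: DiffDef; [exact: differentiable_bilin|rewrite diff_bilin].
have [dc dcE] := is_diff_comp (is_diff_pair (differentiableP da)
  (differentiableP df)) dB.
by apply: DiffDef => //; rewrite dcE.
Qed.

Lemma differentiable_scale (V W : normedModType R) (a : V -> R^o)
    (f : V -> W) u :
  differentiable a u -> differentiable f u ->
  differentiable (fun u => a u *: f u) u.
Proof. by move=> da df; have [] := is_diff_scale da df. Qed.

Lemma derive_scale (V W : normedModType R) (a : V -> R^o) (f : V -> W) u v :
  differentiable a u -> differentiable f u ->
  'D_v (fun u => a u *: f u) u = 'D_v a u *: f u + a u *: 'D_v f u.
Proof.
move=> da df; have [dc dcE] := is_diff_scale da df.
by rewrite !deriveE // dcE addrC.
Qed.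

(** The product rule involves the factors themselves next to their derivatives; [CkS] lowers the
    factors to the order at which the induction hypothesis applies. *)
Lemma CkZ m (W : normedModType R) k (U : set 'rV[R]_m) (a : 'rV[R]_m -> R^o)
    (f : 'rV[R]_m -> W) :
  open U -> Ck k U a -> Ck k U f -> Ck k U (fun u => a u *: f u).
Proof.
move=> oU; elim: k a f => [|k IH] a f.
  by move=> ca cf u Uu; exact: (cvgZ (ca u Uu) (cf u Uu)).
move=> /[dup] /CkS Ca [da Da] /[dup] /CkS Cf [df Df]; split.
  by move=> u Uu; apply: differentiable_scale; [exact: da|exact: df].
move=> i; apply: (Ck_eq oU _ (CkD oU (IH _ _ (Da i) Cf) (IH _ _ Ca (Df i)))).
by move=> u Uu; rewrite derive_scale //; [exact: da|exact: df].
Qed.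

Lemma Ck_sum m (W : normedModType R) k (U : set 'rV[R]_m) (I : Type)
    (s : seq I) (f : I -> 'rV[R]_m -> W) :
  open U -> (forall i, Ck k U (f i)) -> Ck k U (fun u => \sum_(i <- s) f i u).
Proof.
move=> oU Cf; elim: s => [|i s IH].
  by apply: (Ck_eq oU _ (@Ck_cst _ _ _ _ 0)) => u _; rewrite big_nil.
by apply: (Ck_eq oU _ (CkD oU (Cf i) IH)) => u _; rewrite big_cons.
Qed.

Lemma Ck_linear_comp m n (W : normedModType R) k (U : set 'rV[R]_m)
    (L : {linear 'rV[R]_n -> W}) (f : 'rV[R]_m -> 'rV[R]_n) :
  open U -> Ck k U f -> Ck k U (fun u => L (f u)).
Proof.
move=> oU; have cL := @linear_continuous R n W L; have dL := fun x => linear_differentiable x cL.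
elim: k f => [|k IH] f.
  by move=> cf u Uu; apply: (@continuous_comp _ _ _ f L u); [exact: cf|exact: cL].
move=> [df Df]; split.
  by move=> u Uu; apply: differentiable_comp; [exact: df|exact: dL].
move=> i; apply: (Ck_eq oU _ (IH _ (Df i))) => u Uu.
have dfu := df u Uu.
rewrite !deriveE //; last exact: differentiable_comp.
by rewrite (diff_comp dfu (dL _)) /= (diff_lin _ cL).
Qed.

Lemma derive_row_sum m (W : normedModType R) (f : 'rV[R]_m -> W) u v :
  differentiable f u -> 'D_v f u = \sum_i v 0 i *: 'D_(delta_mx 0 i) f u.
Proof.
move=> df; rewrite deriveE // {1}(row_sum_delta v) linear_sum.
by apply: eq_bigr => i _; rewrite linearZ deriveE.
Qed.

Lemma derive_comp (V' V W : normedModType R) (f : V' -> V) (h : V -> W) u v :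
  differentiable f u -> differentiable h (f u) ->
  'D_v (fun u => h (f u)) u = 'D_('D_v f u) h (f u).
Proof.
move=> df dh; rewrite !deriveE //; last exact: differentiable_comp.
by rewrite diff_comp.
Qed.

Lemma Ck_coord m n k (U : set 'rV[R]_m) (f : 'rV[R]_m -> 'rV[R]_n) j :
  open U -> Ck k U f -> Ck k U (fun u => f u 0 j : R^o).
Proof.
have lin : linear (fun v : 'rV[R]_n => v 0 j : R^o) by move=> a v w; rewrite !mxE.
pose L : {linear 'rV[R]_n -> R^o} :=
  HB.pack (fun v : 'rV[R]_n => v 0 j : R^o) (GRing.isLinear.Build _ _ _ _ _ lin).
exact: (@Ck_linear_comp m n R^o k U L f).
Qed.

(** By the chain rule a partial derivative of the composite is a sum of products: a coordinate of a
    partial derivative of [f] times a partial derivative of [h] composed with [f]. The second factor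
    is a composite of order [k]. *)
Lemma Ck_comp m n (W : normedModType R) k (U : set 'rV[R]_m)
    (V : set 'rV[R]_n) (f : 'rV[R]_m -> 'rV[R]_n) (h : 'rV[R]_n -> W) :
  open U -> (forall u, U u -> V (f u)) -> Ck k U f -> Ck k V h ->
  Ck k U (fun u => h (f u)).
Proof.
move=> oU UV; elim: k f UV h => [|k IH] f UV h.
  by move=> cf ch u Uu; apply: (@continuous_comp _ _ _ f h u); [exact: cf|exact/ch/UV].
move=> /[dup] /CkS Cf [df Df] [dh Dh]; split.
  by move=> u Uu; apply: differentiable_comp; [exact: df|exact/dh/UV].
move=> i.
have C j : Ck k U (fun u => ('D_(delta_mx 0 i) f u) 0 j *:
    'D_(delta_mx 0 j) h (f u)).
  apply: CkZ => //; last exact: (IH f UV _ Cf (Dh j)).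
  exact: (Ck_coord j oU (Df i)).
apply: (Ck_eq oU _ (Ck_sum _ oU C)) => u Uu.
rewrite [RHS]derive_comp; [|exact: df|exact/dh/UV].
by rewrite [RHS]derive_row_sum //; exact/dh/UV.
Qed.

End SmoothCalculus.

(** * Smooth maps and the symmetry of second derivatives *)

Section SmoothOn.
Context {R : realType}.

Lemma smooth_on_local m (W : normedModType R) (U : set 'rV[R]_m)
    (f : 'rV[R]_m -> W) :
  (forall u, U u -> exists2 V : set 'rV[R]_m, V u & smooth_on V f) ->
  smooth_on U f.
Proof. by move=> H k; apply: Ck_local => u /H[V Vu Vf]; exists V => //; exact: Vf. Qed.

Lemma smooth_on_sub m (W : normedModType R) (U V : set 'rV[R]_m)
    (f : 'rV[R]_m -> W) : V `<=` U -> smooth_on U f -> smooth_on V f.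
Proof. by move=> VU Uf; apply: smooth_on_local => u Vu; exists U => //; exact: VU. Qed.

Lemma smooth_on_eq m (W : normedModType R) (U : set 'rV[R]_m)
    (f h : 'rV[R]_m -> W) :
  open U -> (forall u, U u -> f u = h u) -> smooth_on U f -> smooth_on U h.
Proof. by move=> oU fh Uf k; exact: (Ck_eq oU fh (Uf k)). Qed.

Lemma smooth_on_cst m (W : normedModType R) (U : set 'rV[R]_m) (w : W) :
  smooth_on U (fun=> w).
Proof. by move=> k; exact: Ck_cst. Qed.

Lemma smooth_onD m (W : normedModType R) (U : set 'rV[R]_m)
    (f h : 'rV[R]_m -> W) :
  open U -> smooth_on U f -> smooth_on U h -> smooth_on U (fun u => f u + h u).
Proof. by move=> oU Uf Uh k; exact: CkD. Qed.

Lemma smooth_onZ m (W : normedModType R) (U : set 'rV[R]_m)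
    (a : 'rV[R]_m -> R^o) (f : 'rV[R]_m -> W) :
  open U -> smooth_on U a -> smooth_on U f -> smooth_on U (fun u => a u *: f u).
Proof. by move=> oU Ua Uf k; exact: CkZ. Qed.

Lemma smooth_on_sum m (W : normedModType R) (U : set 'rV[R]_m) (I : Type)
    (s : seq I) (f : I -> 'rV[R]_m -> W) :
  open U -> (forall i, smooth_on U (f i)) ->
  smooth_on U (fun u => \sum_(i <- s) f i u).
Proof. by move=> oU Uf k; apply: Ck_sum => // i; exact: Uf. Qed.

Lemma smooth_on_linear m n (W : normedModType R) (U : set 'rV[R]_m)
    (L : {linear 'rV[R]_n -> W}) (f : 'rV[R]_m -> 'rV[R]_n) :
  open U -> smooth_on U f -> smooth_on U (fun u => L (f u)).
Proof. by move=> oU Uf k; exact: Ck_linear_comp. Qed.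

Lemma smooth_on_coord m n (U : set 'rV[R]_m) (f : 'rV[R]_m -> 'rV[R]_n) j :
  open U -> smooth_on U f -> smooth_on U (fun u => f u 0 j : R^o).
Proof. by move=> oU Uf k; exact: Ck_coord. Qed.

Lemma smooth_on_comp m n (W : normedModType R) (U : set 'rV[R]_m)
    (V : set 'rV[R]_n) (f : 'rV[R]_m -> 'rV[R]_n) (h : 'rV[R]_n -> W) :
  open U -> (forall u, U u -> V (f u)) -> smooth_on U f -> smooth_on V h ->
  smooth_on U (fun u => h (f u)).
Proof. by move=> oU UV Uf Vh k; exact: Ck_comp UV (Uf k) (Vh k). Qed.

Lemma smooth_on_differentiable m (W : normedModType R) (U : set 'rV[R]_m)
    (f : 'rV[R]_m -> W) u : smooth_on U f -> U u -> differentiable f u.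
Proof. by move=> /(_ 1)[df _]; exact: df. Qed.

Lemma smooth_on_id m (U : set 'rV[R]_m) : open U -> smooth_on U id.
Proof.
move=> oU; case=> [|k]; first by move=> u _; exact: cvg_id.
split; first by move=> u _; exact: ex_diff.
move=> i; apply: (Ck_eq oU _ (Ck_cst _ _ (delta_mx 0 i))) => u _.
by rewrite [RHS]derive_id.
Qed.

(** A varying direction is expanded in the standard basis, which leaves partial derivatives with
    smooth coefficients. In this way the Jacobian of a transition map acts on smooth fields. *)
Lemma smooth_on_derive_along m n (W : normedModType R) (U : set 'rV[R]_m)
    (V : set 'rV[R]_n) (a b : 'rV[R]_m -> 'rV[R]_n) (h : 'rV[R]_n -> W) :
  open U -> (forall u, U u -> V (b u)) -> smooth_on U a -> smooth_on U b ->
  smooth_on V h -> smooth_on U (fun u => 'D_(a u) h (b u)).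
Proof.
move=> oU UV Ua Ub Vh.
have C j : smooth_on U (fun u => (a u 0 j : R^o) *: 'D_(delta_mx 0 j) h (b u)).
  apply: smooth_onZ => //; first exact: smooth_on_coord.
  apply: (@smooth_on_comp _ _ _ U V b (fun x => 'D_(delta_mx 0 j) h x)) => //.
  by move=> k; have [_] := Vh k.+1; exact.
apply: (smooth_on_eq oU _ (smooth_on_sum _ oU C)) => u Uu.
by rewrite [RHS]derive_row_sum //; exact: smooth_on_differentiable Vh (UV u Uu).
Qed.

Lemma smooth_on_derive m (W : normedModType R) (U : set 'rV[R]_m)
    (f : 'rV[R]_m -> W) v :
  open U -> smooth_on U f -> smooth_on U (fun u => 'D_v f u).
Proof.
move=> oU Uf; apply: (@smooth_on_derive_along _ _ _ U U (fun=> v) id f) => //.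
  exact: smooth_on_cst.
exact: smooth_on_id.
Qed.

Lemma mvt_line m (f : 'rV[R]_m -> R) u v (h : R) : 0 < h ->
  (forall s, 0 <= s <= h -> differentiable f (u + s *: v)) ->
  exists2 s, 0 <= s <= h & f (u + h *: v) - f u = 'D_v f (u + s *: v) * h.
Proof.
move=> h0 df.
have dl s : s \in `[0, h] ->
    is_derive s 1 (fun t : R => f (u + t *: v)) ('D_v f (u + s *: v)).
  by rewrite in_itv /= => sh; apply: derive_line; exact: df.
have [|s sh sE] := @MVT_segment R _ _ 0 h (ltW h0)
    (fun s hs => dl s (subset_itv_oo_cc hs)).
  by apply: derivable_within_continuous => s /dl[].
exists s; first by move: sh; rewrite in_itv.
by move: sE; rewrite scale0r addr0 subr0.
Qed.

(** The mean value theorem applies twice: in direction [v] to the increment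
    [F x = f (x + h *: w) - f x], then in direction [w] to the derivative of [f] along [v]. *)
Lemma second_difference m (U : set 'rV[R]_m) (f : 'rV[R]_m -> R^o) u v w h :
  open U -> smooth_on U f -> 0 < h ->
  (forall s t, 0 <= s <= h -> 0 <= t <= h -> U (u + s *: v + t *: w)) ->
  exists s t, [/\ 0 <= s <= h, 0 <= t <= h &
    f (u + h *: v + h *: w) - f (u + h *: v) - (f (u + h *: w) - f u) =
    'D_w (fun x => 'D_v f x) (u + s *: v + t *: w) * h * h].
Proof.
move=> oU Uf h0 hU.
have dfs x : U x -> differentiable f x by exact: smooth_on_differentiable.
have h00 : 0 <= (0 : R) <= h by rewrite lexx ltW.
have hh : 0 <= h <= h by rewrite lexx ltW.
have Uv s : 0 <= s <= h -> U (u + s *: v).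
  by move=> sh; have := hU s 0 sh h00; rewrite scale0r addr0.
pose F x := f (x + h *: w) - f x.
have dF s : 0 <= s <= h -> is_diff (u + s *: v) F
    (fun y => 'd f (u + s *: v + h *: w) y - 'd f (u + s *: v) y).
  move=> sh.
  have d1 := differentiableP (dfs _ (hU s h sh hh)).
  have d2 := differentiableP (dfs _ (Uv s sh)).
  have d3 : is_diff (u + s *: v) (fun x => x + h *: w) (id + 0).
    by apply: is_diffD; exact: is_diff_cst.
  have d4 := is_diff_comp d3 d1.
  have [dd ddE] := is_diffB d4 d2.
  have FE : F = (f \o (fun x => x + h *: w)) - f by [].
  rewrite FE; apply: DiffDef; first exact: dd.
  apply: (etrans ddE); apply/funext => y.
  by congr ('d f _ _ - _); exact: addr0.
have [s sh sE] := @mvt_line _ F u v h h0 (fun s hs => ex_diff (is_diff_def := dF s hs)).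
have UDf := smooth_on_derive v oU Uf.
have [|t th tE] := @mvt_line _ (fun x => 'D_v f x) (u + s *: v) w h h0.
  by move=> t th; apply: (smooth_on_differentiable UDf); exact: hU.
exists s, t; split => //.
rewrite -tE -[LHS]/(F (u + h *: v) - F u) sE; congr (_ * _).
have [dFs dFE] := dF s sh.
rewrite (deriveE v dFs) (deriveE v (dfs _ (hU s h sh hh))).
rewrite (deriveE v (dfs _ (Uv s sh))).
exact: (congr1 (fun k => k v) dFE).
Qed.

(** The second difference is symmetric in [v] and [w], so the two mixed derivatives agree at some
    pair of points of a small parallelogram; both are continuous at [u]. *)
Lemma derive_commute m (U : set 'rV[R]_m) (f : 'rV[R]_m -> R^o) u v w :
  open U -> U u -> smooth_on U f ->
  'D_v (fun x => 'D_w f x) u = 'D_w (fun x => 'D_v f x) u.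
Proof.
move=> oU Uu Uf.
(* [G] is an opaque name for the mixed derivatives, so that rewriting does not look inside them. *)
have [G GE] : {G : 'rV[R]_m -> 'rV[R]_m -> 'rV[R]_m -> R |
    forall v w x, 'D_w (fun x => 'D_v f x) x = G v w x}.
  by exists (fun v w x => 'D_w (fun x => 'D_v f x) x).
have cG v' w' : {for u, continuous (G v' w' : _ -> R^o)}.
  have -> : G v' w' = fun x => 'D_w' (fun x => 'D_v' f x) x.
    by apply/funext => x; rewrite GE.
  have := smooth_on_derive w' oU (smooth_on_derive v' oU Uf).
  by move=> /(_ 0); exact.
rewrite !GE.
apply/eqP; rewrite -subr_eq0 -normr_le0; apply/ler_addgt0Pr => e e0.
have e20 : 0 < e / 2 by rewrite divr_gt0.
rewrite add0r.
have nG v' w' : \forall x \near u, `|G v' w' u - G v' w' x| < e / 2.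
  by have /cvgrPdist_lt := cG v' w'; exact.
have : \forall x \near u, [/\ U x, `|G v w u - G v w x| < e / 2 &
    `|G w v u - G w v x| < e / 2].
  near=> x; split; first by near: x; exact: open_nbhs_nbhs.
    by near: x; exact: nG.
  by near: x; exact: nG.
move=> /nbhs_ballP[d /= d0 dU].
(* A displacement [s *: v + t *: w] with [s] and [t] at most [h] has norm at most h (|v| + |w|); the
   added 1 makes the denominator positive and the bound by [d] strict. *)
pose h := d / (`|v| + `|w| + 1).
have N0 : 0 < `|v| + `|w| + 1 by rewrite ltr_wpDl // addr_ge0.
have h0 : 0 < h by rewrite divr_gt0.
have hd s t : 0 <= s <= h -> 0 <= t <= h -> ball u d (u + s *: v + t *: w).
  move=> /andP[s0 sh] /andP[t0 th]; rewrite -ball_normE /= -addrA opprD addNKr.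
  rewrite normrN (le_lt_trans (ler_normD _ _)) // !normrZ !ger0_norm //.
  apply: (@le_lt_trans _ _ (h * (`|v| + `|w|))).
    by rewrite mulrDr lerD // ler_wpM2r.
  by rewrite /h mulrAC -mulrA gtr_pMr // ltr_pdivrMr // mul1r ltrDl.
have [s [t [sh th stE]]] := second_difference oU Uf h0
  (fun s t sh th => let: And3 P _ _ := dU _ (hd s t sh th) in P).
have [|s' [t' [sh' th' stE']]] := @second_difference m U f u w v h oU Uf h0.
  by move=> s' t' sh' th'; rewrite addrAC; have [] := dU _ (hd _ _ th' sh').
have Gst : G v w (u + s *: v + t *: w) = G w v (u + s' *: w + t' *: v).
  apply: (mulIf (lt0r_neq0 h0)); apply: (mulIf (lt0r_neq0 h0)).
  move: stE stE'; rewrite !GE (addrAC u (h *: w)) => <- <-.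
  by lra.
have [_ G1 _] := dU _ (hd _ _ sh th); have [_ _ G2] := dU _ (hd _ _ th' sh').
rewrite addrAC in G2.
have -> : G w v u - G v w u = (G w v u - G w v (u + s' *: w + t' *: v)) -
    (G v w u - G v w (u + s *: v + t *: w)) by rewrite Gst; ring.
rewrite (le_trans (ler_normB _ _)) // [leRHS]splitr.
by rewrite lerD // ltW.
Unshelve. all: by end_near. Qed.

End SmoothOn.

Section DeriveExtra.
Context {R : realType}.

Lemma derive_coord m n (f : 'rV[R]_m -> 'rV[R]_n) u v k :
  differentiable f u -> 'D_v (fun x => f x 0 k : R^o) u = ('D_v f u) 0 k.
Proof.
move=> df; rewrite derive_mx; last exact: diff_derivable.
by rewrite mxE.
Qed.

Lemma deriveDv (V W : normedModType R) (f : V -> W) u v w :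
  differentiable f u -> 'D_(v + w) f u = 'D_v f u + 'D_w f u.
Proof. by move=> df; rewrite !deriveE // linearD. Qed.

Lemma deriveZv (V W : normedModType R) (f : V -> W) u (a : R) v :
  differentiable f u -> 'D_(a *: v) f u = a *: 'D_v f u.
Proof. by move=> df; rewrite !deriveE // linearZ. Qed.

Lemma deriveBv (V W : normedModType R) (f : V -> W) u v w :
  differentiable f u -> 'D_(v - w) f u = 'D_v f u - 'D_w f u.
Proof. by move=> df; rewrite !deriveE // linearB. Qed.

(** Leibniz rule in the direction field and the function: the first term differentiates the
    direction, the second keeps it frozen at [w]. The first kind of term is what survives in a Lie
    bracket. *)
Lemma derive_derive_along m (W : normedModType R) (U : set 'rV[R]_m)
    (a : 'rV[R]_m -> 'rV[R]_m) (h : 'rV[R]_m -> W) u v w :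
  open U -> U u -> smooth_on U a -> smooth_on U h -> a u = w ->
  'D_v (fun x => 'D_(a x) h x) u =
    'D_('D_v a u) h u + 'D_v (fun x => 'D_w h x) u.
Proof.
move=> oU Uu Ua Uh <- {w}.
have dh x : U x -> differentiable h x by exact: smooth_on_differentiable.
have da : differentiable a u by exact: smooth_on_differentiable Ua Uu.
have dak j : differentiable (fun x => a x 0 j : R^o) u.
  exact: (smooth_on_differentiable (smooth_on_coord j oU Ua)).
have dD i : differentiable (fun x => 'D_(delta_mx 0 i) h x) u.
  exact: (smooth_on_differentiable (smooth_on_derive _ oU Uh)).
have sumE b : {near u, (fun x => 'D_(b x) h x) =1
    \sum_j (fun x => (b x 0 j : R^o) *: 'D_(delta_mx 0 j) h x)}.
  near=> x; rewrite fct_sumE; apply: derive_row_sum; apply: dh.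
  by near: x; exact: open_nbhs_nbhs.
rewrite (near_eq_derive _ (sumE a)) (near_eq_derive _ (sumE (fun=> a u))).
rewrite !derive_sum; last 2 first.
- by move=> j; apply: diff_derivable; apply: differentiable_scale.
- by move=> j; apply: diff_derivable; apply: differentiable_scale.
rewrite [X in X + _]derive_row_sum; last exact: dh.
rewrite -big_split; apply: eq_bigr => j _ /=.
rewrite !derive_scale // derive_cst scale0r add0r.
by rewrite derive_coord.
Unshelve. all: by end_near. Qed.

End DeriveExtra.

(** * Manifolds *)

(* The part of [connected_manifold] that the correspondence depends on; unlike
   it, this is easily seen to pass to the cone. *)
Record smooth_atlas {R : realType} {m : nat} {M : topologicalType}
    (A : charts R m M) : Prop := SmoothAtlas {
  sa_center : forall p, cdom A p p ;
  sa_dom_open : forall p, open (cdom A p) ;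
  sa_img_open : forall p, open (cmap A p @` cdom A p) ;
  sa_mapK : forall p q, cdom A p q -> cinv A p (cmap A p q) = q ;
  sa_map_cont : forall p q, cdom A p q -> {for q, continuous (cmap A p)} ;
  sa_inv_cont : forall p u, (cmap A p @` cdom A p) u ->
    {for u, continuous (cinv A p)} ;
  sa_transition : forall p q,
    smooth_on (cmap A p @` (cdom A p `&` cdom A q)) (cmap A q \o cinv A p) }.

Section ManifoldCalculus.
#[local] Opaque smooth_on derive.
Context {R : realType} {m : nat} {M : topologicalType} (A : charts R m M).
Hypothesis hA : smooth_atlas A.
Implicit Types (p q a b c x y : M) (v w : 'rV[R]_m) (X Y Z : M -> 'rV[R]_m).
Implicit Types (f : M -> R) (U V : set M).

Let center p : cdom A p p := sa_center hA p.

Definition cimg p U : set 'rV[R]_m := cmap A p @` (cdom A p `&` U).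

Lemma cimgP p U x : cdom A p x -> U x -> cimg p U (cmap A p x).
Proof. by move=> px Ux; exists x. Qed.

(** Within the open image of the whole chart, this set is the preimage of [U] under the continuous
    map [cinv A p]. *)
Lemma open_cimg p U : open U -> open (cimg p U).
Proof.
move=> oU; rewrite openE => _ [x [px Ux] <-] /=.
have imx : (cmap A p @` cdom A p) (cmap A p x) by exists x.
have cU : \forall u \near cmap A p x, U (cinv A p u).
  apply: (sa_inv_cont hA imx); rewrite (sa_mapK hA px).
  exact: open_nbhs_nbhs.
have cI : \forall u \near cmap A p x, (cmap A p @` cdom A p) u.
  by apply: open_nbhs_nbhs; split => //; exact: sa_img_open.
near=> u.
have [y py yE] : (cmap A p @` cdom A p) u by near: u.
exists y => //; split => //.
by rewrite -(sa_mapK hA py) yE; near: u.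
Unshelve. all: by end_near. Qed.

(** Carries properties of points near [x] to coordinates near [cmap A p x]. The other two
    conclusions place [u] in the image of the chart, where [cinv] is a genuine inverse. *)
Lemma near_chart p x (P : M -> Prop) : cdom A p x ->
  (\forall y \near x, P y) ->
  \forall u \near cmap A p x,
    [/\ cdom A p (cinv A p u), P (cinv A p u) & cmap A p (cinv A p u) = u].
Proof.
move=> px nP; pose V : set M := interior P.
have oV : open V by exact: open_interior.
have Vx : V x by [].
have VP : V `<=` P by exact: interior_subset.
have : nbhs (cmap A p x) (cimg p V).
  by apply: open_nbhs_nbhs; split; [exact: open_cimg|exact: cimgP].
apply: filterS => _ [y [py Vy] <-]; rewrite (sa_mapK hA py); split => //.
exact: VP.
Qed.

Lemma near_cdom p x : cdom A p x -> \forall y \near x, cdom A p y.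
Proof. by move=> px; apply: open_nbhs_nbhs; split => //; exact: sa_dom_open. Qed.

(* Components in the chart around b of the vector at x with components v in the
   chart around a; sealed to keep conversion from unfolding derivatives. *)
Fact push_sig : {f : M -> M -> M -> 'rV[R]_m -> 'rV[R]_m |
  f = fun a b x v => 'D_v (cmap A b \o cinv A a) (cmap A a x)}.
Proof. by eexists. Qed.

Definition push := sval push_sig.

Lemma pushE a b x v : push a b x v = 'D_v (cmap A b \o cinv A a) (cmap A a x).
Proof. by rewrite /push (svalP push_sig). Qed.

Lemma transition_differentiable a b x : cdom A a x -> cdom A b x ->
  differentiable (cmap A b \o cinv A a) (cmap A a x).
Proof.
by move=> ax bx; apply: (smooth_on_differentiable (sa_transition hA a b)); exists x.
Qed.

(** Chain rule: [x] has a neighbourhood inside [cdom A b], over which the transition from [a] to [c]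
    factors through the chart around [b]. *)
Lemma push_comp a b c x v : cdom A a x -> cdom A b x -> cdom A c x ->
  push b c x (push a b x v) = push a c x v.
Proof.
move=> ax bx cx; rewrite !pushE.
have E : (cmap A b \o cinv A a) (cmap A a x) = cmap A b x.
  by rewrite /= (sa_mapK hA ax).
rewrite -[X in 'D_('D_v _ _) _ X]E -derive_comp; last 2 first.
- exact: transition_differentiable.
- by rewrite E; exact: transition_differentiable.
apply: near_eq_derive.
apply: filterS (near_chart ax (near_cdom bx)) => u [_ bu _] /=.
by rewrite (sa_mapK hA bu).
Qed.

Lemma push_id a x v : cdom A a x -> push a a x v = v.
Proof.
move=> ax; rewrite pushE -[RHS](derive_id (cmap A a x)).
apply: near_eq_derive.
by apply: filterS (near_chart ax (near_cdom ax)) => u [_ _].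
Qed.

Lemma pushD a b x v w : cdom A a x -> cdom A b x ->
  push a b x (v + w) = push a b x v + push a b x w.
Proof. by move=> ax bx; rewrite !pushE; apply: deriveDv; exact: transition_differentiable. Qed.

Lemma pushZ a b x (k : R) v : cdom A a x -> cdom A b x ->
  push a b x (k *: v) = k *: push a b x v.
Proof. by move=> ax bx; rewrite !pushE; apply: deriveZv; exact: transition_differentiable. Qed.

Lemma push0 a b x : push a b x 0 = 0.
Proof. by rewrite pushE; exact: derive0. Qed.

Lemma push_sum a b x (F : 'I_m -> 'rV[R]_m) : cdom A a x -> cdom A b x ->
  push a b x (\sum_i F i) = \sum_i push a b x (F i).
Proof.
move=> ax bx; apply: (big_morph (push a b x)); last exact: push0.
by move=> v w; exact: pushD.
Qed.

Lemma tcompE q p v : tcomp A q p v = push p q p v.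
Proof. by rewrite pushE. Qed.

Lemma local_repE q X x : cdom A q x ->
  local_rep A q X (cmap A q x) = push x q x (X x).
Proof. by move=> qx; rewrite /local_rep (sa_mapK hA qx) tcompE. Qed.

Lemma smooth_vf_eq U X Y : open U -> (forall x, U x -> X x = Y x) ->
  smooth_vf A U X -> smooth_vf A U Y.
Proof.
move=> oU XY UX q; apply: (smooth_on_eq (@open_cimg q _ oU) _ (UX q)).
by move=> _ [x [qx Ux] <-]; rewrite (local_repE X qx) (local_repE Y qx) XY.
Qed.

Lemma smooth_fun_eq U (f h : M -> R) : open U -> (forall x, U x -> f x = h x) ->
  smooth_fun A U f -> smooth_fun A U h.
Proof.
move=> oU fh Uf q; apply: (smooth_on_eq (@open_cimg q _ oU) _ (Uf q)).
by move=> _ [x [qx Ux] <-]; rewrite /= (sa_mapK hA qx) fh.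
Qed.

Lemma cimgS q U V : U `<=` V -> cimg q U `<=` cimg q V.
Proof. by move=> UV _ [x [qx Ux] <-]; apply: cimgP => //; exact: UV. Qed.

Lemma smooth_vf_sub U V X : V `<=` U -> smooth_vf A U X -> smooth_vf A V X.
Proof. by move=> VU UX q; apply: smooth_on_sub (UX q); exact: cimgS. Qed.

Lemma smooth_fun_sub U V f : V `<=` U -> smooth_fun A U f -> smooth_fun A V f.
Proof. by move=> VU Uf q; apply: smooth_on_sub (Uf q); exact: cimgS. Qed.

Lemma transition_smooth_sub a b V : V `<=` cdom A b ->
  smooth_on (cimg a V) (cmap A b \o cinv A a).
Proof. by move=> Vb; apply: smooth_on_sub (sa_transition hA a b); exact: cimgS. Qed.

Lemma smooth_fun_chart q V f : open V -> V `<=` cdom A q ->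
  smooth_on (cimg q V) (f \o cinv A q : _ -> R^o) -> smooth_fun A V f.
Proof.
move=> oV Vq Vf s; have oV' := @open_cimg s _ oV.
have S := smooth_on_comp oV' _ (transition_smooth_sub s Vq) Vf.
apply: (smooth_on_eq oV' _ (S _)).
  by move=> _ [x [sx Vx] <-]; rewrite /= !(sa_mapK hA) //; exact: Vq.
move=> _ [x [sx Vx] <-]; rewrite /= (sa_mapK hA) //.
by apply: cimgP => //; exact: Vq.
Qed.

(** The components in another chart are the given ones multiplied by the Jacobian of the transition
    map, that is, a derivative along a smooth direction. *)
Lemma smooth_vf_chart q V X : open V -> V `<=` cdom A q ->
  smooth_on (cimg q V) (local_rep A q X) -> smooth_vf A V X.
Proof.
move=> oV Vq VX s; have oV' := @open_cimg s _ oV.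
(* The transition from [q] to [s] is known to be smooth only over the overlap of the two domains;
   passing from [V] to [Ws] leaves the image in the chart around [s] unchanged. *)
pose Ws := V `&` cdom A s.
have oW : open Ws by apply: openI => //; exact: sa_dom_open.
have sW : cimg s V = cimg s Ws.
  rewrite eqEsubset; split; last by apply: cimgS => x [].
  by move=> _ [x [sx Vx] <-]; apply: cimgP.
have UV : forall u, cimg s V u -> cimg q Ws ((cmap A q \o cinv A s) u).
  move=> _ [x [sx Vx] <-]; rewrite /= (sa_mapK hA) //.
  by apply: cimgP => //; exact: Vq.
have S1 := smooth_on_comp oV' UV (transition_smooth_sub s Vq)
  (smooth_on_sub (@cimgS q Ws V (@subIsetl _ _ _)) VX).
have S2 := smooth_on_derive_along oV' UV S1 (transition_smooth_sub s Vq)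
  (@transition_smooth_sub q s Ws (@subIsetr _ _ _)).
apply: (smooth_on_eq oV' _ S2) => _ [x [sx Vx] <-].
have qx := Vq x Vx.
rewrite /= (sa_mapK hA sx) (local_repE X qx) (local_repE X sx).
by rewrite -(push_comp (X x) (center x) qx sx) [RHS]pushE.
Qed.

(** Smoothness of germs: the open set is bound existentially, so that it can shrink when several
    fields are combined. *)
Definition smooth_fun_at p f := exists U, [/\ open U, U p & smooth_fun A U f].
Definition smooth_vf_at p X := exists U, [/\ open U, U p & smooth_vf A U X].

Lemma smooth_fun_atI U p f : open U -> U p -> smooth_fun A U f -> smooth_fun_at p f.
Proof. by move=> oU Up Uf; exists U; split. Qed.

Lemma smooth_vf_atI U p X : open U -> U p -> smooth_vf A U X -> smooth_vf_at p X.
Proof. by move=> oU Up UX; exists U; split. Qed.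

Lemma smooth_vf_atP U X : (forall p, U p -> smooth_vf_at p X) -> smooth_vf A U X.
Proof.
move=> H q; apply: smooth_on_local => _ [p [qp Up] <-].
by have [V [oV Vp Vf]] := H p Up; exists (cimg q V); [exact: cimgP|exact: Vf].
Qed.

Lemma smooth_fun_at_near p f : smooth_fun_at p f ->
  \forall q \near p, smooth_fun_at q f.
Proof.
move=> [U [oU Up UX]].
have : nbhs p U by exact: open_nbhs_nbhs.
by apply: filterS => q Uq; exists U.
Qed.

Lemma smooth_vf_at_eq p X Y : {near p, X =1 Y} ->
  smooth_vf_at p X -> smooth_vf_at p Y.
Proof.
move=> nXY [U [oU Up UX]].
pose V : set M := interior [set x | X x = Y x].
have oV : open V by exact: open_interior.
have Vp : V p by [].
have XY x : V x -> X x = Y x by move/interior_subset.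
have oUV : open (U `&` V) by exact: openI.
exists (U `&` V); split; [exact: oUV|by []|].
apply: (smooth_vf_eq oUV) (smooth_vf_sub _ UX); last by move=> x [].
by move=> x [Ux Vx]; exact: XY.
Qed.

Lemma smooth_fun_at_eq p (f h : M -> R) : {near p, f =1 h} ->
  smooth_fun_at p f -> smooth_fun_at p h.
Proof.
move=> nXY [U [oU Up UX]].
pose V : set M := interior [set x | f x = h x].
have oV : open V by exact: open_interior.
have Vp : V p by [].
have XY x : V x -> f x = h x by move/interior_subset.
have oUV : open (U `&` V) by exact: openI.
exists (U `&` V); split; [exact: oUV|by []|].
apply: (smooth_fun_eq oUV) (smooth_fun_sub _ UX); last by move=> x [].
by move=> x [Ux Vx]; exact: XY.
Qed.

Lemma smooth_vf_at2 p X Y : smooth_vf_at p X -> smooth_vf_at p Y ->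
  exists U, [/\ open U, U p, smooth_vf A U X & smooth_vf A U Y].
Proof.
move=> [U [oU Up UX]] [V [oV Vp VY]]; exists (U `&` V); split; [exact: openI|by []|idtac|idtac].
- by apply: smooth_vf_sub UX => x [].
- by apply: smooth_vf_sub VY => x [].
Qed.

Lemma smooth_fun_vf_at2 p f Y : smooth_fun_at p f -> smooth_vf_at p Y ->
  exists U, [/\ open U, U p, smooth_fun A U f & smooth_vf A U Y].
Proof.
move=> [U [oU Up UX]] [V [oV Vp VY]]; exists (U `&` V); split; [exact: openI|by []|idtac|idtac].
- by apply: smooth_fun_sub UX => x [].
- by apply: smooth_vf_sub VY => x [].
Qed.

Lemma smooth_fun_at2 p f h : smooth_fun_at p f -> smooth_fun_at p h ->
  exists U, [/\ open U, U p, smooth_fun A U f & smooth_fun A U h].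
Proof.
move=> [U [oU Up UX]] [V [oV Vp VY]]; exists (U `&` V); split; [exact: openI|by []|idtac|idtac].
- by apply: smooth_fun_sub UX => x [].
- by apply: smooth_fun_sub VY => x [].
Qed.

Lemma smooth_vf_atD p X Y : smooth_vf_at p X -> smooth_vf_at p Y ->
  smooth_vf_at p (fun q => X q + Y q).
Proof.
move=> hX hY; have [U [oU Up UX UY]] := smooth_vf_at2 hX hY.
exists U; split; [exact: oU|exact: Up|move=> q]; have oU' := @open_cimg q _ oU.
apply: (smooth_on_eq oU' _ (smooth_onD oU' (UX q) (UY q))).
by move=> _ [x [qx Ux] <-]; rewrite !local_repE // pushD.
Qed.

Lemma smooth_vf_atZ p f X : smooth_fun_at p f -> smooth_vf_at p X ->
  smooth_vf_at p (fun q => f q *: X q).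
Proof.
move=> hf hX; have [U [oU Up Uf UX]] := smooth_fun_vf_at2 hf hX.
exists U; split; [exact: oU|exact: Up|move=> q]; have oU' := @open_cimg q _ oU.
apply: (smooth_on_eq oU' _ (smooth_onZ oU' (Uf q) (UX q))).
by move=> _ [x [qx Ux] <-]; rewrite !local_repE // pushZ //= (sa_mapK hA).
Qed.

Lemma smooth_fun_atM p f h : smooth_fun_at p f -> smooth_fun_at p h ->
  smooth_fun_at p (fun q => f q * h q).
Proof.
move=> hf hh; have [U [oU Up Uf Uh]] := smooth_fun_at2 hf hh.
exists U; split; [exact: oU|exact: Up|move=> q]; have oU' := @open_cimg q _ oU.
exact: (smooth_on_eq oU' _ (smooth_onZ oU' (Uf q) (Uh q))).
Qed.

Lemma smooth_fun_at_cst p (k : R) : smooth_fun_at p (fun=> k).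
Proof.
by exists setT; split; [exact: openT|by []|move=> q; exact: smooth_on_cst].
Qed.

Lemma smooth_vf_at0 p : smooth_vf_at p (fun=> 0).
Proof.
exists setT; split; [exact: openT|by []|move=> q].
 have oT := @open_cimg q _ openT.
apply: (smooth_on_eq oT _ (smooth_on_cst _ 0)).
by move=> _ [x [qx _] <-]; rewrite local_repE // push0.
Qed.

Lemma smooth_vf_at_sum p (F : 'I_m -> M -> 'rV[R]_m) (s : seq 'I_m) :
  (forall i, smooth_vf_at p (F i)) ->
  smooth_vf_at p (fun q => \sum_(i <- s) F i q).
Proof.
move=> hF; elim: s => [|i s IH].
  by apply: smooth_vf_at_eq (smooth_vf_at0 p); near=> q; rewrite big_nil.
apply: smooth_vf_at_eq (smooth_vf_atD (hF i) IH).
by near=> q; rewrite big_cons.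
Unshelve. all: by end_near. Qed.

Lemma smooth_fun_at_differentiable q p f : smooth_fun_at p f -> cdom A q p ->
  differentiable (f \o cinv A q : _ -> R^o) (cmap A q p).
Proof.
move=> [U [oU Up Uf]] qp; apply: (smooth_on_differentiable (Uf q)).
exact: cimgP.
Qed.

Lemma smooth_vf_at_differentiable q p X : smooth_vf_at p X -> cdom A q p ->
  differentiable (local_rep A q X) (cmap A q p).
Proof.
move=> [U [oU Up UX]] qp; apply: (smooth_on_differentiable (UX q)).
exact: cimgP.
Qed.

(** The coordinate field of the chart around [p] with constant components [w], expressed at [q] in
    the preferred chart of [q]; off [cdom A p] its values carry no meaning. *)
Definition frame p w q : 'rV[R]_m := push p q q w.

Lemma frame_center p w : frame p w p = w.
Proof. exact: push_id. Qed.

Lemma push_frame p w q : cdom A p q -> push q p q (frame p w q) = w.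
Proof. by move=> pq; rewrite /frame push_comp // push_id. Qed.

Lemma frame_push p v q : cdom A p q -> frame p (push q p q v) q = v.
Proof. by move=> pq; rewrite /frame push_comp // push_id. Qed.

Lemma smooth_frame p w : smooth_vf A (cdom A p) (frame p w).
Proof.
have op := sa_dom_open hA p.
apply: (@smooth_vf_chart p _ _ op); first by [].
apply: (smooth_on_eq (@open_cimg p _ op) _ (smooth_on_cst _ w)).
by move=> _ [x [px _] <-]; rewrite local_repE // push_frame.
Qed.

Lemma smooth_frame_at p w q : cdom A p q -> smooth_vf_at q (frame p w).
Proof.
by move=> pq; exists (cdom A p); split => //; [exact: sa_dom_open|exact: smooth_frame].
Qed.

Lemma smooth_component p X i q : smooth_vf_at q X -> cdom A p q ->
  smooth_fun_at q (fun x => push x p x (X x) 0 i).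
Proof.
move=> [U [oU Up UX]] pq; exists (U `&` cdom A p).
have oV : open (U `&` cdom A p) by apply: openI => //; exact: sa_dom_open.
split; [exact: oV|by []|apply: (@smooth_fun_chart p _ _ oV)]; first by move=> x [].
have oV' := @open_cimg p _ oV.
have S := smooth_on_coord i oV' (smooth_on_sub (@cimgS p (U `&` cdom A p) U
  (@subIsetl _ _ _)) (UX p)).
apply: (smooth_on_eq oV' _ S) => _ [x [px _] <-].
by rewrite (local_repE X px) /= (sa_mapK hA px).
Qed.

Lemma frame_decomposition p X q : cdom A p q ->
  X q = \sum_i push q p q (X q) 0 i *: frame p (delta_mx 0 i) q.
Proof.
move=> pq; rewrite -{1}(frame_push (X q) pq) {1}(row_sum_delta (push q p q (X q))).
by rewrite /frame push_sum //; apply: eq_bigr => i _; rewrite pushZ.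
Qed.

(* Extending by an indicator function turns the local frame decomposition
   into an identity of globally defined fields. *)
Lemma tensorial_expansion (W : lmodType R) (F : (M -> 'rV[R]_m) -> W) p :
  (forall X Y, smooth_vf_at p X -> smooth_vf_at p Y ->
     F (fun q => X q + Y q) = F X + F Y) ->
  (forall f X, smooth_fun_at p f -> smooth_vf_at p X ->
     F (fun q => f q *: X q) = f p *: F X) ->
  forall X, smooth_vf_at p X ->
    F X = \sum_i X p 0 i *: F (frame p (delta_mx 0 i)).
Proof.
move=> FD FZ X hX.
pose chi q : R := if pselect (cdom A p q) then 1 else 0.
have hchi : smooth_fun_at p chi.
  apply: smooth_fun_at_eq (smooth_fun_at_cst p 1).
  by apply: filterS (near_cdom (center p)) => q pq; rewrite /chi; case: pselect.
have chip : chi p = 1 by rewrite /chi; case: pselect => // /(_ (center p)).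
pose c i q := push q p q (X q) 0 i.
have hc i : smooth_fun_at p (c i) by exact: smooth_component.
have hfr i : smooth_vf_at p (frame p (delta_mx 0 i)) by exact: smooth_frame_at.
have F0 : F (fun=> 0) = 0.
  have <- : (fun q => 0 *: X q) = (fun=> 0) by apply/funext => q; rewrite scale0r.
  by rewrite FZ ?scale0r //; exact: smooth_fun_at_cst.
have hcf i : smooth_vf_at p (fun q => c i q *: frame p (delta_mx 0 i) q).
  exact: (smooth_vf_atZ (hc i) (hfr i)).
have Fsum s : F (fun q => \sum_(i <- s) c i q *: frame p (delta_mx 0 i) q) =
    \sum_(i <- s) c i p *: F (frame p (delta_mx 0 i)).
  elim: s => [|i s IH].
    rewrite big_nil -[RHS]F0; congr F.
    by apply/funext => q; rewrite big_nil.
  rewrite big_cons -IH -(FZ _ _ (hc i) (hfr i)).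
  rewrite -(FD _ _ (hcf i) (smooth_vf_at_sum s hcf)).
  by congr F; apply/funext => q; rewrite big_cons.
have -> : F X = F (fun q => chi q *: X q) by rewrite (FZ _ _ hchi hX) chip scale1r.
have -> : (fun q => chi q *: X q) =
    (fun q => chi q *: \sum_i c i q *: frame p (delta_mx 0 i) q).
  apply/funext => q; rewrite /chi; case: pselect => [pq|npq] /=.
    by congr (_ *: _); exact: frame_decomposition.
  exact: etrans (scale0r _) (esym (scale0r _)).
rewrite (FZ _ _ hchi (smooth_vf_at_sum _ hcf)).
rewrite chip scale1r Fsum; apply: eq_bigr => i _.
by rewrite /c push_id.
Qed.

Lemma tensorial_eq (W : lmodType R) (F : (M -> 'rV[R]_m) -> W) p :
  (forall X Y, smooth_vf_at p X -> smooth_vf_at p Y ->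
     F (fun q => X q + Y q) = F X + F Y) ->
  (forall f X, smooth_fun_at p f -> smooth_vf_at p X ->
     F (fun q => f q *: X q) = f p *: F X) ->
  forall X Y, smooth_vf_at p X -> smooth_vf_at p Y -> X p = Y p -> F X = F Y.
Proof.
move=> FD FZ X Y hX hY XY.
by rewrite !(tensorial_expansion FD FZ) // XY.
Qed.

Lemma dfun_chart q p f v : smooth_fun_at p f -> cdom A q p ->
  dfun A f p v = 'D_(push p q p v) (f \o cinv A q : _ -> R^o) (cmap A q p).
Proof.
move=> hf qp; rewrite /dfun pushE.
have E : (cmap A q \o cinv A p) (cmap A p p) = cmap A q p.
  by rewrite /= (sa_mapK hA).
rewrite -[X in 'D_('D_v _ _) _ X]E -derive_comp; last 2 first.
- exact: transition_differentiable.
- by rewrite E; exact: smooth_fun_at_differentiable.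
apply: near_eq_derive.
apply: filterS (near_chart (center p) (near_cdom qp)) => u [_ bu _] /=.
by rewrite (sa_mapK hA bu).
Qed.

Lemma dfun_eq p (f h : M -> R) v : {near p, f =1 h} -> dfun A f p v = dfun A h p v.
Proof.
move=> fh; apply: near_eq_derive.
by apply: filterS (near_chart (center p) fh) => u [].
Qed.

Lemma dfunD p f h v : smooth_fun_at p f -> smooth_fun_at p h ->
  dfun A (fun q => f q + h q) p v = dfun A f p v + dfun A h p v.
Proof.
move=> hf hh; apply: deriveD; apply: diff_derivable;
exact: smooth_fun_at_differentiable.
Qed.

Lemma dfunM p f h v : smooth_fun_at p f -> smooth_fun_at p h ->
  dfun A (fun q => f q * h q) p v = dfun A f p v * h p + f p * dfun A h p v.
Proof.
move=> hf hh; rewrite /dfun.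
rewrite [LHS](@derive_scale _ _ _ (f \o cinv A p : _ -> R^o)
  (h \o cinv A p : _ -> R^o)); try exact: smooth_fun_at_differentiable.
by rewrite /= (sa_mapK hA).
Qed.

Lemma dfun_cst p (k : R) v : dfun A (fun=> k) p v = 0.
Proof. exact: derive_cst. Qed.

Lemma dfunZ p (k : R) f v : smooth_fun_at p f ->
  dfun A (fun q => k * f q) p v = k * dfun A f p v.
Proof.
move=> hf; apply: (etrans (dfunM v (smooth_fun_at_cst p k) hf)).
have -> : dfun A (fun=> k) p v = 0 by exact: dfun_cst.
by rewrite mul0r add0r.
Qed.

Lemma smooth_fun_atZ p (k : R) f : smooth_fun_at p f ->
  smooth_fun_at p (fun q => k * f q).
Proof. by move=> hf; exact: (smooth_fun_atM (smooth_fun_at_cst p k) hf). Qed.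

Lemma dfunB p f h v : smooth_fun_at p f -> smooth_fun_at p h ->
  dfun A (fun q => f q - h q) p v = dfun A f p v - dfun A h p v.
Proof.
move=> hf hh; have E : {near p, (fun q => f q - h q) =1 fun q => f q + -1 * h q}.
  by apply: nearW => q; rewrite mulN1r.
apply: (etrans (dfun_eq v E)).
apply: (etrans (dfunD v hf (smooth_fun_atZ (-1) hh))).
by rewrite (dfunZ (-1) v hh) mulN1r.
Qed.

Lemma near_dfun_chart p f X : smooth_fun_at p f ->
  {near cmap A p p, (fun q => dfun A f q (X q)) \o cinv A p =1
     fun u => 'D_(local_rep A p X u) (f \o cinv A p : _ -> R^o) u}.
Proof.
move=> hf.
have nf := smooth_fun_at_near hf.
apply: filterS (near_chart (center p) nf) => u [pu fu uE] /=.
by rewrite (dfun_chart _ fu pu) uE /local_rep tcompE.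
Qed.

Lemma smooth_fun_at_dfun p f X : smooth_fun_at p f -> smooth_vf_at p X ->
  smooth_fun_at p (fun q => dfun A f q (X q)).
Proof.
move=> hf hX; have [U [oU Up Uf UX]] := smooth_fun_vf_at2 hf hX.
pose V := U `&` cdom A p.
have oV : open V by apply: openI => //; exact: sa_dom_open.
exists V; split; [exact: oV|by []|apply: (@smooth_fun_chart p _ _ oV)]; first by move=> x [].
have oV' := @open_cimg p _ oV.
have VU : cimg p V `<=` cimg p U by apply: cimgS => x [].
have S := smooth_on_derive_along oV' (fun u h => h) (smooth_on_sub VU (UX p))
  (smooth_on_id oV') (smooth_on_sub VU (Uf p)).
apply: (smooth_on_eq oV' _ S) => _ [x [px [Ux _]] <-] /=.
have hfx : smooth_fun_at x f by exists U; split.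
by rewrite (sa_mapK hA px) (@dfun_chart p x f _ hfx px) (local_repE X px).
Qed.

(** In X(Y f) - Y(X f) the second derivatives of [f] cancel by [derive_commute]; what remains is the
    derivative of [f] along the differentiated components, which is the bracket in the chart around
    [p]. *)
Lemma dfun_lie_bracket p f X Y : smooth_fun_at p f -> smooth_vf_at p X ->
  smooth_vf_at p Y ->
  dfun A f p (lie_bracket A X Y p) =
    dfun A (fun q => dfun A f q (Y q)) p (X p) -
    dfun A (fun q => dfun A f q (X q)) p (Y p).
Proof.
move=> hf hX hY.
have [U [oU Up UX UY]] := smooth_vf_at2 hX hY.
have [V [oV Vp Vf]] := hf.
pose W := cimg p (U `&` V).
have oW : open W by apply: open_cimg; exact: openI.
have Wp : W (cmap A p p) by exact: cimgP.
have WU : W `<=` cimg p U by apply: cimgS => x [].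
have WX := smooth_on_sub WU (UX p); have WY := smooth_on_sub WU (UY p).
have Wf : smooth_on W (f \o cinv A p : _ -> R^o).
  by apply: smooth_on_sub (Vf p); apply: cimgS => x [].
have df := smooth_on_differentiable Wf Wp.
pose F : 'rV[R]_m -> R^o := f \o cinv A p.
have LE Z : local_rep A p Z (cmap A p p) = Z p.
  by rewrite (local_repE Z (center p)) (push_id _ (center p)).
have EX := etrans (near_eq_derive (X p) (near_dfun_chart Y hf))
  (@derive_derive_along R m R^o W _ F _ (X p) _ oW Wp WY Wf (LE Y)).
have EY := etrans (near_eq_derive (Y p) (near_dfun_chart X hf))
  (@derive_derive_along R m R^o W _ F _ (Y p) _ oW Wp WX Wf (LE X)).
have SE := derive_commute (X p) (Y p) oW Wp Wf.
apply: (etrans _ (esym (congr2 (fun r s : R => r - s) EX EY))).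
apply: (etrans (deriveBv _ _ df)).
have K (r s t : R) : r - s = (r + t) - (s + t) by ring.
by move: SE => ->; exact: K.
Qed.

Lemma smooth_chart_coordinate p k q : cdom A p q ->
  smooth_fun_at q (fun x => cmap A p x 0 k).
Proof.
move=> pq; have op := sa_dom_open hA p.
exists (cdom A p); split; [exact: op|exact: pq|].
apply: (@smooth_fun_chart p _ _ op); first by [].
have S := smooth_on_coord k (@open_cimg p _ op) (smooth_on_id (@open_cimg p _ op)).
apply: (smooth_on_eq (@open_cimg p _ op) _ S) => _ [x [px _] <-] /=.
by rewrite (sa_mapK hA).
Qed.

Lemma dfun_chart_coordinate p k q v : cdom A p q ->
  dfun A (fun x => cmap A p x 0 k) q v = push q p q v 0 k.
Proof.
move=> pq; rewrite /dfun pushE -derive_coord //.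
exact: transition_differentiable.
Qed.

(** At [q] the bracket is computed in the chart around [q], where the coordinate fields of [p] have
    varying components. It is therefore tested on the coordinate functions of the chart around [p],
    whose derivatives along these fields are constant. *)
Lemma lie_bracket_frame p v w q : cdom A p q ->
  lie_bracket A (frame p v) (frame p w) q = 0.
Proof.
move=> pq; set b := lie_bracket _ _ _ _.
suff b0 : push q p q b = 0 by rewrite -(frame_push b pq) b0 /frame push0.
apply/rowP => k; rewrite mxE -(dfun_chart_coordinate k b pq).
have hk := smooth_chart_coordinate k pq.
rewrite /b (dfun_lie_bracket hk (smooth_frame_at v pq) (smooth_frame_at w pq)).
have E u : {near q, (fun x => dfun A (fun y => cmap A p y 0 k) x (frame p u x)) =1
    fun=> u 0 k}.
  apply: filterS (near_cdom pq) => x px.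
  apply: (etrans (dfun_chart_coordinate k _ px)).
  by rewrite (push_frame u px).
have E0 u u' : dfun A (fun x => dfun A (fun y => cmap A p y 0 k) x (frame p u x))
    q u' = 0.
  apply: etrans (dfun_cst q (u 0 k) u'); exact: dfun_eq (E u).
exact: etrans (congr2 (fun r s : R => r - s) (E0 _ _) (E0 _ _)) (subrr 0).
Qed.

End ManifoldCalculus.

(** * Affine and Levi-Civita connections *)

Section Connection.
#[local] Opaque smooth_on derive smooth_vf_at smooth_fun_at smooth_vf smooth_fun.
Context {R : realType} {m : nat} {M : topologicalType} {A : charts R m M}.
Hypothesis hA : smooth_atlas A.
Context {D : M -> 'rV[R]_m -> (M -> 'rV[R]_m) -> 'rV[R]_m}.
Hypothesis hD : affine_connection A D.
Implicit Types (p q : M) (v w : 'rV[R]_m) (X Y Z : M -> 'rV[R]_m).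
Implicit Types (f : M -> R) (J : M -> 'M[R]_m).

Lemma conn_linear_at p (k : R) v w Y : smooth_vf_at A p Y ->
  D p (k *: v + w) Y = k *: D p v Y + D p w Y.
Proof.
move=> hY; have [U [oU Up UY _]] := smooth_vf_at2 hY hY.
exact: (conn_linear hD) UY.
Qed.

Lemma connDv p v w Y : smooth_vf_at A p Y -> D p (v + w) Y = D p v Y + D p w Y.
Proof. by move=> hY; rewrite -{1}(scale1r v) conn_linear_at // scale1r. Qed.

Lemma conn0v p Y : smooth_vf_at A p Y -> D p 0 Y = 0.
Proof.
move=> hY; apply: (@addrI _ (D p 0 Y)).
by rewrite -connDv // !addr0.
Qed.

Lemma connZv p (k : R) v Y : smooth_vf_at A p Y -> D p (k *: v) Y = k *: D p v Y.
Proof. by move=> hY; rewrite -(addr0 (k *: v)) conn_linear_at // conn0v // addr0. Qed.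

Lemma conn_addf p v Y Z : smooth_vf_at A p Y -> smooth_vf_at A p Z ->
  D p v (fun q => Y q + Z q) = D p v Y + D p v Z.
Proof.
move=> hY hZ; have [U [oU Up UY UZ]] := smooth_vf_at2 hY hZ.
exact: (conn_add hD) UY UZ.
Qed.

Lemma conn_scalef p v f Y : smooth_fun_at A p f -> smooth_vf_at A p Y ->
  D p v (fun q => f q *: Y q) = dfun A f p v *: Y p + f p *: D p v Y.
Proof.
move=> hf hY; have [U [oU Up Uf UY]] := smooth_fun_vf_at2 hf hY.
exact: (conn_leibniz hD) Uf UY.
Qed.

Lemma conn_cscalef p v (k : R) Y : smooth_vf_at A p Y ->
  D p v (fun q => k *: Y q) = k *: D p v Y.
Proof.
move=> hY; rewrite (@conn_scalef p v (fun=> k)) //; last exact: smooth_fun_at_cst.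
by rewrite dfun_cst scale0r add0r.
Qed.

Lemma conn_smooth_at p X Y : smooth_vf_at A p X -> smooth_vf_at A p Y ->
  smooth_vf_at A p (fun q => D q (X q) Y).
Proof.
move=> hX hY; have [U [oU Up UX UY]] := smooth_vf_at2 hX hY.
by apply: (smooth_vf_atI oU Up); exact: (conn_smooth hD).
Qed.

(** Locality from the Leibniz rule: the indicator [chi] of the set where the fields agree is
    constant near [p], and its products with [X] and with [Y] are equal everywhere. *)
Lemma conn_eq p v X Y : {near p, X =1 Y} -> smooth_vf_at A p X ->
  D p v X = D p v Y.
Proof.
move=> XY hX; have hY := smooth_vf_at_eq hA XY hX.
pose chi q : R := if X q == Y q then 1 else 0.
have nchi : {near p, (fun=> 1) =1 chi}.
  by apply: filterS XY => q XYq; rewrite /chi XYq eqxx.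
have hchi := smooth_fun_at_eq hA nchi (smooth_fun_at_cst A p 1).
have chip : chi p = 1 by rewrite /chi (nbhs_singleton XY) eqxx.
have dchi : dfun A chi p v = 0.
  by rewrite -(dfun_eq hA v nchi); exact: dfun_cst.
have E Z : smooth_vf_at A p Z -> D p v (fun q => chi q *: Z q) = D p v Z.
  by move=> hZ; rewrite (conn_scalef v hchi hZ) dchi chip scale0r add0r scale1r.
rewrite -(E X hX) -(E Y hY); congr (D p v _); apply/funext => q.
by rewrite /chi; case: eqP => [->|_]; rewrite ?scale0r.
Qed.

Lemma nablaE p v X : smooth_vf_at A p X -> v *m nabla D X p = D p v X.
Proof.
move=> hX.
have lin : linear (fun v => D p v X) by move=> k u w; exact: conn_linear_at.
pose L : {linear 'rV[R]_m -> 'rV[R]_m} :=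
  HB.pack (fun v => D p v X) (GRing.isLinear.Build _ _ _ _ _ lin).
exact: (mul_rV_lin1 L).
Qed.

Lemma local_rep_near_frame p w :
  {near cmap A p p, (fun=> w) =1 local_rep A p (frame A p w)}.
Proof.
apply: filterS (near_chart hA (sa_center hA p) (near_cdom hA (sa_center hA p))).
move=> u [pu _ uE].
by rewrite -[X in local_rep _ _ _ X]uE (local_repE hA _ pu) (push_frame hA).
Qed.

Lemma derive_local_rep_frame p v w :
  'D_v (local_rep A p (frame A p w)) (cmap A p p) = 0.
Proof.
apply: etrans (derive_cst w (cmap A p p) v); apply/esym.
exact: near_eq_derive (local_rep_near_frame p w).
Qed.

Lemma derive_local_repD p v X Y : smooth_vf_at A p X -> smooth_vf_at A p Y ->
  'D_v (local_rep A p (fun q => X q + Y q)) (cmap A p p) =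
  'D_v (local_rep A p X) (cmap A p p) + 'D_v (local_rep A p Y) (cmap A p p).
Proof.
move=> hX hY; have pp := sa_center hA p.
have dX := smooth_vf_at_differentiable hX pp.
have dY := smooth_vf_at_differentiable hY pp.
rewrite -deriveD; [|exact: diff_derivable|exact: diff_derivable].
apply: near_eq_derive; apply: filterS (near_chart hA pp (near_cdom hA pp)).
move=> u [pu _ uE]; rewrite -{}uE /= !fctE.
rewrite !(local_repE hA _ pu) (pushD hA) //; exact: sa_center.
Qed.

Lemma derive_local_repZ p v f X : smooth_fun_at A p f -> smooth_vf_at A p X ->
  'D_v (local_rep A p (fun q => f q *: X q)) (cmap A p p) =
  dfun A f p v *: X p + f p *: 'D_v (local_rep A p X) (cmap A p p).
Proof.
move=> hf hX; have pp := sa_center hA p.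
have dX := smooth_vf_at_differentiable hX pp.
have df := smooth_fun_at_differentiable hf pp.
have E := derive_scale v df dX.
rewrite /= (sa_mapK hA pp) (local_repE hA _ pp) (push_id hA _ pp) in E.
rewrite -[RHS]E.
apply: near_eq_derive; apply: filterS (near_chart hA pp (near_cdom hA pp)).
move=> u [pu _ uE]; rewrite -{}uE /=.
rewrite !(local_repE hA _ pu) (pushZ hA) ?(sa_mapK hA pu) //; exact: sa_center.
Qed.

(* [D p v (frame A p w)] are the Christoffel symbols of the preferred chart. *)
Lemma conn_christoffel p v X : smooth_vf_at A p X ->
  D p v X = 'D_v (local_rep A p X) (cmap A p p) + D p v (frame A p (X p)).
Proof.
move=> hX; have pp := sa_center hA p.
have hF w : smooth_vf_at A p (frame A p w) by exact: smooth_frame_at.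
(* The difference of two connections, here [D] and the flat connection of the chart, is tensorial;
   hence [X] may be replaced by the frame field with the same value at [p]. *)
pose F X := D p v X - 'D_v (local_rep A p X) (cmap A p p).
have FX : F X = F (frame A p (X p)).
  apply: (@tensorial_eq _ _ _ _ hA _ F p _ _ X _ hX (hF _)); rewrite /F.
  - move=> Y Z hY hZ; rewrite (conn_addf _ hY hZ) (derive_local_repD _ hY hZ).
    by rewrite opprD addrACA.
  - move=> f Y hf hY; rewrite (conn_scalef _ hf hY) (derive_local_repZ _ hf hY).
    by rewrite opprD addrACA subrr add0r scalerBr.
  - by rewrite (frame_center hA).
have FF : F (frame A p (X p)) = D p v (frame A p (X p)).
  by rewrite /F derive_local_rep_frame subr0.
by rewrite -FF -FX /F addrC subrK.
Qed.

(** This is [(nabla_v J) X]; for [J = nabla T] it is the second covariant derivative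
    [nabla^2_(v,X) T]. *)
Definition cov_endo J p v X := D p v (fun q => X q *m J q) - D p v X *m J p.

Definition smooth_endo_at J p :=
  forall X, smooth_vf_at A p X -> smooth_vf_at A p (fun q => X q *m J q).

Lemma cov_endoDf J p v X Y : smooth_endo_at J p ->
  smooth_vf_at A p X -> smooth_vf_at A p Y ->
  cov_endo J p v (fun q => X q + Y q) = cov_endo J p v X + cov_endo J p v Y.
Proof.
move=> hJ hX hY; rewrite /cov_endo (conn_addf _ hX hY).
have -> : (fun q => (X q + Y q) *m J q) = (fun q => X q *m J q + Y q *m J q).
  by apply/funext => q; rewrite mulmxDl.
rewrite (conn_addf _ (hJ _ hX) (hJ _ hY)).
by rewrite mulmxDl opprD addrACA.
Qed.

Lemma cov_endo_scalef J p v f X : smooth_endo_at J p ->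
  smooth_fun_at A p f -> smooth_vf_at A p X ->
  cov_endo J p v (fun q => f q *: X q) = f p *: cov_endo J p v X.
Proof.
move=> hJ hf hX; rewrite /cov_endo (conn_scalef _ hf hX).
have -> : (fun q => (f q *: X q) *m J q) = (fun q => f q *: (X q *m J q)).
  by apply/funext => q; rewrite scalemxAl.
rewrite (conn_scalef _ hf (hJ _ hX)).
by rewrite mulmxDl -!scalemxAl opprD addrACA subrr add0r scalerBr.
Qed.

(** Derivatives of coefficients cancel between the two terms of [cov_endo], so it is linear over
    functions. Later proofs use this to pick a convenient extension of [X p]. *)
Lemma cov_endo_tensorial J p v X Y : smooth_endo_at J p ->
  smooth_vf_at A p X -> smooth_vf_at A p Y -> X p = Y p ->
  cov_endo J p v X = cov_endo J p v Y.
Proof.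
move=> hJ; apply: (tensorial_eq hA) => [{}X {}Y hX hY|f {}X hf hX].
  exact: cov_endoDf.
exact: cov_endo_scalef.
Qed.

Lemma cov_endoZf J p v (k : R) X : smooth_endo_at J p -> smooth_vf_at A p X ->
  cov_endo J p v (fun q => k *: X q) = k *: cov_endo J p v X.
Proof. by move=> hJ; exact: (cov_endo_scalef _ hJ (smooth_fun_at_cst A p k)). Qed.

Lemma cov_endoDv J p v w X : smooth_endo_at J p -> smooth_vf_at A p X ->
  cov_endo J p (v + w) X = cov_endo J p v X + cov_endo J p w X.
Proof.
move=> hJ hX; rewrite /cov_endo (connDv _ _ hX) (connDv _ _ (hJ _ hX)).
by rewrite mulmxDl opprD addrACA.
Qed.

Lemma cov_endoZv J p (k : R) v X : smooth_endo_at J p -> smooth_vf_at A p X ->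
  cov_endo J p (k *: v) X = k *: cov_endo J p v X.
Proof.
move=> hJ hX; rewrite /cov_endo (connZv _ _ hX) (connZv _ _ (hJ _ hX)).
by rewrite -scalemxAl scalerBr.
Qed.

Lemma smooth_endo_nabla p T : (forall q, smooth_vf_at A q T) ->
  smooth_endo_at (nabla D T) p.
Proof.
move=> hT X hX; apply: (smooth_vf_at_eq hA _ (conn_smooth_at hX (hT p))).
by apply: nearW => q; rewrite (nablaE _ (hT q)).
Qed.

End Connection.
Arguments cov_endo {R m M} D J p v X.
Arguments smooth_endo_at {R m M} A J p.

Section Gram.
Context {R : realType} {m : nat} {M : topologicalType}.
Variable g : M -> 'M[R]_m.
Implicit Types (p : M) (u v w : 'rV[R]_m).

Lemma ipDl p u v w : ip g p (u + v) w = ip g p u w + ip g p v w.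
Proof. by rewrite /ip !mulmxDl mxE. Qed.

Lemma ipDr p u v w : ip g p u (v + w) = ip g p u v + ip g p u w.
Proof. by rewrite /ip linearD /= mulmxDr mxE. Qed.

Lemma ipZl p (k : R) v w : ip g p (k *: v) w = k * ip g p v w.
Proof. by rewrite /ip -!scalemxAl mxE. Qed.

Lemma ipZr p (k : R) v w : ip g p v (k *: w) = k * ip g p v w.
Proof. by rewrite /ip linearZ /= -scalemxAr mxE. Qed.

Lemma ipNl p v w : ip g p (- v) w = - ip g p v w.
Proof. by rewrite -scaleN1r ipZl mulN1r. Qed.

Lemma ipNr p v w : ip g p v (- w) = - ip g p v w.
Proof. by rewrite -scaleN1r ipZr mulN1r. Qed.

Lemma ipBl p u v w : ip g p (u - v) w = ip g p u w - ip g p v w.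
Proof. by rewrite ipDl ipNl. Qed.

Lemma ipBr p u v w : ip g p u (v - w) = ip g p u v - ip g p u w.
Proof. by rewrite ipDr ipNr. Qed.

Lemma ip0l p v : ip g p 0 v = 0.
Proof. by rewrite -(scale0r 0) ipZl mul0r. Qed.

Lemma ip0r p v : ip g p v 0 = 0.
Proof. by rewrite -(scale0r 0) ipZr mul0r. Qed.

Lemma ip_sym p v w : (g p)^T = g p -> ip g p v w = ip g p w v.
Proof.
move=> gT; rewrite /ip -[in RHS](trmxK (w *m g p *m v^T)) [in RHS]mxE.
by rewrite !trmx_mul trmxK gT mulmxA.
Qed.

Lemma ip_nondegenerate p v : g p \in unitmx -> (forall w, ip g p v w = 0) -> v = 0.
Proof.
move=> gU H; apply: (can_inj (mulmxK gU)); rewrite mul0mx.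
apply/rowP => j; have := H (delta_mx 0 j); rewrite /ip trmx_delta -colE !mxE.
exact.
Qed.

End Gram.

(** * Levi-Civita connections, Killing fields and the second covariant derivative of [T] *)

Section LeviCivita.
#[local] Opaque smooth_on derive smooth_vf_at smooth_fun_at smooth_vf smooth_fun.
Context {R : realType} {m : nat} {M : topologicalType} {A : charts R m M}.
Hypothesis hA : smooth_atlas A.
Context {g : M -> 'M[R]_m} {D : M -> 'rV[R]_m -> (M -> 'rV[R]_m) -> 'rV[R]_m}.
Hypothesis metric_sm : forall U X Y, open U -> smooth_vf A U X ->
  smooth_vf A U Y -> smooth_fun A U (fun p => ip g p (X p) (Y p)).
Hypothesis gsym : forall p, (g p)^T = g p.
Hypothesis hD : levi_civita A g D.
Implicit Types (p q : M) (v w : 'rV[R]_m) (X Y Z : M -> 'rV[R]_m).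

Let hc := lc_connection hD.

Lemma ipC p v w : ip g p v w = ip g p w v.
Proof. exact: ip_sym. Qed.

Lemma smooth_ip p X Y : smooth_vf_at A p X -> smooth_vf_at A p Y ->
  smooth_fun_at A p (fun q => ip g q (X q) (Y q)).
Proof.
move=> hX hY; have [U [oU Up UX UY]] := smooth_vf_at2 hX hY.
by apply: (smooth_fun_atI oU Up); exact: metric_sm.
Qed.

Lemma dfun_ip p v X Y : smooth_vf_at A p X -> smooth_vf_at A p Y ->
  dfun A (fun q => ip g q (X q) (Y q)) p v =
  ip g p (D p v X) (Y p) + ip g p (X p) (D p v Y).
Proof.
move=> hX hY; have [U [oU Up UX UY]] := smooth_vf_at2 hX hY.
exact: (lc_metric hD) oU Up UX UY.
Qed.

Lemma torsion_free_at p X Y : smooth_vf_at A p X -> smooth_vf_at A p Y ->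
  D p (X p) Y - D p (Y p) X = lie_bracket A X Y p.
Proof.
move=> hX hY; have [U [oU Up UX UY]] := smooth_vf_at2 hX hY.
exact: (lc_torsion_free hD) oU Up UX UY.
Qed.

(** Symmetry of the Christoffel symbols: coordinate fields commute and the torsion vanishes. *)
Lemma conn_frame_sym p q v w : cdom A p q ->
  D q (frame A p v q) (frame A p w) = D q (frame A p w q) (frame A p v).
Proof.
move=> pq; apply/eqP; rewrite -subr_eq0; apply/eqP.
rewrite (torsion_free_at (smooth_frame_at hA v pq) (smooth_frame_at hA w pq)).
exact: lie_bracket_frame.
Qed.

(** Torsion-freeness writes [T, X] as nabla_T X - nabla_X T, and metric compatibility cancels the
    nabla_T terms in the Lie derivative of [g]. Frame fields realize arbitrary vectors at [p]. *)
Lemma killing_skew T : (forall p, smooth_vf_at A p T) ->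
  killing A g T <->
  forall p v w, ip g p (D p v T) w + ip g p v (D p w T) = 0.
Proof.
move=> hT.
have key p X Y : smooth_vf_at A p X -> smooth_vf_at A p Y ->
    dfun A (fun q => ip g q (X q) (Y q)) p (T p) -
    (ip g p (lie_bracket A T X p) (Y p) + ip g p (X p) (lie_bracket A T Y p)) =
    ip g p (D p (X p) T) (Y p) + ip g p (X p) (D p (Y p) T).
  move=> hX hY; rewrite (dfun_ip _ hX hY).
  by rewrite -(torsion_free_at (hT p) hX) -(torsion_free_at (hT p) hY) ipBl ipBr; ring.
split => [K p v w|S U p X Y oU Up UX UY].
  have hv : smooth_vf_at A p (frame A p v) := smooth_frame_at hA v (sa_center hA p).
  have hw : smooth_vf_at A p (frame A p w) := smooth_frame_at hA w (sa_center hA p).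
  have := key p _ _ hv hw.
  have [U [oU Up UX UY]] := smooth_vf_at2 hv hw.
  by rewrite (K U p _ _ oU Up UX UY) subrr !(frame_center hA).
apply/eqP; rewrite -subr_eq0; apply/eqP.
rewrite key; [exact: S|exact: (smooth_vf_atI oU Up)|exact: (smooth_vf_atI oU Up)].
Qed.

(** On eigenfields (nabla_X J) Y = s nabla_X Y - J (nabla_X Y); antisymmetrizing brings in the
    bracket. Thus the bracket is an eigenvector exactly when nabla J is symmetric on the two fields,
    which serves both for deducing and for using involutivity. *)
Lemma eigen_bracket J p s X Y : smooth_endo_at A J p ->
  smooth_vf_at A p X -> smooth_vf_at A p Y ->
  {near p, (fun q => X q *m J q) =1 fun q => s *: X q} ->
  {near p, (fun q => Y q *m J q) =1 fun q => s *: Y q} ->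
  cov_endo D J p (X p) Y - cov_endo D J p (Y p) X =
  s *: lie_bracket A X Y p - lie_bracket A X Y p *m J p.
Proof.
move=> hJ hX hY XJ YJ.
rewrite -(torsion_free_at hX hY) /cov_endo.
rewrite (conn_eq hA hc (X p) YJ (hJ _ hY)) (conn_eq hA hc (Y p) XJ (hJ _ hX)).
rewrite (conn_cscalef hc _ _ hX) (conn_cscalef hc _ _ hY).
by rewrite mulmxBl scalerBr !opprD !opprK addrACA.
Qed.

Section Skew.
Variable T : M -> 'rV[R]_m.
Hypothesis hT : forall p, smooth_vf_at A p T.
Hypothesis skew : forall p v w, ip g p (D p v T) w + ip g p v (D p w T) = 0.

Let J := nabla D T.
Let JE p v : v *m J p = D p v T. Proof. exact: (nablaE hc v (hT p)). Qed.
Let hJ p : smooth_endo_at A J p. Proof. exact: (smooth_endo_nabla hA hc). Qed.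

Lemma ip_nabla_skew p v w : ip g p (v *m J p) w = - ip g p v (w *m J p).
Proof. by apply/eqP; rewrite -addr_eq0 !JE skew. Qed.

Lemma dfun_ip_nabla p v X Y : smooth_vf_at A p X -> smooth_vf_at A p Y ->
  dfun A (fun q => ip g q (X q *m J q) (Y q)) p v =
  ip g p (cov_endo D J p v X) (Y p) + ip g p (D p v X *m J p) (Y p) +
  ip g p (X p *m J p) (D p v Y).
Proof.
move=> hX hY; rewrite (dfun_ip _ (hJ hX) hY).
by rewrite /cov_endo ipBl subrK.
Qed.

(** Covariant derivative of the identity g(J X, Y) = - g(J Y, X); the terms that differentiate [X]
    and [Y] cancel. *)
Lemma cov_endo_nabla_skew p v X Y : smooth_vf_at A p X -> smooth_vf_at A p Y ->
  ip g p (cov_endo D J p v X) (Y p) =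
  - ip g p (cov_endo D J p v Y) (X p).
Proof.
move=> hX hY.
have := dfun_ip_nabla v hX hY; have := dfun_ip_nabla v hY hX.
have E : (fun q => ip g q (Y q *m J q) (X q)) =
    (fun q => -1 * ip g q (X q *m J q) (Y q)).
  by apply/funext => q; rewrite ip_nabla_skew ipC mulN1r.
rewrite E (dfunZ hA _ _ (smooth_ip (hJ hX) hY)) !(ip_nabla_skew _ (D p v _)).
rewrite (ipC _ (Y p *m _)) (ipC _ (X p *m _)) => H1 H2.
by move: H1; rewrite H2; lra.
Qed.

(* d(dxi) = 0 for the one-form xi dual to T, whose differential is twice
   [(y, z) |-> ip (y *m J) z]. *)
Lemma cov_endo_nabla_cyclic p x y z :
  ip g p (cov_endo D J p x (frame A p y)) z +
  ip g p (cov_endo D J p y (frame A p z)) x +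
  ip g p (cov_endo D J p z (frame A p x)) y = 0.
Proof.
have pp := sa_center hA p.
(* [F], and below [xi], [dxi] and [om], are introduced through existentials, so that only the listed
   equations are available and nothing unfolds. *)
have [F [FE hF Fsym Fbr]] : exists F : 'rV[R]_m -> M -> 'rV[R]_m,
    [/\ forall w, F w = frame A p w,
        forall w q, cdom A p q -> smooth_vf_at A q (F w),
        forall v w q, cdom A p q -> D q (F v q) (F w) = D q (F w q) (F v) &
        forall v w, lie_bracket A (F v) (F w) p = 0].
  exists (frame A p); split; [by []|exact: smooth_frame_at| |].
    by move=> v w q; exact: conn_frame_sym.
  by move=> v w; exact: (lie_bracket_frame hA).
have Fp w : F w p = w by rewrite FE (frame_center hA).
have hFp w : smooth_vf_at A p (F w) := hF w p pp.
have sym v w : D p v (F w) = D p w (F v) by have := Fsym v w p pp; rewrite !Fp.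
rewrite -!FE {FE}.
have [xi xiE] : exists xi, forall w, xi w = fun q => ip g q (T q) (F w q).
  by exists (fun w q => ip g q (T q) (F w q)).
have hxi w : smooth_fun_at A p (xi w) by rewrite xiE; exact: (smooth_ip (hT p) (hFp w)).
have [dxi dxiE] : exists dxi, forall v w, dxi v w = fun q => dfun A (xi w) q (F v q).
  by exists (fun v w q => dfun A (xi w) q (F v q)).
have hdxi v w : smooth_fun_at A p (dxi v w).
  by rewrite dxiE; exact: (smooth_fun_at_dfun hA (hxi w) (hFp v)).
have [om omE] : exists om, forall v w, om v w = fun q => ip g q (F v q *m J q) (F w q).
  by exists (fun v w q => ip g q (F v q *m J q) (F w q)).
have hom v w : smooth_fun_at A p (om v w).
  by rewrite omE; exact: (smooth_ip (hJ (hFp v)) (hFp w)).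
(* Second derivatives of [xi w] along coordinate fields commute because the fields do. *)
have comm u v w : dfun A (dxi v w) p u = dfun A (dxi u w) p v.
  have := dfun_lie_bracket hA (hxi w) (hFp u) (hFp v).
  rewrite Fbr !Fp -!dxiE => H.
  apply/eqP; rewrite -subr_eq0; apply/eqP; apply: (etrans (esym H)).
  exact: derive0.
(* The exterior derivative of [xi] on coordinate fields: the terms with nabla of the frame drop out
   by [Fsym], and skewness of [J] doubles the rest. *)
have dxi_om v w : {near p, (fun q => 2 * om v w q) =1 (fun q => dxi v w q - dxi w v q)}.
  apply: filterS (near_cdom hA pp) => q pq.
  have E u u' : dxi u u' q = ip g q (F u q *m J q) (F u' q) +
      ip g q (T q) (D q (F u q) (F u')).
    by rewrite JE dxiE xiE; exact: (dfun_ip _ (hT q) (hF u' q pq)).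
  rewrite !E (Fsym w v q pq) omE (ip_nabla_skew _ (F w q)) (ipC _ (F w q)).
  by ring.
have dom u v w : 2 * dfun A (om v w) p u = dfun A (dxi v w) p u - dfun A (dxi w v) p u.
  apply: (etrans (esym (dfunZ hA 2 u (hom v w)))).
  apply: (etrans (dfun_eq hA u (dxi_om v w))).
  exact: (dfunB hA u (hdxi v w) (hdxi w v)).
have E u v w : 2 * ip g p (cov_endo D J p u (F v)) w =
    dfun A (dxi v w) p u - dfun A (dxi w v) p u -
    2 * ip g p (D p u (F v) *m J p) w - 2 * ip g p (v *m J p) (D p u (F w)).
  have := dfun_ip_nabla u (hFp v) (hFp w); rewrite -omE !Fp => Eo.
  by rewrite -dom Eo; ring.
suff : 2 * (ip g p (cov_endo D J p x (F y)) z +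
  ip g p (cov_endo D J p y (F z)) x +
  ip g p (cov_endo D J p z (F x)) y) = 0.
  by move/eqP; rewrite mulf_eq0 pnatr_eq0 /= => /eqP.
(* In the cyclic sum [comm] pairs off the second derivatives; [sym] and skewness pair off the terms
   with derivatives of the frame. *)
rewrite !mulrDr !E (comm x y z) (comm y z x) (comm z x y).
rewrite (sym z x) (sym y x) (sym z y).
have sk v w : ip g p (D p v (F w) *m J p) =1 (fun u => - ip g p (u *m J p) (D p v (F w))).
  by move=> u; rewrite ip_nabla_skew ipC.
rewrite !sk.
by ring.
Qed.

End Skew.

End LeviCivita.

(** * The Sasakian equation *)

Section SasakianAlgebra.
Context {R : realFieldType} {V : lmodType R}.
Variables (h : V -> V -> R) (J : V -> V) (t : V) (B : V -> V -> V -> R).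
(* Here [h] is the metric, [J] the endomorphism [nabla T] and [B x y z] stands
   for [h (nabla^2_(x,y) T) z]. *)
Hypothesis hD : forall u v w, h (u + v) w = h u w + h v w.
Hypothesis hZ : forall k v w, h (k *: v) w = k * h v w.
Hypothesis hC : forall v w, h v w = h w v.
Hypothesis htt : h t t = -1.
Hypothesis JD : forall v w, J (v + w) = J v + J w.
Hypothesis JZ : forall k v, J (k *: v) = k *: J v.
Hypothesis JJ : forall v, h v t = 0 -> J (J v) = v.
Hypothesis hJt : forall v, h (J v) t = 0.
Hypothesis BD1 : forall x x' y z, B (x + x') y z = B x y z + B x' y z.
Hypothesis BZ1 : forall k x y z, B (k *: x) y z = k * B x y z.
Hypothesis BD2 : forall x y y' z, B x (y + y') z = B x y z + B x y' z.
Hypothesis BZ2 : forall k x y z, B x (k *: y) z = k * B x y z.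
Hypothesis Bskew : forall x y z, B x y z = - B x z y.
Hypothesis Bcyclic : forall x y z, B x y z + B y z x + B z x y = 0.
Hypothesis Bt : forall x z, B x t z = - (h x z + h x t * h t z).
Hypothesis BJ : forall x y z, h y t = 0 -> h z t = 0 -> B x (J y) z = B x y (J z).
Hypothesis Bsym : forall s x y z, s = 1 \/ s = -1 ->
  J x = s *: x -> J y = s *: y -> B x y z = B y x z.

Let BD3 x y z z' : B x y (z + z') = B x y z + B x y z'.
Proof. by rewrite !(Bskew x y) BD2 opprD. Qed.

Let BZ3 k x y z : B x y (k *: z) = k * B x y z.
Proof. by rewrite !(Bskew x y) BZ2 mulrN. Qed.

Let sign_nz (s : R) : s = 1 \/ s = -1 -> s != 0.
Proof. by move=> [] ->; rewrite ?oppr_eq0 oner_eq0. Qed.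

Let eigen_orthogonal s y : s = 1 \/ s = -1 -> J y = s *: y -> h y t = 0.
Proof.
move=> hs Jy; have := hJt y; rewrite Jy hZ => /eqP.
by rewrite mulf_eq0 (negbTE (sign_nz hs)) => /eqP.
Qed.

(** [BJ] moves [J] from one slot to the next, where the eigenvalue has the opposite sign. *)
Let mixed s x y z : s = 1 \/ s = -1 -> J y = s *: y -> J z = - s *: z ->
  B x y z = 0.
Proof.
move=> hs Jy Jz.
have hs' : - s = 1 \/ - s = -1 by case: hs => ->; [right|left; rewrite opprK].
have := BJ x (eigen_orthogonal hs Jy) (eigen_orthogonal hs' Jz).
rewrite Jy Jz BZ2 BZ3 => H.
have : s * B x y z = 0 by lra.
by move/eqP; rewrite mulf_eq0 (negbTE (sign_nz hs)) => /eqP.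
Qed.

(** Symmetry in the first two slots and skewness in the last two are incompatible: applying them
    alternately returns to [B x y z] with the opposite sign. *)
Let pure s x y z : s = 1 \/ s = -1 -> J x = s *: x -> J y = s *: y ->
  J z = s *: z -> B x y z = 0.
Proof.
move=> hs Jx Jy Jz.
have := Bsym z hs Jx Jy; have := Bsym x hs Jy Jz; have := Bsym y hs Jz Jx.
have := Bskew x y z; have := Bskew y z x; have := Bskew z x y; lra.
Qed.

(** The other two terms of the cyclic identity have eigenvectors of opposite sign in their last two
    slots. *)
Let opposite s x y z : s = 1 \/ s = -1 -> J x = - s *: x -> J y = s *: y ->
  J z = s *: z -> B x y z = 0.
Proof.
move=> hs Jx Jy Jz; have := Bcyclic x y z.
by rewrite (mixed y hs Jz Jx) (Bskew z) (mixed z hs Jy Jx) oppr0 !addr0.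
Qed.

Let proj (s : R) y := 2^-1 *: (y + s *: J y).

Let proj_eigen s y : s = 1 \/ s = -1 -> h y t = 0 -> J (proj s y) = s *: proj s y.
Proof.
move=> hs yt; rewrite /proj JZ JD JZ JJ // scalerA mulrC -scalerA; congr (_ *: _).
rewrite scalerDr scalerA addrC; congr (_ + _).
by case: hs => ->; rewrite ?mulrNN mulr1 scale1r.
Qed.

Let proj_sum y : y = proj 1 y + proj (-1) y.
Proof.
rewrite /proj -scalerDr scale1r scaleN1r addrACA subrr addr0.
have -> : y + y = (2 : R) *: y by rewrite scaler_nat mulr2n.
by rewrite scalerA mulVf ?pnatr_eq0 // scale1r.
Qed.

Let orthogonal_case x y z : h x t = 0 -> h y t = 0 -> h z t = 0 -> B x y z = 0.
Proof.
move=> xt yt zt.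
have h1 : (1 : R) = 1 \/ (1 : R) = -1 by left.
have hN : (-1 : R) = 1 \/ (-1 : R) = -1 by right.
have P w : h w t = 0 -> J (proj 1 w) = 1 *: proj 1 w by exact: proj_eigen.
have N w : h w t = 0 -> J (proj (-1) w) = -1 *: proj (-1) w by exact: proj_eigen.
have N1 w : h w t = 0 -> J (proj 1 w) = - (-1) *: proj 1 w by rewrite opprK; exact: P.
rewrite (proj_sum x) (proj_sum y) (proj_sum z) !BD1 !BD2 !BD3.
rewrite (pure h1 (P x xt) (P y yt) (P z zt)) (pure hN (N x xt) (N y yt) (N z zt)).
rewrite (opposite h1 (N x xt) (P y yt) (P z zt)).
rewrite (opposite hN (N1 x xt) (N y yt) (N z zt)).
rewrite !(mixed _ h1 (P y yt) (N z zt)) !(mixed _ hN (N y yt) (N1 z zt)).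
by rewrite !addr0.
Qed.

Lemma sasakian_algebra x y z : B x y z = h y t * h x z - h x y * h t z.
Proof.
pose C x y z := B x y z - (h y t * h x z - h x y * h t z).
suff : C x y z = 0 by rewrite /C; lra.
have hD' u v w : h u (v + w) = h u v + h u w by rewrite !(hC u) hD.
have hZ' k v w : h v (k *: w) = k * h v w by rewrite !(hC v) hZ.
have CD1 x1 x2 y1 z1 : C (x1 + x2) y1 z1 = C x1 y1 z1 + C x2 y1 z1.
  by rewrite /C BD1 !hD; ring.
have CZ1 k x1 y1 z1 : C (k *: x1) y1 z1 = k * C x1 y1 z1.
  by rewrite /C BZ1 !hZ; ring.
have Cskew x1 y1 z1 : C x1 y1 z1 = - C x1 z1 y1.
  by rewrite /C Bskew (hC t z1) (hC t y1); ring.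
have Ccyc x1 y1 z1 : C x1 y1 z1 + C y1 z1 x1 + C z1 x1 y1 = 0.
  have := Bcyclic x1 y1 z1; rewrite /C (hC t z1) (hC t x1) (hC t y1).
  by rewrite (hC z1 x1) (hC y1 x1) (hC z1 y1); lra.
have CD2 x1 y1 y2 z1 : C x1 (y1 + y2) z1 = C x1 y1 z1 + C x1 y2 z1.
  by rewrite /C BD2 !hD !hD'; ring.
have CZ2 k x1 y1 z1 : C x1 (k *: y1) z1 = k * C x1 y1 z1.
  by rewrite /C BZ2 !hZ !hZ'; ring.
have CD3 x1 y1 z1 z2 : C x1 y1 (z1 + z2) = C x1 y1 z1 + C x1 y1 z2.
  by rewrite !(Cskew x1 y1) CD2 opprD.
have CZ3 k x1 y1 z1 : C x1 y1 (k *: z1) = k * C x1 y1 z1.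
  by rewrite !(Cskew x1 y1) CZ2 mulrN.
(* The second slot is settled by [Bt] and [htt], the third by skewness, the first by the cyclic
   identity. *)
have Ct2 x1 z1 : C x1 t z1 = 0 by rewrite /C Bt htt; ring.
have Ct3 x1 y1 : C x1 y1 t = 0 by rewrite Cskew Ct2 oppr0.
have Ct1 y1 z1 : C t y1 z1 = 0.
  by have := Ccyc t y1 z1; rewrite Ct2 Ct3 !addr0.
(* Orthogonal projection along [t]; the plus sign in the witness comes from [h t t = -1]. *)
have [pr [prt prE]] : exists pr : V -> V,
    (forall w, h (pr w) t = 0) /\ (forall w, w = pr w + (- h w t) *: t).
  exists (fun w => w + h w t *: t); split => w; last by rewrite scaleNr addrK.
  by rewrite hD hZ htt; ring.
rewrite (prE x) (prE y) (prE z) !(CD1, CD2, CD3, CZ1, CZ2, CZ3, Ct1, Ct2, Ct3).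
rewrite !mulr0 !addr0 /C orthogonal_case // prt (hC t) prt; ring.
Qed.

End SasakianAlgebra.

Section Distributions.
Context {R : realType} {m : nat} {M : topologicalType}.
Implicit Types (g J : M -> 'M[R]_m) (T : M -> 'rV[R]_m).

Lemma orthogonal_distributionP g T p (v : 'rV[R]_m) :
  reflect (ip g p v (T p) = 0) (v <= orthogonal_distribution g T p)%MS.
Proof.
rewrite /orthogonal_distribution; apply: (iffP sub_kermxP); rewrite mulmxA; first by rewrite /ip => ->; rewrite mxE.
by rewrite /ip => H; apply/matrixP => i j; rewrite !ord1 H mxE.
Qed.

Lemma eigen_orthogonalP g T J (s : R) p (v : 'rV[R]_m) :
  reflect (ip g p v (T p) = 0 /\ v *m J p = s *: v)
    (v <= eigen_distribution (orthogonal_distribution g T) J s p)%MS.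
Proof.
rewrite /eigen_distribution sub_capmx.
apply: (iffP andP) => -[H1 H2].
  by split; [exact/orthogonal_distributionP|exact/eigenspaceP].
by split; [exact/orthogonal_distributionP|exact/eigenspaceP].
Qed.

End Distributions.

(** * The Sasakian equation and involutivity of the eigen-distributions *)

Section Sasakian.
#[local] Opaque smooth_on derive smooth_vf_at smooth_fun_at smooth_vf smooth_fun.
Context {R : realType} {m : nat} {M : topologicalType} {A : charts R m M}.
Hypothesis hA : smooth_atlas A.
Context {g : M -> 'M[R]_m} {D : M -> 'rV[R]_m -> (M -> 'rV[R]_m) -> 'rV[R]_m}.
Hypothesis hg : pseudo_riemannian A g.
Hypothesis hD : levi_civita A g D.
Variable T : M -> 'rV[R]_m.
Hypothesis hT : forall p, smooth_vf_at A p T.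
Implicit Types (p q : M) (v w x y z : 'rV[R]_m) (X Y Z : M -> 'rV[R]_m).

Let hc := lc_connection hD.
Let J := nabla D T.
Let JE p v : v *m J p = D p v T. Proof. exact: (nablaE hc v (hT p)). Qed.
Let hJ p : smooth_endo_at A J p. Proof. exact: (smooth_endo_nabla hA hc). Qed.
Let gC p v w : ip g p v w = ip g p w v. Proof. by apply: ip_sym; exact: (Defs.metric_sym hg). Qed.

Hypothesis unit_T : forall p, ip g p (T p) (T p) = -1.
Hypothesis geodesic_T : forall p, D p (T p) T = 0.
Hypothesis skew : forall p v w, ip g p (D p v T) w + ip g p v (D p w T) = 0.

Let Jskew p v w : ip g p (v *m J p) w = - ip g p v (w *m J p).
Proof. exact: (ip_nabla_skew hD hT skew). Qed.

Let TJ p : T p *m J p = 0. Proof. by rewrite JE geodesic_T. Qed.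

Lemma nabla_orthogonal p v : ip g p (v *m J p) (T p) = 0.
Proof. by rewrite Jskew TJ ip0r oppr0. Qed.

Definition sasaki_equation := forall p x y,
  cov_endo D J p x (frame A p y) = ip g p y (T p) *: x - ip g p x y *: T p.

(** J^2 = 1 on the orthogonal complement of T and J T = 0, in one formula without restriction to E;
    the plus sign reflects g(T, T) = -1. *)
Definition square_identity := forall p v,
  v *m J p *m J p = v + ip g p v (T p) *: T p.

Lemma square_identity_orthogonal :
  (forall p v, ip g p v (T p) = 0 -> v *m J p *m J p = v) -> square_identity.
Proof.
move=> H p v.
have := H p (v + ip g p v (T p) *: T p).
rewrite ipDl ipZl unit_T mulrN1 subrr => /(_ erefl).
by rewrite !mulmxDl -!scalemxAl TJ mul0mx scaler0 addr0.
Qed.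

(** Eigenfields are orthogonal to [T] and to each other, so the Sasakian equation makes
    [(nabla_X J) Y] vanish and [eigen_bracket] applies. The bracket is then in the image of [J],
    hence orthogonal to [T]. *)
Lemma eigen_involutive s : s = 1 \/ s = -1 -> square_identity -> sasaki_equation ->
  involutive_distribution A (eigen_distribution (orthogonal_distribution g T) J s).
Proof.
move=> hs sq S U X Y oU UX UY secX secY p Up.
have nU : \forall q \near p, U q by exact: open_nbhs_nbhs.
have hX := smooth_vf_atI oU Up UX; have hY := smooth_vf_atI oU Up UY.
have eX q : U q -> X q *m J q = s *: X q by move=> /secX/eigen_orthogonalP[].
have eY q : U q -> Y q *m J q = s *: Y q by move=> /secY/eigen_orthogonalP[].
have [tX _] := elimT (eigen_orthogonalP _ _ _ _ _ _) (secX p Up).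
have [tY _] := elimT (eigen_orthogonalP _ _ _ _ _ _) (secY p Up).
have nX : {near p, (fun q => X q *m J q) =1 fun q => s *: X q}.
  exact: filterS eX nU.
have nY : {near p, (fun q => Y q *m J q) =1 fun q => s *: Y q}.
  exact: filterS eY nU.
have E := eigen_bracket hA hD (hJ (p := p)) hX hY nX nY.
have s2 : s * s = 1 by case: hs => ->; rewrite ?mulrNN mulr1.
(* The eigenspaces of a skew endomorphism for nonzero eigenvalues are isotropic. *)
have XY0 : ip g p (X p) (Y p) = 0.
  have := Jskew p (X p) (Y p); rewrite eX // eY // ipZl ipZr => H.
  have : s * ip g p (X p) (Y p) = 0 by lra.
  by move=> /(congr1 ( *%R s)); rewrite mulrA s2 mul1r mulr0.
have C Z W : smooth_vf_at A p Z -> smooth_vf_at A p W ->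
    ip g p (Z p) (T p) = 0 -> ip g p (W p) (Z p) = 0 -> cov_endo D J p (W p) Z = 0.
  move=> hZ hW Zt WZ.
  rewrite (cov_endo_tensorial hA hc (W p) (hJ (p := p)) hZ
    (smooth_frame_at hA (Z p) (sa_center hA p))); last by rewrite frame_center.
  by rewrite S Zt WZ !scale0r subrr.
have XY0' : ip g p (Y p) (X p) = 0 by rewrite gC.
rewrite (C Y X hY hX tY XY0) (C X Y hX hY tX XY0') subrr in E.
have {}E := subr0_eq (esym E).
apply/eigen_orthogonalP; split; last by rewrite E.
have := nabla_orthogonal p (lie_bracket A X Y p); rewrite -E ipZl.
by move=> /(congr1 ( *%R s)); rewrite mulrA s2 mul1r mulr0.
Qed.

Lemma sasaki_equation_of_involutive : square_identity ->
  involutive_distribution A (eigen_distribution (orthogonal_distribution g T) J 1) ->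
  involutive_distribution A (eigen_distribution (orthogonal_distribution g T) J (-1)) ->
  sasaki_equation.
Proof.
move=> sq invP invN p.
have pp := sa_center hA p.
have inv s : s = 1 \/ s = -1 ->
    involutive_distribution A (eigen_distribution (orthogonal_distribution g T) J s).
  by case=> ->.
have [F FE] : exists F, forall w, F w = frame A p w by exists (frame A p).
have hF w : smooth_vf_at A p (F w) by rewrite FE; exact: smooth_frame_at.
have Fp w : F w p = w by rewrite FE; exact: frame_center.
have hJp : smooth_endo_at A J p by exact: hJ.
(* [N x y] is the tensor [(nabla_x J) y]; [NE] frees it from the choice of an extension of [y]. *)
have [N NF] : exists N, forall x y, N x y = cov_endo D J p x (F y).
  by exists (fun x y => cov_endo D J p x (F y)).
have NE x Y : smooth_vf_at A p Y -> cov_endo D J p x Y = N x (Y p).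
  by move=> hY; rewrite NF; apply: (cov_endo_tensorial hA hc x hJp hY (hF _)); rewrite Fp.
have NDr x y y' : N x (y + y') = N x y + N x y'.
  have := NE x _ (smooth_vf_atD hA (hF y) (hF y')).
  by rewrite (cov_endoDf hc _ hJp (hF y) (hF y')) !Fp !NF => <-.
have NZr k x y : N x (k *: y) = k *: N x y.
  have := NE x _ (smooth_vf_atZ hA (smooth_fun_at_cst A p k) (hF y)).
  by rewrite (cov_endoZf hc _ _ hJp (hF y)) Fp !NF => <-.
have NDl x x' y : N (x + x') y = N x y + N x' y.
  by rewrite !NF (cov_endoDv hc _ _ hJp (hF y)).
have NZl k x y : N (k *: x) y = k *: N x y.
  by rewrite !NF (cov_endoZv hc _ _ hJp (hF y)).
have Nskew x y z : ip g p (N x y) z = - ip g p (N x z) y.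
  have := cov_endo_nabla_skew hA (metric_smooth hg) (Defs.metric_sym hg) hD hT skew
    x (hF y) (hF z).
  by rewrite !Fp -!NF.
(* Differentiating J T = 0 gives (nabla_x J) T = - J (nabla_x T) = - J^2 x. *)
have NT x : N x (T p) = - (x + ip g p x (T p) *: T p).
  rewrite -(NE x T (hT p)) /cov_endo.
  have TJ0 : {near p, (fun q => T q *m J q) =1 fun q => 0 *: T q}.
    by apply: nearW => q; rewrite TJ scale0r.
  rewrite (conn_eq hA hc _ TJ0 (hJp _ (hT p))) (conn_cscalef hc _ _ (hT p)) scale0r.
  by rewrite sub0r -JE sq.
(* [square_identity] is differentiated along a frame field and paired with [z]. Derivatives of the
   coefficient g(F y, T) multiply [T] and disappear since [z] is orthogonal to it. *)
have NJ x y z : ip g p y (T p) = 0 -> ip g p z (T p) = 0 ->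
    ip g p (N x (y *m J p)) z = ip g p (N x y) (z *m J p).
  move=> yt zt.
  have hYJ := hJp _ (hF y).
  have hf := smooth_ip (metric_smooth hg) (hF y) (hT p).
  have sqF : {near p, (fun q => F y q + ip g q (F y q) (T q) *: T q) =1
      fun q => F y q *m J q *m J q} by apply: nearW => q; rewrite sq.
  have hS := smooth_vf_atD hA (hF y) (smooth_vf_atZ hA hf (hT p)).
  have E1 := conn_eq hA hc x sqF hS.
  rewrite (conn_addf hc _ (hF y) (smooth_vf_atZ hA hf (hT p))) in E1.
  rewrite (conn_scalef hc _ hf (hT p)) Fp yt scale0r addr0 in E1.
  have E2 : D p x (fun q => F y q *m J q *m J q) =
      N x (y *m J p) + (N x y + D p x (F y) *m J p) *m J p.
    have -> : N x (y *m J p) = cov_endo D J p x (fun q => F y q *m J q).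
      by rewrite (NE x _ hYJ) Fp.
    by rewrite NF /cov_endo !subrK.
  have := etrans (esym E2) (esym E1).
  move: (N x y) (N x (y *m J p)) (D p x (F y)) (dfun _ _ _ _) => n nJ d c.
  rewrite mulmxDl sq => /(congr1 (fun v => ip g p v z)).
  rewrite !ipDl !ipZl (gC p (T p)) zt Jskew; lra.
have Nsym s x y z : s = 1 \/ s = -1 -> x *m J p = s *: x -> y *m J p = s *: y ->
    ip g p (N x y) z = ip g p (N y x) z.
  move=> hs xJ yJ; suff -> : N x y = N y x by [].
  have s2 : s * s = 1 by case: hs => ->; rewrite ?mulrNN mulr1.
  (* smooth eigenfields through prescribed eigenvectors *)
  pose E w q := 2^-1 *: (s *: (F w q *m J q) + F w q *m J q *m J q).
  have Ep w : w *m J p = s *: w -> E w p = w.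
    move=> wJ; rewrite /E Fp wJ -scalemxAl wJ !scalerA s2 scale1r.
    have -> : w + w = (2 : R) *: w by rewrite scaler_nat mulr2n.
    by rewrite scalerA mulVf ?pnatr_eq0 // scale1r.
  (* J^3 = J, because the image of [J] is orthogonal to [T]; so (s J + J^2) / 2 takes values in the
     s-eigenspace at every point. *)
  have EJ w q : E w q *m J q = s *: E w q.
    rewrite /E -scalemxAl mulmxDl -scalemxAl [F w q *m J q *m J q *m J q]sq.
    rewrite nabla_orthogonal scale0r addr0 scalerA mulrC -scalerA; congr (_ *: _).
    by rewrite scalerDr scalerA s2 scale1r addrC.
  have hE w q : cdom A p q -> smooth_vf_at A q (E w).
    move=> pq; have hFq : smooth_vf_at A q (F w).
      by rewrite FE; exact: smooth_frame_at.
    have h1 := hJ hFq.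
    have h2 := hJ h1; have c k := smooth_fun_at_cst A q k.
    exact: (smooth_vf_atZ hA (c _) (smooth_vf_atD hA (smooth_vf_atZ hA (c s) h1) h2)).
  have sE w : smooth_vf A (cdom A p) (E w).
    by apply: smooth_vf_atP => q; exact: hE.
  have secE w : section_on (cdom A p)
      (eigen_distribution (orthogonal_distribution g T) J s) (E w).
    move=> q _; apply/eigen_orthogonalP; split; last exact: EJ.
    have := nabla_orthogonal q (E w q); rewrite EJ ipZl.
    by move=> /(congr1 ( *%R s)); rewrite mulrA s2 mul1r mulr0.
  have /eigen_orthogonalP[_ bJ] := inv s hs _ _ _ (sa_dom_open hA p) (sE x) (sE y)
    (secE x) (secE y) p pp.
  have EJn w : {near p, (fun q => E w q *m J q) =1 fun q => s *: E w q}.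
    by apply: nearW => q; exact: EJ.
  have := eigen_bracket hA hD hJp (hE x p pp) (hE y p pp) (EJn x) (EJn y).
  by rewrite bJ subrr (NE _ _ (hE x p pp)) (NE _ _ (hE y p pp)) !Ep // => /subr0_eq.
move=> x y; rewrite -FE -NF.
apply/eqP; rewrite -subr_eq0; apply/eqP; apply: (ip_nondegenerate (metric_nondegenerate hg p)) => z.
rewrite ipBl.
rewrite (@sasakian_algebra R _ (ip g p) (mulmx^~ (J p)) (T p) (fun x y z => ip g p (N x y) z)).
- by rewrite ipBl !ipZl subrr.
- exact: ipDl.
- exact: ipZl.
- exact: gC.
- exact: unit_T.
- by move=> v w; rewrite mulmxDl.
- by move=> k v; rewrite scalemxAl.
- by move=> v vt; rewrite sq vt scale0r addr0.
- exact: nabla_orthogonal.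
- by move=> x1 x2 y1 z1; rewrite NDl ipDl.
- by move=> k x1 y1 z1; rewrite NZl ipZl.
- by move=> x1 y1 y2 z1; rewrite NDr ipDl.
- by move=> k x1 y1 z1; rewrite NZr ipZl.
- exact: Nskew.
- move=> x1 y1 z1; rewrite !NF !FE.
  exact: (cov_endo_nabla_cyclic hA (metric_smooth hg) (Defs.metric_sym hg) hD hT skew).
- by move=> x1 z1; rewrite NT ipNl ipDl ipZl.
- exact: NJ.
- exact: Nsym.
Qed.

End Sasakian.

(** * The cone *)

Section LinearDerivatives.
Context {R : realType}.

Lemma derive_linear m n (L : {linear 'rV[R]_m -> 'rV[R]_n}) u v : 'D_v L u = L v.
Proof.
have cL := @linear_continuous R m _ L.
by rewrite (deriveE v (linear_differentiable u cL)) (diff_lin u cL).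
Qed.

Lemma derive_linear_comp m n k (L : {linear 'rV[R]_n -> 'rV[R]_k})
    (f : 'rV[R]_m -> 'rV[R]_n) u v : differentiable f u ->
  'D_v (fun x => L (f x)) u = L ('D_v f u).
Proof.
move=> df; have cL := @linear_continuous R n _ L.
by rewrite (derive_comp v df (linear_differentiable (f u) cL)) derive_linear.
Qed.

End LinearDerivatives.

(** * Tangent vectors of the cone: radial and horizontal components *)

Section ConeVectors.
Context {R : realType} {m : nat}.
Implicit Types (a b : R) (v w : 'rV[R]_m) (u : 'rV[R]_(1 + m)).

Fact cvec_sig : {f : R -> 'rV[R]_m -> 'rV[R]_(1 + m) | f = fun a v => row_mx a%:M v}.
Proof. by eexists. Qed.

Fact hd_sig : {f : 'rV[R]_(1 + m) -> R | f = fun u => lsubmx u 0 0}.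
Proof. by eexists. Qed.

Fact tl_sig : {f : 'rV[R]_(1 + m) -> 'rV[R]_m | f = fun u => rsubmx u}.
Proof. by eexists. Qed.

(* The tangent vector [a d/dr + v] of the cone and its components, sealed to
   keep conversion from unfolding matrices. *)
Definition cvec := sval cvec_sig.
Definition hd := sval hd_sig.
Definition tl := sval tl_sig.

Lemma cvec_rowE a v : cvec a v = row_mx a%:M v.
Proof. by rewrite /cvec (svalP cvec_sig). Qed.

Lemma hd_lsubmxE u : hd u = lsubmx u 0 0.
Proof. by rewrite /hd (svalP hd_sig). Qed.

Lemma tl_rsubmxE u : tl u = rsubmx u.
Proof. by rewrite /tl (svalP tl_sig). Qed.

Lemma hd_cvec a v : hd (cvec a v) = a.
Proof. by rewrite hd_lsubmxE cvec_rowE row_mxKl mxE eqxx. Qed.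

Lemma tl_cvec a v : tl (cvec a v) = v.
Proof. by rewrite tl_rsubmxE cvec_rowE row_mxKr. Qed.

Lemma cvecE u : cvec (hd u) (tl u) = u.
Proof. by rewrite cvec_rowE hd_lsubmxE tl_rsubmxE -mx11_scalar hsubmxK. Qed.

Lemma cvecD a b v w : cvec a v + cvec b w = cvec (a + b) (v + w).
Proof. by rewrite !cvec_rowE add_row_mx raddfD. Qed.

Lemma cvecZ k a v : k *: cvec a v = cvec (k * a) (k *: v).
Proof. by rewrite !cvec_rowE scale_row_mx scale_scalar_mx. Qed.

Lemma cvecN a v : - cvec a v = cvec (- a) (- v).
Proof. by rewrite -scaleN1r cvecZ mulN1r scaleN1r. Qed.

Lemma cvec0 : cvec 0 0 = 0.
Proof. by rewrite cvec_rowE raddf0 row_mx0. Qed.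

Lemma cvec_inj a b v w : cvec a v = cvec b w -> a = b /\ v = w.
Proof.
move=> E; split; first by rewrite -(hd_cvec a v) E hd_cvec.
by rewrite -(tl_cvec a v) E tl_cvec.
Qed.

Lemma hdE u : hd u = u 0 (lshift m 0).
Proof. by rewrite hd_lsubmxE mxE. Qed.

Lemma cvec_is_linear : linear (cvec 0).
Proof. by move=> k v w; rewrite cvecZ cvecD mulr0 addr0. Qed.
HB.instance Definition _ := GRing.isLinear.Build R 'rV[R]_m 'rV[R]_(1 + m) _
  (cvec 0) cvec_is_linear.

Lemma tl_is_linear : linear tl.
Proof. by move=> k u w; rewrite !tl_rsubmxE linearP. Qed.
HB.instance Definition _ := GRing.isLinear.Build R 'rV[R]_(1 + m) 'rV[R]_m _
  tl tl_is_linear.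

Lemma hd_part_is_linear : linear (fun u => cvec (hd u) 0).
Proof.
by move=> k u w; rewrite cvecZ cvecD scaler0 addr0 !hdE !mxE.
Qed.
Definition hd_part u := cvec (hd u) 0.
HB.instance Definition _ := GRing.isLinear.Build R 'rV[R]_(1 + m) 'rV[R]_(1 + m) _
  hd_part hd_part_is_linear.

Lemma tl_differentiable u : differentiable tl u.
Proof. exact/linear_differentiable/linear_continuous. Qed.

Lemma cvec_split a v : cvec a v = cvec a 0 + cvec 0 v.
Proof. by rewrite cvecD addr0 add0r. Qed.

Lemma hd_differentiable u : differentiable (hd : _ -> R^o) u.
Proof.
have -> : hd = (fun u => u 0 (lshift m 0)) by apply/funext => x; rewrite hdE.
exact: differentiable_coord.
Qed.

Lemma derive_hd u u' : 'D_u' (hd : _ -> R^o) u = hd u'.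
Proof.
have -> : hd = (fun u => u 0 (lshift m 0)) by apply/funext => x; rewrite hdE.
by rewrite (derive_coord u' (lshift m 0) (ex_diff (is_diff_def := is_diff_id u))) derive_id.
Qed.

Lemma derive_comp_tl (W : normedModType R) (f : 'rV[R]_m -> W) u u' :
  differentiable f (tl u) -> 'D_u' (fun x => f (tl x)) u = 'D_(tl u') f (tl u).
Proof.
move=> df; rewrite (derive_comp u' (tl_differentiable u) df).
by rewrite derive_linear.
Qed.

End ConeVectors.

Section ConeVectorDerivatives.
Context {R : realType} {m : nat}.

Lemma derive_block (f : 'rV[R]_m -> 'rV[R]_m) (u w : 'rV[R]_(1 + m)) :
  differentiable f (tl u) ->
  'D_w (fun x => cvec (hd x) (f (tl x))) u = cvec (hd w) ('D_(tl w) f (tl u)).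
Proof.
move=> df.
have dft : differentiable (fun x => f (tl x)) u.
  by apply: (differentiable_comp (tl_differentiable u)).
have dL : differentiable (fun x : 'rV[R]_(1 + m) => cvec 0 (f (tl x))) u.
  exact: (differentiable_comp dft (linear_differentiable _ (@linear_continuous R m _ (cvec 0)))).
have dh : differentiable (@hd_part R m) u.
  exact/linear_differentiable/linear_continuous.
have -> : (fun x => cvec (hd x) (f (tl x))) =
    (@hd_part R m) + (fun x : 'rV[R]_(1 + m) => cvec 0 (f (tl x))).
  by apply/funext => x; rewrite fctE /hd_part -cvec_split.
rewrite deriveD; [|exact: diff_derivable|exact: diff_derivable].
rewrite derive_linear (derive_linear_comp (cvec 0) w dft) (derive_comp_tl w df).
by rewrite /hd_part -cvec_split.
Qed.

Lemma smooth_on_cvec (U : set 'rV[R]_(1 + m)) (a : 'rV[R]_(1 + m) -> R^o)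
    (f : 'rV[R]_(1 + m) -> 'rV[R]_m) :
  open U -> smooth_on U a -> smooth_on U f -> smooth_on U (fun u => cvec (a u) (f u)).
Proof.
move=> oU Ua Uf.
have S1 := smooth_onZ oU Ua (smooth_on_cst U (cvec 1 0 : 'rV[R]_(1 + m))).
have S2 := smooth_on_linear (cvec 0) oU Uf.
apply: (smooth_on_eq oU _ (smooth_onD oU S1 S2)) => u _.
by rewrite cvecZ cvecD scaler0 mulr1 addr0 add0r.
Qed.

Lemma smooth_on_hd (U : set 'rV[R]_(1 + m)) : open U -> smooth_on U (hd : _ -> R^o).
Proof.
move=> oU; apply: (smooth_on_eq oU _ (smooth_on_coord (lshift m 0) oU (smooth_on_id oU))).
by move=> u _; rewrite hdE.
Qed.

Lemma smooth_on_comp_tl (W : normedModType R) (U : set 'rV[R]_(1 + m))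
    (V : set 'rV[R]_m) (f : 'rV[R]_m -> W) :
  open U -> (forall u, U u -> V (tl u)) -> smooth_on V f ->
  smooth_on U (fun u => f (tl u)).
Proof.
move=> oU UV Vf.
exact: (smooth_on_comp oU UV (smooth_on_linear tl oU (smooth_on_id oU)) Vf).
Qed.

End ConeVectorDerivatives.

(** * The atlas of the cone, lifted fields and the radial field *)

Section ConeAtlas.
Context {R : realType} {m : nat} {M : topologicalType} (A : charts R m M).
Hypothesis hA : smooth_atlas A.
Implicit Types (p q : M) (z y : cone R M) (X : M -> 'rV[R]_m) (f : M -> R).

Notation cA := (cone_charts A).

Definition radius z : R := set_val z.1.

Lemma radius_gt0 z : 0 < radius z.
Proof. by rewrite /radius set_valE; have := valP z.1; rewrite inE. Qed.

Lemma radius_neq0 z : radius z != 0.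
Proof. exact/lt0r_neq0/radius_gt0. Qed.

Lemma cone_cmapE z y : cmap cA z y = cvec (radius y) (cmap A z.2 y.2).
Proof. by rewrite cvec_rowE. Qed.

Lemma cone_cinvE z u : cinv cA z u = (insubd z.1 (hd u), cinv A z.2 (tl u)).
Proof. by rewrite hd_lsubmxE tl_rsubmxE. Qed.

Lemma radius_insubd (s : @pos_reals R) q (r : R) : 0 < r ->
  radius (insubd s r, q) = r.
Proof. by move=> r0; rewrite /radius set_valE /= insubdK // inE. Qed.

Lemma radius_cinv z u : 0 < hd u -> radius (cinv cA z u) = hd u.
Proof. by move=> u0; rewrite cone_cinvE radius_insubd. Qed.

Lemma radius_inj z y : radius z = radius y -> z.2 = y.2 -> z = y.
Proof.
case: z y => [r p] [s q] /=; rewrite /radius /= !set_valE => /val_inj -> /= ->.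
by [].
Qed.

Lemma hd_continuous : continuous (@hd R m : _ -> R^o).
Proof. by move=> u; exact/differentiable_continuous/hd_differentiable. Qed.

Lemma tl_continuous : continuous (@tl R m).
Proof. by move=> u; exact/differentiable_continuous/tl_differentiable. Qed.

Lemma radius_continuous : continuous (radius : cone R M -> R^o).
Proof.
move=> z; rewrite /radius.
apply: (@continuous_comp _ _ _ fst (@set_val R (@pos_reals R)) z).
  exact: cvg_fst.
exact: initial_continuous.
Qed.

Lemma cone_cimgE z : cmap cA z @` cdom cA z =
  [set u | 0 < hd u /\ (cmap A z.2 @` cdom A z.2) (tl u)].
Proof.
rewrite eqEsubset; split => [_ [y yz <-]|u [u0 [q zq uq]]].
  rewrite cone_cmapE /= hd_cvec tl_cvec; split; first exact: radius_gt0.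
  by exists y.2.
exists (insubd z.1 (hd u), q) => //.
by rewrite cone_cmapE radius_insubd //= uq cvecE.
Qed.

Lemma open_cone_set (V : set 'rV[R]_m) : open V ->
  open [set u : 'rV[R]_(1 + m) | 0 < hd u /\ V (tl u)].
Proof.
move=> oV; apply: openI.
  apply: (@open_comp _ _ (@hd R m) [set r : R | 0 < r]).
    by move=> u _; exact: hd_continuous.
  exact: open_gt.
apply: (@open_comp _ _ (@tl R m) V) => // u _; exact: tl_continuous.
Qed.

Lemma cone_mapK z y : cdom cA z y -> cinv cA z (cmap cA z y) = y.
Proof.
move=> zy; apply: radius_inj.
  by rewrite radius_cinv cone_cmapE hd_cvec //; exact: radius_gt0.
by rewrite cone_cinvE cone_cmapE /= tl_cvec (sa_mapK hA).
Qed.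

Lemma cone_transition z y u : 0 < hd u ->
  (cmap cA y \o cinv cA z) u = cvec (hd u) ((cmap A y.2 \o cinv A z.2) (tl u)).
Proof. by move=> u0; rewrite -[LHS]/(cmap cA y (cinv cA z u)) cone_cmapE radius_cinv // cone_cinvE. Qed.

Lemma smooth_atlas_cone : smooth_atlas cA.
Proof.
split.
- by move=> z; exact: (sa_center hA).
- move=> z; apply: (@open_comp _ _ snd (cdom A z.2)); last exact: sa_dom_open.
  by move=> y _; exact: cvg_snd.
- move=> z; rewrite cone_cimgE; apply: open_cone_set; exact: sa_img_open.
- exact: cone_mapK.
- move=> z y zy.
  have -> : cmap cA z = fun y : cone R M =>
      radius y *: cvec 1 0 + cvec 0 (cmap A z.2 y.2).
    apply/funext => x; rewrite cone_cmapE cvecZ cvecD.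
    by rewrite scaler0 mulr1 addr0 add0r.
  apply: cvgD.
    by apply: cvgZr_tmp; exact: radius_continuous.
  apply: (@continuous_comp _ _ _ (fun y : cone R M => cmap A z.2 y.2) (cvec 0) y).
    apply: (@continuous_comp _ _ _ snd (cmap A z.2) y); first exact: cvg_snd.
    exact: (sa_map_cont hA zy).
  exact: linear_continuous.
- move=> z u; rewrite cone_cimgE => -[u0 uV].
  have c2 : (cinv A z.2 \o tl) x @[x --> u] --> cinv A z.2 (tl u).
    apply: (@continuous_comp _ _ _ (@tl R m) (cinv A z.2) u); first exact: tl_continuous.
    exact: (sa_inv_cont hA uV).
  (* Neighbourhoods in the positive reals are traces of open sets [W] of the line. Near [u] the
     first coordinate stays positive, so [insubd] takes its true value and not the default. *)
  have c1 : insubd z.1 (hd x) @[x --> u] --> (insubd z.1 (hd u) : @pos_reals R).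
    move=> U [/= B [[W oW <-] Wu BU]].
    have WhU : W (hd u).
      by have : W (radius (insubd z.1 (hd u), z.2)) := Wu; rewrite radius_insubd.
    have nW : nbhs u (hd @^-1` (W `&` [set r | 0 < r])).
      apply: (@hd_continuous u); apply: open_nbhs_nbhs; split => //.
      by apply: openI => //; exact: open_gt.
    apply: filterS nW => x [Wx x0]; apply: BU => /=.
    by have := @radius_insubd z.1 z.2 (hd x) x0; rewrite /radius /= => ->.
  have -> : cinv cA z = fun u => (insubd z.1 (hd u), cinv A z.2 (tl u)).
    by apply/funext => x; exact: cone_cinvE.
  exact: (cvg_pair c1 c2).
- move=> z y.
  pose V := cmap A z.2 @` (cdom A z.2 `&` cdom A y.2).
  have oV : open V by apply: (open_cimg hA); exact: sa_dom_open.
  have oU := open_cone_set oV.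
  have S : smooth_on [set u : 'rV[R]_(1 + m) | 0 < hd u /\ V (tl u)]
      (cmap cA y \o cinv cA z).
    have S1 := smooth_on_comp_tl oU (fun u (h : _ /\ _) => h.2) (sa_transition hA z.2 y.2).
    apply: (smooth_on_eq oU _ (smooth_on_cvec oU (smooth_on_hd oU) S1)) => u [u0 _].
    by rewrite cone_transition.
  apply: smooth_on_sub S => _ [x [zx yx] <-].
  rewrite cone_cmapE /= hd_cvec tl_cvec; split; first exact: radius_gt0.
  by exists x.2.
Qed.

(** Near a chart image the first coordinate is positive, so the transition map there is the identity
    times the transition map of [M] and its derivative is block diagonal. *)
Lemma push_cone z z' y (u : 'rV[R]_(1 + m)) : cdom cA z y -> cdom cA z' y ->
  push cA z z' y u = cvec (hd u) (push A z.2 z'.2 y.2 (tl u)).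
Proof.
move=> zy z'y; rewrite !pushE cone_cmapE.
have d := transition_differentiable hA zy z'y.
have E := @derive_block R m (cmap A z'.2 \o cinv A z.2)
  (cvec (radius y) (cmap A z.2 y.2)) u.
rewrite tl_cvec in E; rewrite -(E d).
apply: near_eq_derive.
have : nbhs (cvec (radius y) (cmap A z.2 y.2)) (hd @^-1` [set r : R | 0 < r]).
  apply: (@hd_continuous (cvec (radius y) (cmap A z.2 y.2))).
  apply: open_nbhs_nbhs; split; first exact: open_gt.
  by rewrite /= hd_cvec radius_gt0.
by apply: filterS => x x0; rewrite cone_transition.
Qed.

Lemma frame_cone z y (u : 'rV[R]_(1 + m)) : cdom cA z y ->
  frame cA z u y = cvec (hd u) (frame A z.2 (tl u) y.2).
Proof. by move=> zy; rewrite /frame push_cone //; exact: (sa_center hA). Qed.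

#[local] Opaque smooth_on derive.

Let hcA := smooth_atlas_cone.

Lemma cone_cimg_radius z (U : set (cone R M)) u : cimg cA z U u -> 0 < hd u.
Proof. by move=> [y _ <-]; rewrite cone_cmapE hd_cvec radius_gt0. Qed.

Lemma open_snd (U : set M) : open U -> open [set z : cone R M | U z.2].
Proof.
move=> oU; apply: (@open_comp _ _ snd U) => // z _; exact: cvg_snd.
Qed.

Lemma cone_cimg_snd z (U : set M) u :
  cimg cA z [set y : cone R M | U y.2] u -> cimg A z.2 U (tl u).
Proof. by move=> [y [zy Uy] <-]; rewrite cone_cmapE tl_cvec; exists y.2. Qed.

Lemma smooth_fun_snd z f : smooth_fun_at A z.2 f ->
  smooth_fun_at cA z (fun y => f y.2).
Proof.
move=> [U [oU Uz Uf]]; have oU' := open_snd oU.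
apply: (smooth_fun_atI oU' Uz) => s.
have oI := @open_cimg _ _ _ _ hcA s _ oU'.
apply: (smooth_on_eq oI _ (smooth_on_comp_tl oI (@cone_cimg_snd s U) (Uf s.2))).
by move=> _ [y [sy Uy] <-]; rewrite /comp cone_mapK // cone_cmapE tl_cvec (sa_mapK hA).
Qed.

Lemma smooth_radius z : smooth_fun_at cA z radius.
Proof.
apply: (smooth_fun_atI openT) => // s.
have oI := @open_cimg _ _ _ _ hcA s _ openT.
apply: (smooth_on_eq oI _ (smooth_on_hd oI)) => u /cone_cimg_radius u0.
by rewrite /comp (radius_cinv s u0).
Qed.

Definition radial (z : cone R M) : 'rV[R]_(1 + m) := cvec 1 0.

Lemma local_rep_radial s y : cdom cA s y ->
  local_rep cA s radial (cmap cA s y) = cvec 1 0.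
Proof.
move=> sy; have yy : cdom cA y y := sa_center hA y.2.
rewrite (local_repE hcA _ sy) (push_cone _ yy sy).
by rewrite /radial hd_cvec tl_cvec push0.
Qed.

Lemma smooth_radial z : smooth_vf_at cA z radial.
Proof.
apply: (smooth_vf_atI openT) => // s.
have oI := @open_cimg _ _ _ _ hcA s _ openT.
apply: (smooth_on_eq oI _ (smooth_on_cst _ (cvec 1 0))) => _ [y [sy _] <-].
by rewrite local_rep_radial.
Qed.

Lemma cone_liftE X z : cone_lift X z = cvec 0 (X z.2).
Proof. by rewrite /cone_lift cvec_rowE raddf0. Qed.

Lemma local_rep_lift s y X : cdom cA s y ->
  local_rep cA s (cone_lift X) (cmap cA s y) =
  cvec 0 (local_rep A s.2 X (cmap A s.2 y.2)).
Proof.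
move=> sy; have yy : cdom cA y y := sa_center hA y.2.
rewrite (local_repE hcA _ sy) (push_cone _ yy sy) (local_repE hA _ sy).
by rewrite cone_liftE hd_cvec tl_cvec.
Qed.

Lemma smooth_lift z X : smooth_vf_at A z.2 X -> smooth_vf_at cA z (cone_lift X).
Proof.
move=> [U [oU Uz UX]]; have oU' := open_snd oU.
apply: (smooth_vf_atI oU' Uz) => s.
have oI := @open_cimg _ _ _ _ hcA s _ oU'.
have S := smooth_on_comp_tl oI (@cone_cimg_snd s U) (UX s.2).
apply: (smooth_on_eq oI _ (smooth_on_linear (cvec 0) oI S)) => _ [y [sy Uy] <-].
by rewrite (local_rep_lift X sy) cone_cmapE tl_cvec.
Qed.

Lemma dfun_snd z f (u : 'rV[R]_(1 + m)) : smooth_fun_at A z.2 f ->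
  dfun cA (fun y => f y.2) z u = dfun A f z.2 (tl u).
Proof.
move=> hf; rewrite /dfun cone_cmapE.
have d := smooth_fun_at_differentiable hf (sa_center hA z.2).
have E := @derive_comp_tl R m R^o (f \o cinv A z.2)
  (cvec (radius z) (cmap A z.2 z.2)) u.
rewrite tl_cvec in E; rewrite -(E d).
suff -> : (fun y => f y.2) \o cinv cA z = fun x => (f \o cinv A z.2) (tl x) by [].
by apply/funext => x; rewrite /comp cone_cinvE.
Qed.

Lemma dfun_radius z (u : 'rV[R]_(1 + m)) : dfun cA radius z u = hd u.
Proof.
rewrite /dfun cone_cmapE -[RHS](derive_hd (cvec (radius z) (cmap A z.2 z.2))).
apply: near_eq_derive.
have : nbhs (cvec (radius z) (cmap A z.2 z.2)) (hd @^-1` [set r : R | 0 < r]).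
  apply: (@hd_continuous (cvec (radius z) (cmap A z.2 z.2))).
  apply: open_nbhs_nbhs; split; first exact: open_gt.
  by rewrite /= hd_cvec radius_gt0.
by apply: filterS => x x0; rewrite /comp (radius_cinv z x0).
Qed.

Lemma derive_local_rep_lift z X (u : 'rV[R]_(1 + m)) : smooth_vf_at A z.2 X ->
  'D_u (local_rep cA z (cone_lift X)) (cmap cA z z) =
  cvec 0 ('D_(tl u) (local_rep A z.2 X) (cmap A z.2 z.2)).
Proof.
move=> hX; have zz := sa_center hA z.2.
have d := smooth_vf_at_differentiable hX zz.
pose c := cmap cA z z.
have cE : tl c = cmap A z.2 z.2 by rewrite /c cone_cmapE tl_cvec.
have d' : differentiable (local_rep A z.2 X) (tl c) by rewrite cE.
rewrite -cE -(derive_comp_tl u d').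
rewrite -(derive_linear_comp (cvec 0)); last first.
  exact: (differentiable_comp (tl_differentiable c) d').
apply: near_eq_derive.
have zz' : cdom cA z z by exact: zz.
apply: filterS (near_chart hcA zz' (near_cdom hcA zz')) => x [zx _ xE].
by rewrite -xE (local_rep_lift X zx) cone_cmapE tl_cvec.
Qed.

End ConeAtlas.

Section ChristoffelUniqueness.
Context {R : realFieldType} {V : Type}.
(** The algebraic core of the uniqueness of the Levi-Civita connection, for the difference of two
    candidates with the last index lowered. *)
Lemma sym_skew_eq0 (t : V -> V -> V -> R) :
  (forall x y z, t x y z = t y x z) -> (forall x y z, t x y z = - t x z y) ->
  forall x y z, t x y z = 0.
Proof.
move=> sym skew x y z.
have := sym x y z; have := sym y z x; have := sym z x y.
have := skew x y z; have := skew y z x; have := skew z x y; lra.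
Qed.

End ChristoffelUniqueness.

(** * The Levi-Civita connection of the cone metric *)

Section ConeConnection.
#[local] Opaque smooth_on derive smooth_vf_at smooth_fun_at smooth_vf smooth_fun.
Context {R : realType} {m : nat} {M : topologicalType} {A : charts R m M}.
Hypothesis hA : smooth_atlas A.
Context {g : M -> 'M[R]_m} {D : M -> 'rV[R]_m -> (M -> 'rV[R]_m) -> 'rV[R]_m}.
Hypothesis hg : pseudo_riemannian A g.
Hypothesis hD : levi_civita A g D.
Notation cA := (cone_charts A).
Notation cg := (cone_metric g).
Context {Dh : cone R M -> 'rV[R]_(1 + m) -> (cone R M -> 'rV[R]_(1 + m)) ->
  'rV[R]_(1 + m)}.
Hypothesis hDh : levi_civita cA cg Dh.
Implicit Types (z y : cone R M) (v w : 'rV[R]_m) (a b : R) (X Y : M -> 'rV[R]_m).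

Let hcA : smooth_atlas cA := smooth_atlas_cone hA.
Let hc := lc_connection hD.
Let hch := lc_connection hDh.
Let gC p v w : ip g p v w = ip g p w v.
Proof. by apply: ip_sym; exact: (Defs.metric_sym hg). Qed.

Lemma ip_cone z (u x : 'rV[R]_(1 + m)) :
  ip cg z u x = hd u * hd x + radius z ^+ 2 * ip g z.2 (tl u) (tl x).
Proof.
rewrite -{1}(cvecE u) -{1}(cvecE x) !cvec_rowE /ip /cone_metric.
rewrite mul_row_block tr_row_mx mul_row_col !mulmx0 addr0 add0r mulmx1.
rewrite mxE tr_scalar_mx -scalar_mxM mxE eqxx -scalemxAr -scalemxAl mxE.
by [].
Qed.

Lemma ip_cone_sym z (u x : 'rV[R]_(1 + m)) : ip cg z u x = ip cg z x u.
Proof. by rewrite !ip_cone mulrC gC. Qed.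

Lemma ip_cone_nondegenerate z (u : 'rV[R]_(1 + m)) :
  (forall x, ip cg z u x = 0) -> u = 0.
Proof.
move=> H; rewrite -(cvecE u).
have -> : hd u = 0.
  by have := H (cvec 1 0); rewrite ip_cone hd_cvec tl_cvec ip0r mulr0 addr0 mulr1.
have -> : tl u = 0.
  apply: (ip_nondegenerate (Defs.metric_nondegenerate hg z.2)) => w.
  have := H (cvec 0 w); rewrite ip_cone hd_cvec tl_cvec mulr0 add0r => /eqP.
  by rewrite mulf_eq0 sqrf_eq0 (negbTE (radius_neq0 z)) => /eqP.
exact: cvec0.
Qed.

(** The Christoffel symbols of dr^2 + r^2 g in the preferred chart; the [D] term contributes those
    of [M]. *)
Definition cone_christoffel z (u x : 'rV[R]_(1 + m)) : 'rV[R]_(1 + m) :=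
  cvec (- (radius z * ip g z.2 (tl u) (tl x)))
       ((radius z)^-1 *: (hd u *: tl x + hd x *: tl u) +
        D z.2 (tl u) (frame A z.2 (tl x))).

Let pp p : cdom A p p := sa_center hA p.
Let zz z : cdom cA z z := sa_center hA z.2.
Let hF p w : smooth_vf_at A p (frame A p w) := smooth_frame_at hA w (pp p).
Let hFc z u : smooth_vf_at cA z (frame cA z u) := smooth_frame_at hcA u (zz z).

(** First derivatives of the Gram matrix entries: the factor r^2 is differentiated along d/dr, the
    entries of [g] by metric compatibility of [D]. *)
Let dfun_ip_frame z (u x x' : 'rV[R]_(1 + m)) :
  dfun cA (fun y => ip cg y (frame cA z x y) (frame cA z x' y)) z u =
  2 * radius z * hd u * ip g z.2 (tl x) (tl x') +
  radius z ^+ 2 * (ip g z.2 (D z.2 (tl u) (frame A z.2 (tl x))) (tl x') +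
                   ip g z.2 (tl x) (D z.2 (tl u) (frame A z.2 (tl x')))).
Proof.
have [f fE] : exists f, f = fun q => ip g q (frame A z.2 (tl x) q) (frame A z.2 (tl x') q).
  by eexists.
have hf : smooth_fun_at A z.2 f.
  by rewrite fE; exact: (smooth_ip (metric_smooth hg) (hF _ _) (hF _ _)).
have dfE : dfun A f z.2 (tl u) =
    ip g z.2 (D z.2 (tl u) (frame A z.2 (tl x))) (tl x') +
    ip g z.2 (tl x) (D z.2 (tl u) (frame A z.2 (tl x'))).
  rewrite fE; apply: (etrans (dfun_ip hD _ (hF _ _) (hF _ _))).
  by rewrite !(frame_center hA).
have fz : f z.2 = ip g z.2 (tl x) (tl x') by rewrite fE !(frame_center hA).
have hr := smooth_radius hA z.
have hrr := smooth_fun_atM hcA hr hr.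
have hfc := smooth_fun_snd hA hf.
have hrf := smooth_fun_atM hcA hrr hfc.
have E : {near z, (fun y => ip cg y (frame cA z x y) (frame cA z x' y)) =1
    fun y => hd x * hd x' + radius y * radius y * f y.2}.
  apply: filterS (near_cdom hcA (zz z)) => y zy.
  have e1 := frame_cone hA x zy; have e2 := frame_cone hA x' zy.
  move: (frame cA z x y) (frame cA z x' y) e1 e2 => X1 X2 -> ->.
  by rewrite ip_cone !hd_cvec !tl_cvec expr2 fE.
apply: (etrans (dfun_eq hcA u E)).
apply: (etrans (dfunD hcA u (smooth_fun_at_cst cA z _) hrf)).
have -> : dfun cA (fun=> hd x * hd x') z u = 0 by exact: dfun_cst.
rewrite (dfunM hcA u hrr hfc) (dfunM hcA u hr hr) (dfun_radius A) (dfun_snd hA _ hf).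
by rewrite dfE fz; ring.
Qed.

(** [Dh] and the candidate are both symmetric in coordinate frames and compatible with the metric,
    so their difference [S], paired with a third vector, is killed by [sym_skew_eq0]. *)
Lemma cone_conn_frame z (u x : 'rV[R]_(1 + m)) :
  Dh z u (frame cA z x) = cone_christoffel z u x.
Proof.
have [S SE] : exists S, forall u x,
    S u x = Dh z u (frame cA z x) - cone_christoffel z u x.
  by exists (fun u x => Dh z u (frame cA z x) - cone_christoffel z u x).
suff : S u x = 0 by rewrite SE => /subr0_eq.
apply: (@ip_cone_nondegenerate z) => x'.
apply: (@sym_skew_eq0 R _ (fun u x x' => ip cg z (S u x) x')) => {u x x'} u x x'.
- have e1 : Dh z u (frame cA z x) = Dh z x (frame cA z u).
    have := conn_frame_sym hcA hDh u x (zz z).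
    by rewrite (frame_center hcA z u) (frame_center hcA z x).
  have e2 : cone_christoffel z u x = cone_christoffel z x u.
    rewrite /cone_christoffel gC (addrC (hd u *: _)).
    have := conn_frame_sym hA hD (tl u) (tl x) (pp z.2).
    by rewrite (frame_center hA _ (tl u)) (frame_center hA _ (tl x)) => ->.
  rewrite !SE; exact: (congr1 (fun u1 : 'rV[R]_(1 + m) => ip cg z u1 x')
    (congr2 (fun u1 u2 : 'rV[R]_(1 + m) => u1 - u2) e1 e2)).
- have := dfun_ip hDh u (hFc z x) (hFc z x'); rewrite dfun_ip_frame.
  rewrite !(frame_center hcA) (ip_cone_sym _ x) !SE !ipBl => H.
  (* [H] is metric compatibility of [Dh]; it remains to see that the candidate satisfies the same
     equation. *)
  suff : ip cg z (cone_christoffel z u x) x' + ip cg z (cone_christoffel z u x') x =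
      2 * radius z * hd u * ip g z.2 (tl x) (tl x') +
      radius z ^+ 2 * (ip g z.2 (D z.2 (tl u) (frame A z.2 (tl x))) (tl x') +
                   ip g z.2 (tl x) (D z.2 (tl u) (frame A z.2 (tl x')))) by lra.
  rewrite !ip_cone /cone_christoffel !hd_cvec !tl_cvec !ipDl !ipZl !ipDl !ipZl.
  rewrite (gC _ (tl x') (tl x)) (gC _ (tl x) (D _ _ _)).
  rewrite ?(gC _ (tl x) (tl u)) ?(gC _ (tl x') (tl u)).
  have := radius_neq0 z; move: (radius z) => r r0.
  by field.
Qed.

Lemma cone_conn_lift z a v X : smooth_vf_at A z.2 X ->
  Dh z (cvec a v) (cone_lift X) =
  cvec (- (radius z * ip g z.2 v (X z.2))) ((a / radius z) *: X z.2 + D z.2 v X).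
Proof.
move=> hX; rewrite (conn_christoffel hcA hch _ (smooth_lift hA hX)).
rewrite (conn_christoffel hA hc _ hX) (derive_local_rep_lift hA _ hX).
rewrite cone_conn_frame /cone_christoffel cone_liftE !hd_cvec !tl_cvec cvecD.
rewrite add0r scale0r addr0 scalerA (mulrC _ a); congr (cvec _ _).
by rewrite addrCA.
Qed.

Lemma cone_conn_radial z a v : Dh z (cvec a v) (@radial R m M) = cvec 0 ((radius z)^-1 *: v).
Proof.
have E : {near z, @radial R m M =1 frame cA z (cvec 1 0)}.
  apply: filterS (near_cdom hcA (zz z)) => y zy.
  by rewrite (frame_cone hA _ zy) hd_cvec tl_cvec /frame push0.
rewrite (conn_eq hcA hch _ E (smooth_radial hA z)) cone_conn_frame /cone_christoffel.
rewrite !hd_cvec !tl_cvec ip0r mulr0 oppr0 scaler0 add0r scale1r.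
have -> : frame A z.2 0 = fun q => 0 *: frame A z.2 0 q.
  by apply/funext => q; rewrite scale0r /frame push0.
by rewrite (conn_cscalef hc _ _ (hF _ _)) scale0r addr0.
Qed.

Definition euler z : 'rV[R]_(1 + m) := radius z *: radial z.

Lemma eulerE z : euler z = cvec (radius z) 0.
Proof. by rewrite /euler /radial cvecZ mulr1 scaler0. Qed.

Lemma smooth_euler z : smooth_vf_at cA z euler.
Proof. exact: (smooth_vf_atZ hcA (smooth_radius hA z) (smooth_radial hA z)). Qed.

Lemma cone_conn_euler z u : Dh z u euler = u.
Proof.
rewrite -[u]cvecE.
rewrite (conn_scalef hch _ (smooth_radius hA z) (smooth_radial hA z)).
rewrite cone_conn_radial (dfun_radius A) /radial hd_cvec !cvecZ cvecD.
by rewrite mulr1 mulr0 addr0 scaler0 add0r scalerA mulfV ?radius_neq0 // scale1r.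
Qed.

(** * The endomorphism nabla^ T and its covariant derivative *)

Section ConeEndomorphism.
Variable T : M -> 'rV[R]_m.
Hypothesis hT : forall p, smooth_vf_at A p T.

Let J := nabla D T.
Let JE p v : v *m J p = D p v T. Proof. exact: (nablaE hc v (hT p)). Qed.
Let hJ p : smooth_endo_at A J p. Proof. exact: (smooth_endo_nabla hA hc). Qed.
Let Jh := nabla Dh (cone_lift T).
Let hTl z : smooth_vf_at cA z (cone_lift T). Proof. exact: (smooth_lift hA (hT z.2)). Qed.
Let JhE z u : u *m Jh z = Dh z u (cone_lift T).
Proof. exact: (nablaE hch u (hTl z)). Qed.
Let hJh z : smooth_endo_at cA Jh z. Proof. exact: (smooth_endo_nabla hcA hch). Qed.

Lemma cone_endoE z a v : cvec a v *m Jh z =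
  cvec (- (radius z * ip g z.2 v (T z.2))) ((a / radius z) *: T z.2 + v *m J z.2).
Proof. by rewrite JhE (cone_conn_lift _ _ (hT z.2)) JE. Qed.

Lemma euler_endo z : euler z *m Jh z = cone_lift T z.
Proof.
rewrite eulerE cone_endoE ip0l mulr0 oppr0 mul0mx addr0 mulfV ?radius_neq0 //.
by rewrite scale1r cone_liftE.
Qed.

(** J^ maps the Euler field to the lift of [T], and nabla^ of the Euler field is the identity; both
    terms of [cov_endo] therefore equal [u *m Jh z]. *)
Lemma cov_endo_euler z u : cov_endo Dh Jh z u euler = 0.
Proof.
rewrite /cov_endo cone_conn_euler JhE.
have -> : (fun y => euler y *m Jh y) = cone_lift T.
  by apply/funext => y; rewrite euler_endo.
exact: subrr.
Qed.

Lemma cov_endo_radial z u : cov_endo Dh Jh z u (@radial R m M) = 0.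
Proof.
have := cov_endo_euler z u.
rewrite (cov_endo_scalef hch _ (hJh (z := z)) (smooth_radius hA z) (smooth_radial hA z)).
by move/eqP; rewrite scaler_eq0 (negbTE (radius_neq0 z)) => /eqP.
Qed.

Lemma cov_endo_lift z a v Y : smooth_vf_at A z.2 Y ->
  cov_endo Dh Jh z (cvec a v) (cone_lift Y) =
  cvec (- (radius z * (ip g z.2 (Y z.2) (v *m J z.2) + ip g z.2 v (Y z.2 *m J z.2))))
       (cov_endo D J z.2 v Y - ip g z.2 (Y z.2) (T z.2) *: v +
        ip g z.2 v (Y z.2) *: T z.2).
Proof.
move=> hY.
pose f q := ip g q (Y q) (T q).
have hf : smooth_fun_at A z.2 f := smooth_ip (metric_smooth hg) hY (hT z.2).
have dfE : dfun A f z.2 v = ip g z.2 (D z.2 v Y) (T z.2) + ip g z.2 (Y z.2) (v *m J z.2).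
  by rewrite JE; exact: (dfun_ip hD v hY (hT z.2)).
have hr := smooth_radius hA z.
have hfc := smooth_fun_snd hA hf.
have hrf := smooth_fun_atZ hcA (-1) (smooth_fun_atM hcA hr hfc).
have hYJ := hJ hY.
(* J^ Y splits into a function times d/dr and a lifted field, the two kinds of fields for which [Dh]
   is known. *)
have E : (fun y => cone_lift Y y *m Jh y) =
    (fun y => (-1 * (radius y * f y.2)) *: radial y +
              cone_lift (fun q => Y q *m J q) y).
  apply/funext => y; rewrite !cone_liftE cone_endoE /radial cvecZ cvecD mul0r scale0r.
  by rewrite add0r scaler0 add0r mulr1 addr0 mulN1r.
rewrite /cov_endo E.
rewrite (conn_addf hch _ (smooth_vf_atZ hcA hrf (smooth_radial hA z)) (smooth_lift hA hYJ)).
rewrite (conn_scalef hch _ hrf (smooth_radial hA z)).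
rewrite (dfunZ hcA _ _ (smooth_fun_atM hcA hr hfc)) (dfunM hcA _ hr hfc).
rewrite (dfun_radius A) (dfun_snd hA _ hf) hd_cvec tl_cvec dfE.
rewrite cone_conn_radial (cone_conn_lift _ _ hYJ) (cone_conn_lift _ _ hY) cone_endoE.
rewrite /radial !cvecZ !cvecD cvecN cvecD /f.
have r0 := radius_neq0 z.
congr (cvec _ _).
  by rewrite ipDl ipZl; move: (radius z) r0 => r r0; field.
rewrite mulmxDl -scalemxAl !scaler0 add0r scalerA.
move: (D z.2 v (fun q => Y q *m J q)) (D z.2 v Y *m J z.2) => d1 d2.
have -> : -1 * (radius z * ip g z.2 (Y z.2) (T z.2)) * (radius z)^-1 =
    - ip g z.2 (Y z.2) (T z.2) by field.
have -> : - (radius z * ip g z.2 v (Y z.2)) / radius z = - ip g z.2 v (Y z.2) by field.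
rewrite !scaleNr !opprD opprK.
move: (_ *: v) (_ *: T z.2) (_ *: (Y z.2 *m J z.2)) => A1 A2 A3.
by apply/rowP => j; rewrite !mxE; ring.
Qed.

End ConeEndomorphism.

End ConeConnection.

(** * Rank and signature *)

Section SkewEndomorphisms.
Context {R : fieldType} {n : nat}.
Implicit Types (G J : 'M[R]_n).

Lemma row_mulmx_inj k (B C : 'M[R]_(k, n)) :
  (forall u : 'rV[R]_k, u *m B = u *m C) -> B = C.
Proof. by move=> H; apply/row_matrixP => i; rewrite !rowE H. Qed.

Lemma form_eq (B C : 'M[R]_n) :
  (forall v w : 'rV[R]_n, (v *m B *m w^T) 0 0 = (v *m C *m w^T) 0 0) -> B = C.
Proof.
move=> H; apply/matrixP => i j.
have := H (delta_mx 0 i) (delta_mx 0 j).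
by rewrite !trmx_delta -!rowE -!colE !mxE.
Qed.

(** Skewness gives (J - 1) G = - G (J + 1)^T with [G] invertible, so J - 1 and J + 1 have equal
    rank. *)
Lemma skew_eigenspace_rank G J : G \in unitmx -> J *m G = - (G *m J^T) ->
  \rank (eigenspace J 1) = \rank (eigenspace J (-1)).
Proof.
move=> GU JG; rewrite /eigenspace !mxrank_ker; congr (_ - _)%N.
have Gf : row_free G by rewrite row_free_unit.
rewrite -(mxrankMfree _ Gf) mulmxBl mul_scalar_mx scale1r JG -opprD.
have -> : - (G *m J^T + G) = G *m (- (J + 1%:M)^T).
  have -> : (J + 1%:M)^T = J^T + 1%:M by rewrite linearD; congr (_ + _); exact: trmx1.
  by rewrite mulmxN mulmxDr mulmx1.
have GTf : row_full G by rewrite row_full_unit.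
rewrite (eqmxMfull _ GTf) mxrank_opp mxrank_tr.
by rewrite -[RHS]/(\rank (J - _)) raddfN opprK.
Qed.

End SkewEndomorphisms.

Section Signature.
Context {R : realFieldType}.

(** [X] and [Y] span isotropic subspaces in perfect duality, that is [r] hyperbolic planes with one
    negative and one positive direction each; [t] is the extra negative direction. *)
Lemma signature_of_hyperbolic_basis r m (G : 'M[R]_m) (t : 'rV[R]_m)
    (X Y : 'M[R]_(r, m)) :
  m = (1 + (r + r))%N -> G^T = G -> G \in unitmx ->
  t *m G *m t^T = (-1)%:M -> X *m G *m X^T = 0 -> Y *m G *m Y^T = 0 ->
  t *m G *m X^T = 0 -> t *m G *m Y^T = 0 ->
  row_free (col_mx t (col_mx X Y)) ->
  (r.+1 + r)%N = m /\
  exists2 P : 'M[R]_m, P \in unitmx &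
    P *m G *m P^T = diag_mx (\row_i (if (i < r.+1)%N then -1 else 1)).
Proof.
move=> mE; subst m => Gs GU tt XX YY tX tY Qf; split; first by rewrite addSn.
have tr_form k l (B : 'M[R]_(k, 1 + (r + r))) (C : 'M[R]_(l, 1 + (r + r))) :
    (B *m G *m C^T)^T = C *m G *m B^T by rewrite !trmx_mul trmxK Gs mulmxA.
have Xt : X *m G *m t^T = 0 by apply: trmx_inj; rewrite tr_form tX trmx0.
have Yt : Y *m G *m t^T = 0 by apply: trmx_inj; rewrite tr_form tY trmx0.
set Q := col_mx t (col_mx X Y) in Qf.
have QU : Q \in unitmx by rewrite -row_free_unit.
pose N := X *m G *m Y^T.
(* A row [u] killed by [N] makes [u *m X] orthogonal to the whole basis, hence zero, and the rows of
   [X] are free. *)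
have NU : N \in unitmx.
  rewrite -row_free_unit; apply: inj_row_free => u uN.
  have uXGQ : u *m X *m G *m Q^T = 0.
    rewrite /Q !tr_col_mx !mul_mx_row -!(mulmxA u) Xt XX -/N uN !mulmx0.
    by rewrite !row_mx0.
  have uX : u *m X = 0.
    apply: (can_inj (mulmxK GU)); rewrite mul0mx.
    apply: (can_inj (mulmxK (_ : Q^T \in unitmx))); first by rewrite unitmx_tr.
    by rewrite uXGQ mul0mx.
  have : row_mx 0 (row_mx u 0) *m Q = 0 :> 'rV_(1 + (r + r)).
    by rewrite /Q !mul_row_col !mul0mx uX !addr0.
  move=> /(congr1 (mulmx^~ (invmx Q))); rewrite mulmxK // mul0mx.
  by rewrite -[RHS]row_mx0 => /eq_row_mx[_]; rewrite -[X in _ = X -> _]row_mx0 => /eq_row_mx[].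
(* [Z] is the basis of the span of [Y] dual to [X], so that [X / 2 - Z] and
   [X / 2 + Z] are orthonormal of negative and positive type. *)
pose Z := (invmx N)^T *m Y.
have XZ : X *m G *m Z^T = 1%:M by rewrite /Z trmx_mul trmxK mulmxA mulmxV.
have ZX : Z *m G *m X^T = 1%:M by apply: trmx_inj; rewrite tr_form XZ trmx1.
have ZZ : Z *m G *m Z^T = 0.
  by rewrite /Z trmx_mul trmxK -!mulmxA (mulmxA Y) (mulmxA (Y *m G)) YY mul0mx mulmx0.
have tZ : t *m G *m Z^T = 0 by rewrite /Z trmx_mul trmxK mulmxA tY mul0mx.
have Zt : Z *m G *m t^T = 0 by rewrite /Z -!mulmxA (mulmxA Y) Yt mulmx0.
pose U1 := 2^-1 *: X - Z; pose U2 := 2^-1 *: X + Z.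
have half : (2^-1 : R) + 2^-1 = 1 by field.
(* For [a] and [b] equal to 1 or -1 the value is [a] if they agree and 0 otherwise: the blocks are
   orthonormal up to sign and mutually orthogonal. *)
have bil (a b : R) : (2^-1 *: X + a *: Z) *m G *m (2^-1 *: X + b *: Z)^T =
    ((a + b) * 2^-1)%:M.
  rewrite linearD !linearZ /= !mulmxDl !mulmxDr -!scalemxAl -!scalemxAr.
  rewrite XX XZ ZX ZZ !scaler0 add0r addr0 !scalerA.
  by rewrite -scalerDl scalemx1; congr (_%:M); ring.
have U1E : U1 = 2^-1 *: X + (-1) *: Z by rewrite scaleN1r.
have U2E : U2 = 2^-1 *: X + 1 *: Z by rewrite scale1r.
have tU a : t *m G *m (2^-1 *: X + a *: Z)^T = 0.
  by rewrite linearD !linearZ /= mulmxDr -!scalemxAr tX tZ !scaler0 addr0.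
have Ut a : (2^-1 *: X + a *: Z) *m G *m t^T = 0.
  by rewrite !mulmxDl -!scalemxAl Xt Zt !scaler0 addr0.
pose P := col_mx t (col_mx U1 U2).
pose d : 'rV[R]_(1 + (r + r)) := row_mx (const_mx (-1)) (row_mx (const_mx (-1)) (const_mx 1)).
have WW : col_mx U1 U2 *m G *m (col_mx U1 U2)^T =
    block_mx (-1)%:M 0 0 1%:M :> 'M[R]_(r + r).
  rewrite tr_col_mx mul_col_mx mul_col_row U1E U2E !bil.
  have -> : (-1 + -1) / 2 = -1 :> R by field.
  have -> : (1 + 1) / 2 = 1 :> R by field.
  have -> : (-1 + 1) / 2 = 0 :> R by field.
  have -> : (1 + -1) / 2 = 0 :> R by field.
  by rewrite raddf0.
have tW : t *m G *m (col_mx U1 U2)^T = 0.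
  by rewrite tr_col_mx mul_mx_row U1E U2E !tU row_mx0.
have Wt : col_mx U1 U2 *m G *m t^T = 0.
  by rewrite !mul_col_mx U1E U2E !Ut col_mx0.
have PE : P *m G *m P^T = diag_mx d.
  rewrite /P [in LHS]tr_col_mx mul_col_mx mul_col_row tt tW Wt WW.
  by rewrite /d !diag_mx_row !diag_const_mx.
(* [diag_mx d] is its own inverse, so [PE] exhibits a right inverse of [P]. *)
have dd : diag_mx d *m diag_mx d = 1%:M.
  rewrite mulmx_diag -(diag_const_mx _ (1 : R)); congr diag_mx.
  apply/rowP => i; rewrite !mxE; case: splitP => j _; rewrite !mxE ?mulrNN ?mulr1 //.
  by case: splitP => k _; rewrite !mxE ?mulrNN ?mulr1.
exists P.
  have : P *m (G *m P^T *m diag_mx d) = 1%:M by rewrite !mulmxA PE.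
  by case/mulmx1_unit.
rewrite PE; congr diag_mx; apply/rowP => i; rewrite !mxE.
case: splitP => [j ij|j ij]; rewrite !mxE; first by rewrite ij (ord1 j).
case: splitP => [k jk|k jk]; rewrite !mxE ij jk; first by rewrite add1n ltnS ltn_ord.
by rewrite add1n ltnS ltnNge leq_addr.
Qed.

End Signature.

(** [t] and bases of the two eigenspaces form a hyperbolic basis, so m = 2 r + 1. Writing [r] as
    [m./2] makes the signature visibly independent of the point. *)
Lemma para_sasakian_signature (R : realType) m (G J : 'M[R]_m) (t : 'rV[R]_m) :
  G^T = G -> G \in unitmx -> J *m G = - (G *m J^T) -> t *m G *m t^T = (-1)%:M ->
  t *m J = 0 -> (forall v, v *m J *m J = v + (v *m G *m t^T) 0 0 *: t) ->
  has_signature m./2.+1 m./2 G.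
Proof.
move=> Gs GU JG tt tJ JJ.
have rk := skew_eigenspace_rank GU JG.
set r := \rank (eigenspace J 1) in rk.
have [X [XE Xf]] : exists X : 'M[R]_(r, m), (X :=: eigenspace J 1)%MS /\ row_free X.
  by exists (row_base (eigenspace J 1)); split; [exact: eq_row_base|exact: row_base_free].
have [Y [YE Yf]] : exists Y : 'M[R]_(r, m), (Y :=: eigenspace J (-1))%MS /\ row_free Y.
  rewrite rk; exists (row_base (eigenspace J (-1))).
  by split; [exact: eq_row_base|exact: row_base_free].
have XJ : X *m J = X.
  have /eigenspaceP -> : (X <= eigenspace J 1)%MS by rewrite XE.
  exact: scale1r.
have YJ : Y *m J = - Y.
  have /eigenspaceP -> : (Y <= eigenspace J (-1))%MS by rewrite YE.
  exact: scaleN1r.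
have skew k l (B : 'M[R]_(k, m)) (C : 'M[R]_(l, m)) :
    B *m J *m G *m C^T = - (B *m G *m (C *m J)^T).
  by rewrite -!mulmxA (mulmxA J) JG mulNmx mulmxN trmx_mul !mulmxA.
have tr_form k l (B : 'M[R]_(k, m)) (C : 'M[R]_(l, m)) :
    (B *m G *m C^T)^T = C *m G *m B^T by rewrite !trmx_mul trmxK Gs mulmxA.
have self_opp k l (B : 'M[R]_(k, l)) : B = - B -> B = 0.
  move=> H; apply/matrixP => i j; have := congr1 (fun C : 'M[R]_(k, l) => C i j) H.
  by rewrite !mxE; lra.
have XX : X *m G *m X^T = 0 by apply: self_opp; rewrite -{1}XJ skew XJ.
have YY : Y *m G *m Y^T = 0.
  apply: self_opp; have := skew _ _ Y Y.
  by rewrite YJ !mulNmx linearN /= mulmxN opprK => ->.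
have Xt : X *m G *m t^T = 0 by rewrite -{1}XJ skew tJ trmx0 mulmx0 oppr0.
have Yt : Y *m G *m t^T = 0.
  have := skew _ _ Y t; rewrite YJ tJ trmx0 mulmx0 oppr0 !mulNmx => /eqP.
  by rewrite oppr_eq0 => /eqP.
have tX : t *m G *m X^T = 0 by apply: trmx_inj; rewrite tr_form Xt trmx0.
have tY : t *m G *m Y^T = 0 by apply: trmx_inj; rewrite tr_form Yt trmx0.
set Q := col_mx t (col_mx X Y).
(* Pairing a relation with [t] kills the coefficient of [t]; applying [J] then separates the two
   eigenspaces. *)
have Qf : row_free Q.
  apply: inj_row_free => u.
  rewrite -[u]hsubmxK -[rsubmx u]hsubmxK.
  set a := lsubmx u; set b := lsubmx _; set c := rsubmx _.
  rewrite /Q !mul_row_col => E0.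
  have a0 : a = 0.
    have := congr1 (fun v => v *m G *m t^T) E0.
    rewrite !mulmxDl -!mulmxA !(mulmxA _ G) tt Xt Yt !mulmx0 !addr0 !mul0mx.
    by rewrite mul_mx_scalar scaleN1r => /eqP; rewrite oppr_eq0 => /eqP.
  move: E0; rewrite a0 mul0mx add0r => E0.
  have E1 : b *m X - c *m Y = 0.
    have := congr1 (mulmx^~ J) E0.
    by rewrite mulmxDl -!mulmxA XJ YJ mulmxN mul0mx.
  have bX : b *m X = 0.
    apply: self_opp; apply/eqP; rewrite -addr_eq0; apply/eqP.
    by rewrite -[RHS](addr0 0) -{1}E0 -E1 addrACA subrr addr0.
  have cY : c *m Y = 0 by move: E0; rewrite bX add0r.
  have -> : b = 0 by apply: (row_free_inj Xf); rewrite bX mul0mx.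
  have -> : c = 0 by apply: (row_free_inj Yf); rewrite cY mul0mx.
  by rewrite !row_mx0.
have Qfull : row_full Q.
  rewrite -sub1mx; apply/row_subP => i; set v := row i _.
  have tQ : (t <= Q)%MS by rewrite /Q -addsmxE addsmxSl.
  have XQ : (X <= Q)%MS.
    by rewrite /Q -!addsmxE (submx_trans _ (addsmxSr _ _)) // -addsmxE addsmxSl.
  have YQ : (Y <= Q)%MS.
    by rewrite /Q -!addsmxE (submx_trans _ (addsmxSr _ _)) // -addsmxE addsmxSr.
  (* [w] is the part of [v] orthogonal to [t], on which J^2 = 1; it is half the sum of the
     eigenvectors w + J w and w - J w. *)
  have [w wD] : exists w, w = v + (v *m G *m t^T) 0 0 *: t by eexists.
  have wJJ : w *m J *m J = w by rewrite wD !mulmxDl -!scalemxAl tJ mul0mx scaler0 addr0 JJ.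
  have wp : ((w + w *m J)%R <= Q)%MS.
    apply: submx_trans XQ; rewrite XE; apply/eigenspaceP.
    by rewrite mulmxDl wJJ scale1r addrC.
  have wm : ((w - w *m J)%R <= Q)%MS.
    apply: submx_trans YQ; rewrite YE; apply/eigenspaceP.
    by rewrite mulmxBl wJJ scaleN1r opprB.
  have wE : w = 2^-1 *: ((w + w *m J) + (w - w *m J)).
    by apply/rowP => j; rewrite !mxE; field.
  have -> : v = w - (v *m G *m t^T) 0 0 *: t by rewrite wD addrK.
  rewrite addmx_sub // ?eqmx_opp ?scalemx_sub //.
  by rewrite wE scalemx_sub // addmx_sub.
have mE : m = (1 + (r + r))%N.
  by move: Qf Qfull; rewrite /row_free /row_full => /eqP -> /eqP.
have -> : m./2 = r by rewrite {1}mE add1n addnn /= uphalf_double.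
exact: (signature_of_hyperbolic_basis mE Gs GU tt XX YY tX tY Qf).
Qed.

(** * The correspondence *)

Section EigenDistributions.
Context {R : realType} {m : nat} {M : topologicalType}.

Lemma eigen_fullP (J : M -> 'M[R]_m) (s : R) p (v : 'rV[R]_m) :
  reflect (v *m J p = s *: v) (v <= eigen_distribution (fun=> 1%:M) J s p)%MS.
Proof.
rewrite /eigen_distribution sub_capmx submx1; exact: eigenspaceP.
Qed.

Lemma rank_eigen_full (J : M -> 'M[R]_m) (s : R) p :
  \rank (eigen_distribution (fun=> 1%:M) J s p) = \rank (eigenspace (J p) s).
Proof. by rewrite /eigen_distribution cap1mx. Qed.

End EigenDistributions.

Section ConeCorrespondence.
#[local] Opaque smooth_on derive smooth_vf_at smooth_fun_at smooth_vf smooth_fun.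
Context {R : realType} {m : nat} {M : topologicalType} {A : charts R m M}.
Hypothesis hA : smooth_atlas A.
Context {g : M -> 'M[R]_m} {D : M -> 'rV[R]_m -> (M -> 'rV[R]_m) -> 'rV[R]_m}.
Hypothesis hg : pseudo_riemannian A g.
Hypothesis hD : levi_civita A g D.
Notation cA := (cone_charts A).
Notation cg := (cone_metric g).
Context {Dh : cone R M -> 'rV[R]_(1 + m) -> (cone R M -> 'rV[R]_(1 + m)) ->
  'rV[R]_(1 + m)}.
Hypothesis hDh : levi_civita cA cg Dh.
Implicit Types (z y : cone R M) (v w : 'rV[R]_m) (a b : R) (T : M -> 'rV[R]_m)
  (u x : 'rV[R]_(1 + m)).

Let hcA : smooth_atlas cA := smooth_atlas_cone hA.
Let hc := lc_connection hD.
Let hch := lc_connection hDh.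
Let gC p v w : ip g p v w = ip g p w v.
Proof. by apply: ip_sym; exact: (Defs.metric_sym hg). Qed.

Lemma cone_metric_unit z : cg z \in unitmx.
Proof.
rewrite -row_free_unit; apply: inj_row_free => u uG.
apply: (ip_cone_nondegenerate hg (z := z)) => x.
by rewrite /ip uG mul0mx mxE.
Qed.

(** * From para-Sasakian structures to the cone *)

Section Forward.
Variable T : M -> 'rV[R]_m.
Hypothesis hT : forall p, smooth_vf_at A p T.
Hypothesis unit_T : forall p, ip g p (T p) (T p) = -1.
Hypothesis geodesic_T : forall p, D p (T p) T = 0.
Hypothesis skew : forall p v w, ip g p (D p v T) w + ip g p v (D p w T) = 0.
Hypothesis sq : @square_identity R m M g D T.
Hypothesis sasaki : @sasaki_equation R m M A g D T.

Let J := nabla D T.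
Let Jh := nabla Dh (cone_lift T).
Let hJh z : smooth_endo_at cA Jh z.
Proof. by apply: (smooth_endo_nabla hcA hch) => y; exact: (smooth_lift hA (hT y.2)). Qed.

Let TJ p : T p *m J p = 0.
Proof. by rewrite (nablaE hc _ (hT p)) geodesic_T. Qed.

Let JT p v : ip g p (v *m J p) (T p) = 0.
Proof. exact: (nabla_orthogonal hD hT geodesic_T skew). Qed.

Let Jskew p v w : ip g p (v *m J p) w = - ip g p v (w *m J p).
Proof. exact: (ip_nabla_skew hD hT skew). Qed.

Let endoE z a v : cvec a v *m Jh z =
  cvec (- (radius z * ip g z.2 v (T z.2))) ((a / radius z) *: T z.2 + v *m J z.2).
Proof. exact: (cone_endoE hA hg hD hDh hT). Qed.

(** The term g(v, T) T by which J^2 differs from the identity is cancelled by the image of the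
    d/dr-component. *)
Let Jh_square z u : u *m Jh z *m Jh z = u.
Proof.
rewrite -[u]cvecE !endoE; have r0 := radius_neq0 z; congr (cvec _ _).
  by rewrite ipDl ipZl unit_T JT; move: (radius z) r0 => r r0; field.
rewrite mulmxDl -scalemxAl TJ scaler0 add0r sq mulNr mulrAC mulfV // mul1r.
by rewrite scaleNr addrC addrK.
Qed.

Let Jh_skew z u x : ip cg z (u *m Jh z) x = - ip cg z u (x *m Jh z).
Proof.
rewrite -[u]cvecE -[x]cvecE !endoE !ip_cone !hd_cvec !tl_cvec.
rewrite !ipDl !ipDr !ipZl !ipZr (gC _ (T z.2)) Jskew.
by have := radius_neq0 z; move: (radius z) => r r0; field.
Qed.

Let Jh_parallel z u X : smooth_vf_at cA z X -> cov_endo Dh Jh z u X = 0.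
Proof.
move=> hX; have hJz := hJh (z := z).
have zz := sa_center hA z.2.
pose F := frame A z.2 (tl (X z)).
have hF : smooth_vf_at A z.2 F by exact: (smooth_frame_at hA _ zz).
have hFl := smooth_lift hA hF.
have hr := smooth_vf_atZ hcA (smooth_fun_at_cst cA z (hd (X z))) (smooth_radial hA z).
(* By tensoriality [X] is replaced by a constant multiple of d/dr plus the lift of a frame field,
   with the same value at [z]. *)
have -> : cov_endo Dh Jh z u X =
    cov_endo Dh Jh z u (fun y => hd (X z) *: radial y + cone_lift F y).
  apply: (cov_endo_tensorial hcA hch _ hJz hX (smooth_vf_atD hcA hr hFl)).
  rewrite /radial cvecZ cone_liftE /F (frame_center hA) cvecD mulr1 scaler0.
  by rewrite addr0 add0r cvecE.
rewrite (cov_endoDf hch _ hJz hr hFl).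
rewrite (cov_endoZf hch _ _ hJz (smooth_radial hA z)).
rewrite (cov_endo_radial hA hg hD hDh hT) scaler0 add0r -[u]cvecE.
rewrite (cov_endo_lift hA hg hD hDh hT _ _ hF) sasaki /F (frame_center hA).
have V0 (a1 a2 : 'rV[R]_m) : a1 - a2 - a1 + a2 = 0 by rewrite addrAC subrK subrr.
rewrite V0 (gC _ (tl (X z)) (tl u *m _)) Jskew addNr mulr0 oppr0.
exact: cvec0.
Qed.

Lemma para_kahler_cone : para_kahler cA cg Dh Jh.
Proof.
(* Integrability comes from parallelism: with nabla^ J^ = 0, [eigen_bracket] says that the bracket
   is again an eigenvector. *)
have inv s : involutive_distribution cA (eigen_distribution (fun=> 1%:M) Jh s).
  move=> U X Y oU UX UY secX secY z Uz.
  have nU : \forall y \near z, U y by exact: open_nbhs_nbhs.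
  have hX := smooth_vf_atI oU Uz UX; have hY := smooth_vf_atI oU Uz UY.
  have nX : {near z, (fun y => X y *m Jh y) =1 fun y => s *: X y}.
    by apply: filterS nU => y Uy; apply/eigen_fullP; exact: secX.
  have nY : {near z, (fun y => Y y *m Jh y) =1 fun y => s *: Y y}.
    by apply: filterS nU => y Uy; apply/eigen_fullP; exact: secY.
  have := eigen_bracket hcA hDh (hJh (z := z)) hX hY nX nY.
  rewrite (Jh_parallel _ hX) (Jh_parallel _ hY) subrr => E.
  by apply/eigen_fullP; rewrite (subr0_eq (esym E)).
split; first split.
- split.
  + by move=> z; exact: submx1.
  + by move=> z; apply: row_mulmx_inj => u; rewrite mul1mx mulmxA Jh_square mulmx1.
  + move=> z; rewrite !rank_eigen_full.
    apply: (skew_eigenspace_rank (cone_metric_unit z)); apply: form_eq => u x.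
    have := Jh_skew z u x; rewrite /ip trmx_mul !mulmxA => ->.
    by rewrite mulmxN mulNmx [in RHS]mxE !mulmxA.
  + move=> U X oU UX _; apply: smooth_vf_atP => z Uz.
    exact: (hJh (smooth_vf_atI oU Uz UX)).
- exact: inv.
- exact: inv.
- by move=> z u x; rewrite Jh_skew Jh_square.
- move=> U z u X oU Uz UX.
  by apply/subr0_eq; exact: (Jh_parallel u (smooth_vf_atI oU Uz UX)).
Qed.

End Forward.

Lemma para_sasakian_to_kahler T : para_sasakian A g D T ->
  para_kahler cA cg Dh (nabla Dh (cone_lift T)).
Proof.
move=> [_ smT unT geT kT [[_ invT _ _] invP invN]].
have hT p : smooth_vf_at A p T by exact: (smooth_vf_atI openT).
have skew := (killing_skew hA hD hT).1 kT.
have sq : @square_identity R m M g D T.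
  apply: (square_identity_orthogonal hD hT unT geT) => p v vT.
  have /submxP[c ->] : (v <= orthogonal_distribution g T p)%MS.
    exact/orthogonal_distributionP.
  by rewrite -[in RHS](invT p) !mulmxA.
apply: (para_kahler_cone hT unT geT skew sq).
exact: (sasaki_equation_of_involutive hA hg hD hT unT geT skew sq invP invN).
Qed.

(** * From para-Kaehler structures on the cone back to [M] *)

Section Backward.
Variable Jh : cone R M -> 'M[R]_(1 + m).
Hypothesis hK : para_kahler cA cg Dh Jh.

Let That z := euler z *m Jh z.

Let Jh_square z u : u *m Jh z *m Jh z = u.
Proof.
have [[[_ H _ _] _ _] _ _] := hK.
have H1 : 1%:M *m Jh z *m Jh z = 1%:M := H z.
by rewrite mul1mx in H1; rewrite -mulmxA H1 mulmx1.
Qed.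

Let Jh_skew z u x : ip cg z (u *m Jh z) x = - ip cg z u (x *m Jh z).
Proof. by rewrite -{1}(Jh_square z x) (pk_anti_isometry hK). Qed.

Let hJh z : smooth_endo_at cA Jh z.
Proof.
move=> X hX; have [[[_ _ _ H] _ _] _ _] := hK.
have [U [oU Uz UX _]] := smooth_vf_at2 hX hX.
apply: (smooth_vf_atI oU Uz); apply: H => // y _; exact: submx1.
Qed.

Let smooth_That z : smooth_vf_at cA z That.
Proof. exact: (hJh (smooth_euler hA z)). Qed.

Let conn_parallel z u X : smooth_vf_at cA z X ->
  Dh z u (fun y => X y *m Jh y) = Dh z u X *m Jh z.
Proof.
move=> hX; have [U [oU Uz UX _]] := smooth_vf_at2 hX hX.
exact: (pk_parallel hK) UX.
Qed.

Let conn_That z u : Dh z u That = u *m Jh z.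
Proof.
by rewrite (conn_parallel u (smooth_euler hA z)) (cone_conn_euler hA hg hD hDh).
Qed.

(** Skewness of [Jh] makes the image of the Euler field orthogonal to the Euler field, which is a
    nonzero multiple of d/dr. *)
Let hd_That z : hd (That z) = 0.
Proof.
have := Jh_skew z (euler z) (euler z).
rewrite (ip_cone_sym hg _ (euler z)) -/(That z) => H.
have {H} : ip cg z (That z) (euler z) = 0 by lra.
rewrite ip_cone eulerE hd_cvec tl_cvec ip0r mulr0 addr0 => /eqP.
by rewrite mulf_eq0 (negbTE (radius_neq0 z)) orbF => /eqP.
Qed.

Let one : @pos_reals R := exist _ 1 (mem_set ltr01).

Let T p := tl (That (one, p)).

(** [conn_That] along d/dr equals [That] divided by r, and so does the Christoffel part of the same
    derivative; nothing is left for the derivative of the components. *)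
Let derive_That_radial z :
  'D_(cvec 1 0) (local_rep cA z That) (cmap cA z z) = 0.
Proof.
have := conn_christoffel hcA hch (cvec 1 0) (smooth_That z).
rewrite conn_That (cone_conn_frame hA hg hD hDh) /cone_christoffel hd_cvec tl_cvec.
rewrite ip0l mulr0 oppr0 scale1r scaler0 addr0 (conn0v hc) ?addr0; last first.
  exact: (smooth_frame_at hA _ (sa_center hA z.2)).
have -> : cvec 1 0 *m Jh z = cvec 0 ((radius z)^-1 *: tl (That z)).
  have -> : cvec 1 0 = (radius z)^-1 *: euler z :> 'rV[R]_(1 + m).
    by rewrite eulerE cvecZ mulVf ?radius_neq0 // scaler0.
  rewrite -scalemxAl -/(That z) -{1}(cvecE (That z)) hd_That cvecZ.
  by rewrite mulr0.
by move=> H; apply: (@addIr _ (cvec 0 ((radius z)^-1 *: tl (That z)))); rewrite -H add0r.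
Qed.

(** The charts around [(s, p)] and [(t, p)] differ only in the default value of [insubd] at
    nonpositive radius. *)
Let local_rep_slice (s t : @pos_reals R) p X (u : 'rV[R]_(1 + m)) : 0 < hd u ->
  local_rep cA (s, p) X u = local_rep cA (t, p) X u.
Proof.
move=> u0; rewrite /local_rep.
have -> : cinv cA (s, p) u = cinv cA (t, p) u.
  apply: radius_inj; first by rewrite !radius_cinv.
  by rewrite !cone_cinvE.
by [].
Qed.

(** The chart around [(one, p)] covers the whole ray over [p]; each component has zero radial
    derivative there, and the mean value theorem compares any two radii. *)
Let That_const s p : That (s, p) = That (one, p).
Proof.
pose c := cmap A p p.
have pp : cdom A p p := sa_center hA p.
have lE r : local_rep cA (one, p) That (cvec (radius (r, p)) c) = That (r, p).
  have d : cdom cA (one, p) (r, p) by exact: pp.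
  have -> : cvec (radius (r, p)) c = cmap cA (one, p) (r, p) by rewrite cone_cmapE.
  have d' : cdom cA (r, p) (r, p) by exact: pp.
  rewrite (local_repE hcA _ d) (push_cone hA _ d' d) /= (push_id hA _ pp).
  exact: cvecE.
have rE (r : R) : 0 < r -> exists2 r' : @pos_reals R, radius (r', p) = r &
    cvec r c = cmap cA (r', p) (r', p).
  move=> r0; exists (insubd one r); first exact: radius_insubd.
  by rewrite cone_cmapE radius_insubd.
have sm j (r : R) : 0 < r ->
    differentiable (fun u => local_rep cA (one, p) That u 0 j : R^o) (cvec r c) /\
    'D_(cvec 1 0) (fun u => local_rep cA (one, p) That u 0 j : R^o) (cvec r c) = 0.
  move=> r0; have [r' r'E cE] := rE r r0.
  have hT' := smooth_That (r', p).
  have d : cdom cA (one, p) (r', p) by exact: pp.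
  have df : differentiable (local_rep cA (one, p) That) (cvec r c).
    rewrite -r'E; have -> : cvec (radius (r', p)) c = cmap cA (one, p) (r', p).
      by rewrite cone_cmapE.
    exact: smooth_vf_at_differentiable.
  split.
    apply: (@differentiable_comp _ _ _ _ (local_rep cA (one, p) That)
      (fun v : 'rV[R]_(1 + m) => v 0 j : R^o)) => //.
    exact: differentiable_coord.
  rewrite (derive_coord _ j df).
  suff -> : 'D_(cvec 1 0) (local_rep cA (one, p) That) (cvec r c) = 0 by rewrite mxE.
  rewrite -(derive_That_radial (r', p)) -cE; apply: near_eq_derive.
  have : nbhs (cvec r c) (hd @^-1` [set t : R | 0 < t]).
    apply: (@hd_continuous R m (cvec r c)).
    by apply: open_nbhs_nbhs; split; [exact: open_gt|rewrite /= hd_cvec].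
  by apply: filterS => u u0; exact: local_rep_slice.
have const_le (r1 r2 : @pos_reals R) : radius (r1, p) < radius (r2, p) ->
    That (r2, p) = That (r1, p).
  move=> r12; rewrite -(lE r1) -(lE r2).
  have h0 : 0 < radius (r2, p) - radius (r1, p) by rewrite subr_gt0.
  have lineE (t : R) : cvec (radius (r1, p)) c + t *: cvec 1 0 = cvec (radius (r1, p) + t) c.
    by rewrite cvecZ cvecD mulr1 scaler0 addr0.
  apply/rowP => j.
  have pos (t : R) : 0 <= t -> 0 < radius (r1, p) + t.
    by move=> t0; rewrite ltr_wpDr // radius_gt0.
  have [t /andP[t0 _]|t /andP[t0 _]] := @mvt_line R _
    (fun u => local_rep cA (one, p) That u 0 j) (cvec (radius (r1, p)) c) (cvec 1 0) _ h0.
    by rewrite lineE; have [] := sm j _ (pos t t0).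
  rewrite !lineE (proj2 (sm j _ (pos t t0))) mul0r [_ + (_ - _)]addrC subrK.
  by move/subr0_eq.
have [H|H|/eqP H] := ltgtP (radius (s, p)) (radius (one, p)).
- by rewrite (const_le _ _ H).
- exact: const_le.
- by congr That; apply: radius_inj => //; exact/eqP.
Qed.

Let That_lift : That = cone_lift T.
Proof.
apply/funext => -[s p]; rewrite cone_liftE -[LHS]cvecE hd_That.
by rewrite (That_const s p).
Qed.

(** In charts [T] is the smooth field [That] composed with the inclusion of the slice r = 1,
    followed by a linear projection. *)
Let hT p : smooth_vf_at A p T.
Proof.
apply: (smooth_vf_atI openT) => // q.
have oI := @open_cimg _ _ _ _ hA q _ openT.
have S1 := smooth_onD oI (smooth_on_cst _ (cvec 1 0))
  (smooth_on_linear (cvec 0) oI (smooth_on_id oI)).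
have sub v : cimg A q setT v -> cimg cA (one, q) setT (cvec 1 0 + cvec 0 v).
  move=> [x [qx _] <-]; exists (one, x) => //.
  by rewrite cone_cmapE cvecD addr0 add0r /radius set_valE.
have ST : smooth_vf cA setT That by apply: smooth_vf_atP => z _.
have S2 := smooth_on_comp oI sub S1 (ST (one, q)).
apply: (smooth_on_eq oI _ (smooth_on_linear tl oI S2)) => _ [x [qx _] <-].
have d : cdom cA (one, q) (one, x) by exact: qx.
have -> : cvec 1 0 + cvec 0 (cmap A q x) = cmap cA (one, q) (one, x).
  by rewrite cone_cmapE cvecD addr0 add0r /radius set_valE.
by rewrite That_lift (local_rep_lift hA T d) /= tl_cvec.
Qed.

Lemma para_kahler_to_sasakian : exists2 T, para_sasakian A g D T &
  nabla Dh (cone_lift T) = Jh.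
Proof.
have JhE : nabla Dh (cone_lift T) = Jh.
  apply/funext => z; apply: row_mulmx_inj => u.
  by rewrite (nablaE hch _ (smooth_lift hA (hT z.2))) -That_lift conn_That.
exists T; last exact: JhE.
pose J := nabla D T.
have endoE z a v : cvec a v *m Jh z =
    cvec (- (radius z * ip g z.2 v (T z.2))) ((a / radius z) *: T z.2 + v *m J z.2).
  by rewrite -JhE; exact: (cone_endoE hA hg hD hDh hT).
have sqE p a v := Jh_square (one, p) (cvec a v).
have r1 p : radius (one, p) = 1 by rewrite /radius set_valE.
(* The two components of J^^2 = 1 on the slice r = 1: the vector (1, 0) gives the unit length of T
   and the geodesic equation, the vector (0, v) gives [square_identity]. *)
have comp p a v : - ip g p (a *: T p + v *m J p) (T p) = a /\
    - ip g p v (T p) *: T p + (a *: T p + v *m J p) *m J p = v.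
  have := sqE p a v; rewrite !endoE !r1 !mul1r invr1 !mulr1 /= => /cvec_inj.
  exact.
have unT p : ip g p (T p) (T p) = -1.
  by have [+ _] := comp p 1 0; rewrite mul0mx addr0 scale1r => <-; rewrite opprK.
have geT p : D p (T p) T = 0.
  have [_] := comp p 1 0; rewrite ip0l oppr0 scale0r add0r mul0mx addr0 scale1r.
  by rewrite (nablaE hc _ (hT p)).
have sq : @square_identity R m M g D T.
  move=> p v; have [_] := comp p 0 v; rewrite scale0r add0r scaleNr => {2}<-.
  by rewrite addrAC addNr add0r.
have skew p v w : ip g p (D p v T) w + ip g p v (D p w T) = 0.
  have := Jh_skew (one, p) (cvec 0 v) (cvec 0 w).
  rewrite !endoE !ip_cone !hd_cvec !tl_cvec r1 !(mul0r, mulr0, scale0r, add0r).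
  rewrite expr1n !mul1r /J /= !(nablaE hc _ (hT p)) => ->.
  by rewrite addNr.
have S : @sasaki_equation R m M A g D T.
  move=> p x y; pose z : cone R M := (one, p).
  have hF : smooth_vf_at A z.2 (frame A p y).
    exact: (smooth_frame_at hA y (sa_center hA p)).
  have := cov_endo_lift hA hg hD hDh hT 0 x hF.
  rewrite JhE {1}/cov_endo (conn_parallel _ (smooth_lift hA hF)) subrr -cvec0.
  move=> /cvec_inj[_] /= /esym; rewrite (frame_center hA) => H.
  by apply: subr0_eq; rewrite opprB addrA addrAC.
have Jskew p v w : ip g p (v *m J p) w = - ip g p v (w *m J p).
  exact: (ip_nabla_skew hD hT skew).
have JG p : J p *m g p = - (g p *m (J p)^T).
  apply: form_eq => v w; have := Jskew p v w; rewrite /ip trmx_mul !mulmxA => ->.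
  by rewrite mulmxN mulNmx [in RHS]mxE !mulmxA.
have JT p v : ip g p (v *m J p) (T p) = 0.
  exact: (nabla_orthogonal hD hT geT skew).
(* Eigenvectors for 1 and -1 lie in the image of [J], hence in the orthogonal complement of [T];
   intersecting with that distribution changes nothing. *)
have rankE p s : s = 1 \/ s = -1 ->
    \rank (eigen_distribution (orthogonal_distribution g T) J s p) =
    \rank (eigenspace (J p) s).
  move=> hs; rewrite /eigen_distribution; apply/eqmx_rank/eqmxP/capmx_idPr.
  apply/rV_subP => v /eigenspaceP vJ; apply/orthogonal_distributionP.
  have := JT p v; rewrite vJ ipZl => /eqP; rewrite mulf_eq0.
  by case: hs => ->; rewrite ?oppr_eq0 oner_eq0 => /eqP.
split.
- exists m./2 => p; apply: (@para_sasakian_signature R m (g p) (J p) (T p)).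
  + exact: (Defs.metric_sym hg).
  + exact: (Defs.metric_nondegenerate hg).
  + exact: JG.
  + by rewrite [LHS]mx11_scalar; congr (_%:M); exact: unT.
  + by rewrite (nablaE hc _ (hT p)).
  + by move=> v; exact: sq.
- by apply: smooth_vf_atP => p _.
- exact: unT.
- exact: geT.
- exact/(killing_skew hA hD hT).
- split; first split.
  + move=> p; apply/row_subP => i; rewrite row_mul.
    by apply/orthogonal_distributionP; exact: JT.
  + move=> p; apply/row_matrixP => i; rewrite 2!row_mul.
    have /orthogonal_distributionP H : (row i (orthogonal_distribution g T p) <=
      orthogonal_distribution g T p)%MS by exact: row_sub.
    by rewrite sq H scale0r addr0.
  + move=> p; rewrite !rankE; [|by right|by left].
    exact: (skew_eigenspace_rank (Defs.metric_nondegenerate hg p)).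
  + move=> U X oU UX _; apply: smooth_vf_atP => p Up.
    exact: (smooth_endo_nabla hA hc hT (smooth_vf_atI oU Up UX)).
  + by apply: (eigen_involutive hA hg hD hT geT skew _ sq S); left.
  + by apply: (eigen_involutive hA hg hD hT geT skew _ sq S); right.
Qed.

End Backward.

(** [T] is recovered as the image of the Euler field on the slice r = 1. *)
Lemma cone_lift_nabla_inj T T' :
  (forall p, smooth_vf_at A p T) -> (forall p, smooth_vf_at A p T') ->
  nabla Dh (cone_lift T) = nabla Dh (cone_lift T') -> T = T'.
Proof.
move=> hT hT' E; apply/funext => p.
pose z : cone R M := (exist _ 1 (mem_set ltr01), p).
have := euler_endo hA hg hD hDh hT z; rewrite E (euler_endo hA hg hD hDh hT').
by rewrite !cone_liftE => /cvec_inj[_].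
Qed.

End ConeCorrespondence.

Lemma smooth_atlas_of_manifold (R : realType) m (M : topologicalType)
    (A : charts R m M) : connected_manifold A -> smooth_atlas A.
Proof. by move=> [_ _ _ *]; split. Qed.

Theorem theorem8p1 (R : realType) (m : nat) (M : topologicalType)
    (A : charts R m M) (g : M -> 'M[R]_m)
    (D : M -> 'rV[R]_m -> (M -> 'rV[R]_m) -> 'rV[R]_m)
    (Dh : cone R M -> 'rV[R]_(1 + m) -> (cone R M -> 'rV[R]_(1 + m)) ->
          'rV[R]_(1 + m)) :
  connected_manifold A ->
  pseudo_riemannian A g ->
  levi_civita A g D ->
  levi_civita (cone_charts A) (cone_metric g) Dh ->
  set_bij [set T : M -> 'rV[R]_m | para_sasakian A g D T]
          [set J : cone R M -> 'M[R]_(1 + m) |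
             para_kahler (cone_charts A) (cone_metric g) Dh J]
          (fun T => nabla Dh (cone_lift T)).
Proof.
move=> /smooth_atlas_of_manifold hA hg hD hDh.
have smT T : para_sasakian A g D T -> forall p, smooth_vf_at A p T.
  by move=> [_ smT _ _ _ _] p; exact: (smooth_vf_atI openT).
split.
- by move=> T hT; exact: (para_sasakian_to_kahler hA hg hD hDh hT).
- move=> T T' /set_mem hT /set_mem hT' E.
  exact: (cone_lift_nabla_inj hA hg hD hDh (smT T hT) (smT T' hT') E).
- move=> J hJ; have [T hT TJ] := para_kahler_to_sasakian hA hg hD hDh hJ.
  by exists T.
Qed.
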